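(* Let $D$ be a distribution over $\mathbb{R}^d$ satisfying the Slow Fourier Decay (SFD) property with constants $c_1,c_2\ge0$, i.e. $\inf_{t:\|t\|_2\le T}|\phi_D(t)|\gtrsim d^{-c_1}T^{-c_2}$ for all $T\ge 1$. Let $\mathcal M=\sum_{j\in[k]}w_jD(\mu_j)$ be a mixture of $k$ translates of $D$ with means $\mu_1,\dots,\mu_k\in\mathbb{R}^d$ and weights $w_j>0$, $\sum_j w_j=1$. Let $\gamma=\min_{j'\neq j}\|\mu_{j'}-\mu_j\|_2>0$, $w_{\min}=\min_j w_j$ and $B=\max_j\|\mu_j\|_2$. There is an algorithm that, given $\varepsilon,\delta\in(0,1)$ and $n$ i.i.d. samples from $\mathcal M$, computes a list $\{(\widehat w_j,\widehat\mu_j)\}_{j\in[k]}$ such that, with probability at least $1-\delta$, there is a permutation $\pi$ of $[k]$ with $$\max_{j\in[k]}\|\mu_j-\widehat\mu_{\pi(j)}\|_2\le\varepsilon,\qquad \max_{j\in[k]}|w_j-\widehat w_{\pi(j)}|\le\varepsilon.$$ The sample complexity is $n=\widetilde O\!\left(\frac{\mathrm{poly}_{c_1,c_2}(d,1/\gamma)\,B^2\log(1/\delta)}{w_{\min}^2\varepsilon^2}\right)$ and the running time is $\mathrm{poly}(n)$.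
   Context: $\phi_D(t)=\mathbb{E}_{X\sim D}[e^{i\langle t,X\rangle}]$ is the characteristic function. $D(\mu)$ denotes the translate of $D$ with mean (location) $\mu$, i.e. the law of $X+\mu$ for $X\sim D$ where $D$ is centered, so $\phi_{D(\mu)}(t)=e^{i\langle t,\mu\rangle}\phi_D(t)$. The symbol $\gtrsim$ hides an absolute positive constant; $\mathrm{poly}_{c_1,c_2}$ denotes a polynomial whose degree depends on $c_1,c_2$; $\widetilde O$ hides polylogarithmic factors.
   Formalization: The factor log(1/δ) in the sample complexity is read as log(2/δ), since log(1/δ) vanishes as δ→1 and the bound then fails; for δ bounded away from 1 only the constant changes. D is known through φ_D, and running time counts unit-cost real-number operations. *)

(* Defs.v *)
From HB Require Import structures.
From mathcomp Require Import all_boot all_order all_algebra.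
From mathcomp Require Import all_classical all_reals all_analysis.
From mathcomp Require Import perm complex.

Set Implicit Arguments.
Unset Strict Implicit.
Unset Printing Implicit Defensive.

Import Order.TTheory GRing.Theory Num.Theory.

Local Open Scope classical_set_scope.
Local Open Scope ring_scope.
Local Open Scope complex_scope.

(* [R^d] is [d.-tuple R] with the product (= Borel) sigma-algebra. *)

Section Euclidean.
Variables (R : realType) (d : nat).
Implicit Types x y t : d.-tuple R.

Definition vadd x y : d.-tuple R := [tuple tnth x i + tnth y i | i < d].
Definition vsub x y : d.-tuple R := [tuple tnth x i - tnth y i | i < d].
Definition inner x y : R := \sum_(i < d) tnth x i * tnth y i.
Definition norm2 x : R := Num.sqrt (inner x x).

End Euclidean.

Definition is_min (R : realType) (S : set R) (m : R) : Prop := S m /\ lbound S m.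
Definition is_max (R : realType) (S : set R) (m : R) : Prop := S m /\ ubound S m.

Section Mixtures.
Variables (R : realType) (d : nat).
Implicit Type D : probability (d.-tuple R) R.

(* E[e^{i<t,X>}] = E[cos <t,X>] + i E[sin <t,X>] *)
Definition charfun D (t : d.-tuple R) : R[i] :=
  (Rintegral D setT (fun x => cos (inner t x)))
    +i* (Rintegral D setT (fun x => sin (inner t x))).

(* [c0] is the absolute constant hidden by the symbol [\gtrsim]. *)
Definition slow_fourier_decay (c0 c1 c2 : R) D : Prop :=
  forall T : R, 1 <= T ->
    c0 * d%:R `^ (- c1) * T `^ (- c2)
      <= inf [set Normc.normc (charfun D t) | t in [set t | norm2 t <= T]].

(* D(m), the law of X + m for X ~ D.  "Centered" only fixes which member of
   the translation family has location 0 (D need not have a mean), so it is not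
   a condition on D. *)
Definition translate D (m : d.-tuple R) : set (d.-tuple R) -> \bar R :=
  pushforward D (fun x => vadd x m).

Definition mixture D (k : nat) (w : 'I_k -> R) (mu : 'I_k -> d.-tuple R) :
    set (d.-tuple R) -> \bar R :=
  fun A => (\sum_(j < k) (w j)%:E * translate D (mu j) A)%E.

Definition separations (k : nat) (mu : 'I_k -> d.-tuple R) : set R :=
  [set r | exists j j' : 'I_k, j' != j /\ r = norm2 (vsub (mu j') (mu j))].

End Mixtures.

Definition mutually_independent (R : realType) (disp : measure_display)
    (Omega : measurableType disp) (P : probability Omega R)
    (I : eqType) (E : I -> set_system Omega) : Prop :=
  forall (J : seq I) (A : I -> set Omega), uniq J ->
    (forall i, i \in J -> E i (A i)) ->
    fine (P (\bigcap_(i in [set` J]) A i)) = \prod_(i <- J) fine (P (A i)).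

Definition events_of (disp disp' : measure_display)
    (Omega : measurableType disp) (T : measurableType disp')
    (X : Omega -> T) : set_system Omega :=
  [set E | exists2 A, measurable A & E = X @^-1` A].

(* The [X i] are i.i.d. samples from [M]; the [U l] are i.i.d. uniform on
   [0,1] (the internal randomness of the algorithm), independent of the
   samples. *)
Definition iid_samples_and_coins (R : realType) (disp : measure_display)
    (Omega : measurableType disp) (P : probability Omega R) (d n : nat)
    (M : set (d.-tuple R) -> \bar R)
    (X : 'I_n -> {RV P >-> d.-tuple R}) (U : nat -> {RV P >-> R}) : Prop :=
  [/\ forall i A, measurable A -> distribution P (X i) A = M A,
      forall l A, measurable A ->
        distribution P (U l) A = uniform_prob (@ltr01 R) A
    & mutually_independent P
        (fun z : 'I_n + nat =>
           match z with inl i => events_of (X i) | inr l => events_of (U l) end)].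

(* Algorithms are programs of a unit-cost real RAM: finitely many natural
   number variables, an array of real cells indexed by natural numbers, exact
   real arithmetic with elementary functions, comparisons, read access to the
   samples, uniform random coins, and an oracle for the characteristic function
   of the known distribution [D].  A program is a finite syntactic object whose
   only constants are natural numbers; reals cannot be rounded to naturals, and
   naturals cannot be multiplied in one step. *)

Inductive nexp : Type :=
| NConst of nat
| NVar of nat
| NAdd of nexp & nexp
| NSub of nexp & nexp.

Inductive rexp : Type :=
| RNat of nexp
| RCell of nexp
| RSample of nexp & nexp
| RAdd of rexp & rexp
| RSub of rexp & rexp
| RMul of rexp & rexp
| RDiv of rexp & rexp
| RSqrt of rexp
| RExp of rexp
| RLn of rexp
| RSin of rexp
| RCos of rexp
| RAtan of rexp.

Inductive test : Type :=
| NLt of nexp & nexp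
| RLt of rexp & rexp.

Inductive program : Type :=
| Skip
| SetN of nat & nexp
| SetR of nexp & rexp
| Coin of nexp
| Query of nexp & nexp
| Seq of program & program
| If of test & program & program
| While of test & program.

Section Semantics.
Variables (R : realType) (d : nat).
Variable sample : nat -> nat -> R.    (* sample i j : j-th coordinate of sample i *)
Variable coin : nat -> R.
Variable phi : d.-tuple R -> R[i].

Record state : Type := State {
  nvar : nat -> nat;
  cell : nat -> R;
  coins_used : nat
}.

Definition upd (T : Type) (f : nat -> T) (x : nat) (v : T) : nat -> T :=
  fun y => if y == x then v else f y.

Definition set_nvar (s : state) x v :=
  State (upd (nvar s) x v) (cell s) (coins_used s).
Definition set_cell (s : state) a v :=
  State (nvar s) (upd (cell s) a v) (coins_used s).

Fixpoint neval (s : state) (e : nexp) : nat :=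
  match e with
  | NConst c => c
  | NVar x => nvar s x
  | NAdd e1 e2 => (neval s e1 + neval s e2)%N
  | NSub e1 e2 => (neval s e1 - neval s e2)%N
  end.

Fixpoint reval (s : state) (e : rexp) : R :=
  match e with
  | RNat a => (neval s a)%:R
  | RCell a => cell s (neval s a)
  | RSample a b => sample (neval s a) (neval s b)
  | RAdd e1 e2 => reval s e1 + reval s e2
  | RSub e1 e2 => reval s e1 - reval s e2
  | RMul e1 e2 => reval s e1 * reval s e2
  | RDiv e1 e2 => reval s e1 / reval s e2
  | RSqrt e1 => Num.sqrt (reval s e1)
  | RExp e1 => expR (reval s e1)
  | RLn e1 => ln (reval s e1)
  | RSin e1 => sin (reval s e1)
  | RCos e1 => cos (reval s e1)
  | RAtan e1 => atan (reval s e1)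
  end.

Definition teval (s : state) (b : test) : bool :=
  match b with
  | NLt e1 e2 => (neval s e1 < neval s e2)%N
  | RLt e1 e2 => reval s e1 < reval s e2
  end.

(* The query point is read from [d] consecutive cells starting at [a]; the
   real and imaginary parts of the answer are written to cells [b], [b + 1]. *)
Definition query (s : state) (a b : nat) : state :=
  let z := phi [tuple cell s (a + i)%N | i < d] in
  set_cell (set_cell s b (complex.Re z)) b.+1 (complex.Im z).

Definition toss (s : state) (a : nat) : state :=
  State (nvar s) (upd (cell s) a (coin (coins_used s))) (coins_used s).+1.

(* [exec c s t s'] : started in [s], the program [c] halts in [s'] after [t]
   steps.  Expressions occurring in a fixed program have bounded size, so
   counting one step per instruction is exact up to a constant factor. *)
Inductive exec : program -> state -> nat -> state -> Prop :=
| exec_skip s : exec Skip s 1 s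
| exec_setn s x e : exec (SetN x e) s 1 (set_nvar s x (neval s e))
| exec_setr s a e : exec (SetR a e) s 1 (set_cell s (neval s a) (reval s e))
| exec_coin s a : exec (Coin a) s 1 (toss s (neval s a))
| exec_query s a b : exec (Query a b) s 1 (query s (neval s a) (neval s b))
| exec_seq c1 c2 s s1 s2 t1 t2 :
    exec c1 s t1 s1 -> exec c2 s1 t2 s2 -> exec (Seq c1 c2) s (t1 + t2)%N s2
| exec_if b c1 c2 s s' t :
    exec (if teval s b then c1 else c2) s t s' -> exec (If b c1 c2) s t.+1 s'
| exec_while_done b c s : ~~ teval s b -> exec (While b c) s 1 s
| exec_while_step b c s s1 s2 t1 t2 :
    teval s b -> exec c s t1 s1 -> exec (While b c) s1 t2 s2 ->
    exec (While b c) s (t1 + t2).+1 s2.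

(* Input: [d], [k], [n] in the natural number variables 0, 1, 2, and [eps],
   [delta] in the real cells 0, 1. *)
Definition init_state (k n : nat) (eps delta : R) : state :=
  State (fun x => nth 0%N [:: d; k; n] x) (fun a => nth 0 [:: eps; delta] a) 0.

(* Output: the j-th pair (weight, mean) occupies the [d + 1] cells starting at
   cell [j * (d + 1)]. *)
Definition out_weight (s : state) (j : nat) : R := cell s (j * d.+1)%N.
Definition out_mean (s : state) (j : nat) : d.-tuple R :=
  [tuple cell s (j * d.+1 + 1 + i)%N | i < d].

End Semantics.

Section Guarantees.
Variables (R : realType) (d k : nat).

Definition sample_at (n : nat) (x : 'I_n -> d.-tuple R) (i j : nat) : R :=
  nth 0 (nth [::] [seq tval (x l) | l : 'I_n] i) j.

Definition accurate (eps : R) (w : 'I_k -> R) (mu : 'I_k -> d.-tuple R)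
    (w' : 'I_k -> R) (mu' : 'I_k -> d.-tuple R) : Prop :=
  exists pi : {perm 'I_k},
    (forall j, norm2 (vsub (mu j) (mu' (pi j))) <= eps) /\
    (forall j, `|w j - w' (pi j)| <= eps).

(* A soft-O bound on F is a bound by C F log(2 + F)^p for some C and p. *)
Definition soft (C : R) (p : nat) (F : R) : R := C * F * ln (2 + F) ^+ p.

(* As d >= 1, the polynomials in d and 1/gamma are, up to constants, bounded by
   the powers of d + 1/gamma.  log(1/delta) is rendered as log(2/delta), which
   is of the same order for delta <= 1/2 but stays bounded below as delta tends
   to 1 (a sample bound tending to 0 as delta tends to 1 is impossible). *)
Definition sample_rate (q : nat) (gamma wmin B eps delta : R) : R :=
  (d%:R + gamma^-1) ^+ q * B ^+ 2 * ln (2 / delta) / (wmin ^+ 2 * eps ^+ 2).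

End Guarantees.

(* Main.v *)
(* Fix directions u_1, ..., u_m in R^d, and weight the ratio of the empirical
   characteristic function to phi_D at the frequencies a_1 u_1 + ... + a_m u_m + s e_j
   by binomial probabilities in a_1, ..., a_m < Q.  Up to noise, the sum recentered at
   c in R^m is G_s(c) = sum_j' w_j' e^{i s mu_j'j} prod_i H(<u_i, mu_j'> - c_i) with
   |H(y)| = |cos(y / 2)|^(Q - 1), a sharp bump modulo 2 pi.  All frequencies have
   polynomial norm, so slow Fourier decay keeps the noise polynomially amplified.

   Hence |G_0(c)| exceeds a threshold only near the location vectors (<u_i, mu_j>)_i,
   and it does so at a grid point near each of them.  If these vectors are separated, a
   greedy choice of pairwise distant grid points finds one per component; conversely,
   k distant grid points above the threshold belong to distinct components, so the
   program can stop as soon as it has found k.  Around such a point the phase of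
   G_s / G_0 is s mu_j, and doubling s from 2^-n to 1 yields mu_j; the weight is |G_0|
   at the recentered location.  With m about log n / log log n directions and Q
   polylogarithmic, the grid and the sum both have polynomial size Q^m.

   The directions are built from fair coins at a scale M that must reach d / gamma.
   For a given pair of means and given remaining coins, at most one value of the r
   coins at the relevant binary position, for each direction and trial, leaves the two
   location vectors close.  So a union bound shows that some trial with M of order
   (d + 1 / gamma)^2 separates all pairs, except with probability delta / 2. *)
Require Import Defs.
From HB Require Import structures.
From mathcomp Require Import all_boot all_order all_algebra.
From mathcomp Require Import all_classical all_reals all_analysis.
From mathcomp Require Import perm complex.
From mathcomp Require Import measurable_realfun.
From mathcomp Require Import zify ring lra.

Set Implicit Arguments.
Unset Strict Implicit.
Unset Printing Implicit Defensive.

Import Order.TTheory GRing.Theory Num.Theory.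

Local Open Scope classical_set_scope.
Local Open Scope ring_scope.

(** * Running time and correctness of programs *)

(** The obstacle is the number of components. Along a single random direction, keeping about [k ^ 2]
    pairs apart takes a resolution polynomial in [1 / k], hence frequencies polynomial in [k], and
    dividing by the characteristic function there would raise the power of [1 / wmin] in the sample
    bound. Here each direction resolves only about [2 ^ - r] with [r] of order log log n, so the
    frequencies exceed the scale [M * d] by polylogarithmic factors alone. A pair merges in all [m]
    directions with probability about [2 ^ - (r * m)], at most [n ^ - 2], which beats the number of
    pairs.

    None of gamma, wmin and B is known to the program. The threshold is therefore tied to the noise
    level at the current scale, and correctness is split: [k] picks in any trial give an accurate
    answer, whether or not all locations are well separated, while the separation of the locations
    and a threshold below [wmin / 4] serve to show that some trial reaches [k] picks. *)

Fixpoint depth (c : program) : nat :=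
  match c with
  | Seq c1 c2 | If _ c1 c2 => (maxn (depth c1) (depth c2)).+1
  | While _ c1 => (depth c1).+2
  | _ => 1
  end.

Definition For (x : nat) (e : nexp) (c : program) : program :=
  Seq (SetN x (NConst 0))
      (While (NLt (NVar x) e) (Seq c (SetN x (NAdd (NVar x) (NConst 1))))).

Section WeakestPrecondition.
Variables (R : realType) (d : nat) (sample : nat -> nat -> R) (coin : nat -> R).
Variables (phi : d.-tuple R -> R[i]) (K : nat).

Local Notation state := (state R).
Local Notation exec := (@exec R d sample coin phi).

(* [K.+4] bounds the number of iterations of every loop, so that the running time
   of [c] is at most [K.+4 ^ depth c]. *)
Definition wp (c : program) (Q : state -> Prop) (s : state) : Prop :=
  exists (t : nat) (s' : state), [/\ exec c s t s', (t <= K.+4 ^ depth c)%N & Q s'].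

Lemma depth_gt0 c : (0 < depth c)%N. Proof. by case: c. Qed.

Lemma wp_conseq c (Q Q' : state -> Prop) s :
  (forall s', Q s' -> Q' s') -> wp c Q s -> wp c Q' s.
Proof. by move=> QQ' [t [s' [? ? ?]]]; exists t, s'; split=> //; exact: QQ'. Qed.

Lemma wp_skip (Q : state -> Prop) s : Q s -> wp Skip Q s.
Proof.
by move=> Qs; exists 1, s; split; [exact: exec_skip|rewrite /= expn1|].
Qed.

Lemma wp_setn (Q : state -> Prop) s x e :
  Q (set_nvar s x (neval s e)) -> wp (SetN x e) Q s.
Proof.
by move=> Qs; eexists 1, _; split; [exact: exec_setn|rewrite /= expn1|].
Qed.

Lemma wp_setr (Q : state -> Prop) s a e :
  Q (set_cell s (neval s a) (reval sample s e)) -> wp (SetR a e) Q s.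
Proof.
by move=> Qs; eexists 1, _; split; [exact: exec_setr|rewrite /= expn1|].
Qed.

Lemma wp_coin (Q : state -> Prop) s a :
  Q (toss coin s (neval s a)) -> wp (Coin a) Q s.
Proof.
by move=> Qs; eexists 1, _; split; [exact: exec_coin|rewrite /= expn1|].
Qed.

Lemma wp_query (Q : state -> Prop) s a b :
  Q (query phi s (neval s a) (neval s b)) -> wp (Query a b) Q s.
Proof.
by move=> Qs; eexists 1, _; split; [exact: exec_query|rewrite /= expn1|].
Qed.

Lemma wp_seq c1 c2 (Q : state -> Prop) s :
  wp c1 (wp c2 Q) s -> wp (Seq c1 c2) Q s.
Proof.
move=> [t1 [s1 [e1 le1 [t2 [s2 [e2 le2 Qs]]]]]].
exists (t1 + t2)%N, s2; split => //; first exact: exec_seq e1 e2.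
rewrite /= expnS; set D := maxn _ _.
have h1 : (K.+4 ^ depth c1 <= K.+4 ^ D)%N by rewrite leq_pexp2l// ?leq_maxl//; lia.
have h2 : (K.+4 ^ depth c2 <= K.+4 ^ D)%N by rewrite leq_pexp2l// ?leq_maxr//; lia.
have := leq_trans le1 h1; have := leq_trans le2 h2; nia.
Qed.

Lemma wp_if b c1 c2 (Q : state -> Prop) s :
  wp (if teval sample s b then c1 else c2) Q s -> wp (If b c1 c2) Q s.
Proof.
move=> [t [s' [e le1 Qs]]]; exists t.+1, s'; split => //; first exact: exec_if.
rewrite /= expnS; set D := maxn _ _.
have h1 : (K.+4 ^ depth c1 <= K.+4 ^ D)%N by rewrite leq_pexp2l// ?leq_maxl//; lia.
have h2 : (K.+4 ^ depth c2 <= K.+4 ^ D)%N by rewrite leq_pexp2l// ?leq_maxr//; lia.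
have : (0 < K.+4 ^ D)%N by rewrite expn_gt0; lia.
have : (t <= K.+4 ^ D)%N by case: ifP le1 => _ h; [move: h1|move: h2]; exact: leq_trans.
nia.
Qed.

(** A body of cost at most [z] gives a loop of cost at most [N * (z + 1) + 1]. As [depth] counts a
    loop twice, one of the two factors [K.+4] pays for the number of rounds and the other for the
    additional steps of the tests. *)
Lemma wp_while (I : nat -> state -> Prop) N b c (Q : state -> Prop) s :
  (N <= K.+4)%N -> I 0%N s ->
  (forall i s', (i < N)%N -> I i s' -> teval sample s' b /\ wp c (I i.+1) s') ->
  (forall s', I N s' -> ~~ teval sample s' b /\ Q s') ->
  wp (While b c) Q s.
Proof.
move=> NK I0 step fin.
suff H j : (j <= N)%N -> forall s1, I (N - j)%N s1 -> exists t s',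
    [/\ exec (While b c) s1 t s', (t <= j * (K.+4 ^ depth c).+1 + 1)%N & Q s'].
  have [|t [s' [e le1 Qs]]] := H N (leqnn _) s; first by rewrite subnn.
  exists t, s'; split=> //; apply: (leq_trans le1); rewrite /= !expnS.
  have : (K.+4 ^ 1 <= K.+4 ^ depth c)%N by rewrite leq_pexp2l// ?depth_gt0//; lia.
  rewrite expn1; move: (K.+4 ^ _)%N => z Kz.
  have : (N * z.+1 <= K.+4 * z.+1)%N by rewrite leq_mul2r NK orbT.
  have : (K.+4 * (2 * z) <= K.+4 * (K.+4 * z))%N by rewrite leq_mul2l leq_mul2r; lia.
  nia.
elim: j => [_ s1|j IH jN s1 Is1].
  rewrite subn0 => Is1; have [nb Qs] := fin _ Is1.
  by exists 1, s1; split; [exact: exec_while_done|lia|].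
have [|bt [t1 [s2 [e1 le1 Is2]]]] := step _ _ _ Is1; first by lia.
have [||t2 [s3 [e2 le2 Qs]]] := IH _ s2; first by lia.
  by rewrite (_ : N - j = (N - j.+1).+1)%N; [|lia].
exists (t1 + t2).+1, s3; split=> //; first exact: exec_while_step e1 e2.
rewrite mulSn; lia.
Qed.

Lemma wp_for (I : nat -> state -> Prop) N x e c (Q : state -> Prop) s :
  (N <= K.+4)%N -> I 0%N (set_nvar s x 0) ->
  (forall i s', I i s' -> nvar s' x = i /\ neval s' e = N) ->
  (forall i s', (i < N)%N -> I i s' ->
    wp c (fun s2 => I i.+1 (set_nvar s2 x (nvar s2 x + 1)%N)) s') ->
  (forall s', I N s' -> Q s') ->
  wp (For x e c) Q s.
Proof.
move=> NK I0 Ix step fin; apply/wp_seq/wp_setn => /=.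
apply: (@wp_while I N) => // [i s' iN Is|s' Is].
  have [xi eN] := Ix _ _ Is; split; first by rewrite /= xi eN.
  by apply: wp_seq; apply: wp_conseq (step _ _ iN Is) => s2 h; exact: wp_setn.
by have [xi eN] := Ix _ _ Is; split; [rewrite /= xi eN ltnn|exact: fin].
Qed.

End WeakestPrecondition.

(** * The program *)

(** [vd], [vk], [vn] are the inputs; [vm], [vQ], [vr], [vl] hold the number of directions, the base,
    [2 ^ loglog n] and [ell n]. [vQm], and later [vmd] and [vkd], hold [Q ^ m], [m * d] and
    [k * (d + 1)], prepared once because naturals cannot be multiplied in one step. [vtau] numbers
    the trials, [vci] the candidates, [vcnt] the picks; [vpp] and [vop] point into the arrays of
    picks and of outputs. *)
Notation vd := 0%N. Notation vk := 1%N. Notation vn := 2%N. Notation vm := 3%N.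
Notation vQ := 4%N. Notation vQm := 5%N. Notation vr := 6%N. Notation vl := 7%N.
Notation vtau := 8%N. Notation vcnt := 9%N. Notation vj0 := 11%N.
Notation vci := 12%N. Notation vi' := 13%N. Notation vfar := 14%N.
Notation vpp := 15%N. Notation vpk := 16%N. Notation vsep := 17%N.
Notation vop := 18%N. Notation vop0 := 19%N.
Notation vidx := 20%N. Notation vi := 21%N. Notation vx := 22%N.
Notation vq := 23%N. Notation vj := 24%N. Notation vp := 25%N.
Notation vs := 26%N. Notation vj' := 27%N. Notation ve := 28%N. Notation vb := 29%N.

Notation "$ x" := (NVar x) (at level 2, format "$ x").
Notation rc a := (RCell (NConst a)).
Notation "a <-- e" := (SetR (NConst a) e) (at level 60).
Notation "x ::= e" := (SetN x e) (at level 60).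
Notation "c1 ;; c2" := (Seq c1 c2) (at level 65, right associativity).
Notation nc := NConst.

(* Cells 0 to 6 hold [eps], [delta], [M], [theta ^ 2], the scale [s], [Re G] and
   [Im G].  The query point starts at cell 40; behind it, five arrays are
   interleaved with stride 5: the directions [u] (0), the binomial weights [W]
   (1), the current center [c] (2), the centers picked so far (3) and the output
   (4). *)
Definition at_t (e : nexp) : nexp := NAdd (nc 40) e.
Definition at_arr (i : nat) (e : nexp) : nexp :=
  NAdd (NAdd (nc (40 + i)) $vd) (NAdd (NAdd e e) (NAdd (NAdd e e) e)).

Definition arr (d i x : nat) : nat := (40 + i + d + (x + x + (x + x + x)))%N.
Definition is_arr (d i a : nat) : bool :=
  ((40 + d <= a) && ((a - 40 - d) %% 5 == i))%N.
Definition is_t (d a : nat) : bool := (40 <= a < 40 + d)%N.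

Definition digit_div : program :=
  vq ::= nc 0 ;;
  While (NLt $vQ (NAdd $vx (nc 1)))
    (vx ::= NSub $vx $vQ ;; vq ::= NAdd $vq (nc 1)).

(** The quotient of [a + i b] by [p + i q] is spelled out over the reals as [((a p + b q) + i (b p -
    a q)) / (p ^ 2 + q ^ 2)]: cells 9 and 10 hold the sums of cosines and sines, 11 and 12 the
    answer of the oracle, 14 its squared modulus. Cells 7 and 8 accumulate the shift and the weight
    of the current digit vector. *)
Definition eval_G : program :=
  5 <-- RNat (nc 0) ;; 6 <-- RNat (nc 0) ;;
  For vidx $vQm (
    vx ::= $vidx ;; 7 <-- RNat (nc 0) ;; 8 <-- RNat (nc 1) ;;
    For vj $vd (SetR (at_t $vj) (RNat (nc 0))) ;;
    SetR (at_t $vj0) (rc 4) ;;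
    vp ::= nc 0 ;;
    For vi $vm (
      digit_div ;;
      8 <-- RMul (rc 8) (RCell (at_arr 1 $vx)) ;;
      7 <-- RAdd (rc 7) (RMul (RNat $vx) (RCell (at_arr 2 $vi))) ;;
      For vj $vd (
        SetR (at_t $vj) (RAdd (RCell (at_t $vj))
                           (RMul (RNat $vx) (RCell (at_arr 0 $vp)))) ;;
        vp ::= NAdd $vp (nc 1)) ;;
      vx ::= $vq) ;;
    9 <-- RNat (nc 0) ;; 10 <-- RNat (nc 0) ;;
    For vs $vn (
      13 <-- RSub (RNat (nc 0)) (rc 7) ;;
      For vj $vd (
        13 <-- RAdd (rc 13) (RMul (RCell (at_t $vj)) (RSample $vs $vj))) ;;
      9 <-- RAdd (rc 9) (RCos (rc 13)) ;;
      10 <-- RAdd (rc 10) (RSin (rc 13))) ;;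
    Query (nc 40) (nc 11) ;;
    14 <-- RAdd (RMul (rc 11) (rc 11)) (RMul (rc 12) (rc 12)) ;;
    5 <-- RAdd (rc 5) (RMul (rc 8)
      (RDiv (RDiv (RAdd (RMul (rc 9) (rc 11)) (RMul (rc 10) (rc 12))) (rc 14))
            (RNat $vn))) ;;
    6 <-- RAdd (rc 6) (RMul (rc 8)
      (RDiv (RDiv (RSub (RMul (rc 10) (rc 11)) (RMul (rc 9) (rc 12))) (rc 14))
            (RNat $vn)))).

Definition digit (Q idx i : nat) : nat := ((idx %/ Q ^ i) %% Q)%N.

Section Spec.
Variables (R : realType) (d : nat) (sample : nat -> nat -> R).
Variables (phi : d.-tuple R -> R[i]) (m n Q : nat).
Variables (W u c : nat -> R).

(* The number [idx] codes the vector [a] of its base-[Q] digits, and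
   [Gre + i Gim = \sum_a (\prod_i W a_i) e^{- i <a, c>} (ecf / phi) (t_a)] with
   [t_a = \sum_i a_i u_i + s e_j0]. *)
Definition freq_coord (s : R) (j0 idx j : nat) : R :=
  (if j == j0 then s else 0) + \sum_(i < m) (digit Q idx i)%:R * u (i * d + j)%N.
Definition freq (s : R) (j0 idx : nat) : d.-tuple R :=
  [tuple freq_coord s j0 idx j | j < d].
Definition weight_of (idx : nat) : R := \prod_(i < m) W (digit Q idx i).
Definition shift_of (idx : nat) : R := \sum_(i < m) (digit Q idx i)%:R * c i.
Definition phase (s : R) (j0 idx l : nat) : R :=
  - shift_of idx + \sum_(j < d) freq_coord s j0 idx j * sample l j.
Definition Gre_term (s : R) (j0 idx : nat) : R :=
  let z := phi (freq s j0 idx) in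
  weight_of idx *
  (((\sum_(l < n) cos (phase s j0 idx l)) * complex.Re z +
    (\sum_(l < n) sin (phase s j0 idx l)) * complex.Im z) /
   (complex.Re z * complex.Re z + complex.Im z * complex.Im z) / n%:R).
Definition Gim_term (s : R) (j0 idx : nat) : R :=
  let z := phi (freq s j0 idx) in
  weight_of idx *
  (((\sum_(l < n) sin (phase s j0 idx l)) * complex.Re z -
    (\sum_(l < n) cos (phase s j0 idx l)) * complex.Im z) /
   (complex.Re z * complex.Re z + complex.Im z * complex.Im z) / n%:R).
Definition Gre (s : R) (j0 : nat) : R := \sum_(idx < (Q ^ m)%N) Gre_term s j0 idx.
Definition Gim (s : R) (j0 : nat) : R := \sum_(idx < (Q ^ m)%N) Gim_term s j0 idx.

End Spec.

(** * Frame conditions: what a subprogram leaves unchanged *)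

Section Frame.
Variables (R : realType).
Implicit Types (s : state R) (vars : seq nat) (A : nat -> bool).

(** Scratch cells, query point and the five arrays occupy disjoint sets of addresses. With this
    relation, every value needed later is carried across a subprogram by arithmetic on addresses
    alone. *)
Definition frame vars A s s' : Prop :=
  [/\ forall x, x \notin vars -> nvar s' x = nvar s x,
      forall a, ~~ A a -> cell s' a = cell s a
    & coins_used s' = coins_used s].

Lemma frame_refl vars A s : frame vars A s s. Proof. by []. Qed.

Lemma frame_trans vars A s1 s2 s3 :
  frame vars A s1 s2 -> frame vars A s2 s3 -> frame vars A s1 s3.
Proof.
move=> [h1 h2 h3] [g1 g2 g3]; split=> [x xv|a aA|]; last by rewrite g3.
- by rewrite g1// h1.
- by rewrite g2// h2.
Qed.

Lemma frame_sub vars A vars' A' s s' :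
  {subset vars <= vars'} -> (forall a, A a -> A' a) ->
  frame vars A s s' -> frame vars' A' s s'.
Proof.
move=> vv AA [h1 h2 h3]; split=> // [x xv|a aA].
- by apply: h1; apply: contra xv => /vv.
- by apply: h2; apply: contra aA => /AA.
Qed.

Lemma frame_setn vars A s s' x v : x \in vars ->
  frame vars A s s' -> frame vars A s (set_nvar s' x v).
Proof.
move=> xv [h1 h2 h3]; split=> //= y yv; rewrite /upd; case: eqP => [yx|_]; last exact: h1.
by rewrite yx xv in yv.
Qed.

Lemma frame_setr vars A s s' a v : A a ->
  frame vars A s s' -> frame vars A s (set_cell s' a v).
Proof.
move=> xv [h1 h2 h3]; split=> //= y yv; rewrite /upd; case: eqP => [yx|_]; last exact: h2.
by rewrite yx xv in yv.
Qed.

Lemma frN vars A s s' : frame vars A s s' ->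
  forall x, x \notin vars -> nvar s' x = nvar s x.
Proof. by case. Qed.

Lemma frC vars A s s' : frame vars A s s' ->
  forall a, ~~ A a -> cell s' a = cell s a.
Proof. by case. Qed.

Lemma frK vars A s s' : frame vars A s s' -> coins_used s' = coins_used s.
Proof. by case. Qed.

End Frame.

Ltac step := repeat lazymatch goal with
  | |- wp _ _ _ _ (Seq _ _) _ _ => apply: wp_seq
  | |- wp _ _ _ _ (SetN _ _) _ _ => apply: wp_setn
  | |- wp _ _ _ _ (SetR _ _) _ _ => apply: wp_setr
  | |- wp _ _ _ _ Skip _ _ => apply: wp_skip
  | |- wp _ _ _ _ (Coin _) _ _ => apply: wp_coin
  | |- wp _ _ _ _ (Query _ _) _ _ => apply: wp_query
  end.
Ltac upds := rewrite /= /upd /=.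
Ltac addr := first [done | rewrite /is_t /is_arr /arr /=; first [done | lia]].
Ltac fr := repeat first [apply: frame_setn; [by [] | ] | apply: frame_setr; [addr | ]];
  try exact: frame_refl; try assumption.

(** * Correctness of the evaluation of the sum [G] *)

Section Eval.
Variables (R : realType) (d : nat) (sample : nat -> nat -> R) (coin : nat -> R).
Variables (phi : d.-tuple R -> R[i]) (K : nat).

Local Notation state := (state R).
Local Notation wp := (@wp R d sample coin phi K).

Lemma wp_digit_div (Q a : nat) (P : state -> Prop) (s : state) :
  (0 < Q)%N -> (a < K.+4)%N -> nvar s vQ = Q -> nvar s vx = a ->
  (forall s', frame [:: vx; vq] pred0 s s' -> nvar s' vx = (a %% Q)%N ->
    nvar s' vq = (a %/ Q)%N -> P s') ->
  wp digit_div P s.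
Proof.
move=> Q0 aK sQ sx post; rewrite /digit_div; step => /=.
pose I i s' := [/\ frame [:: vx; vq] pred0 s s', nvar s' vx = (a - i * Q)%N &
  nvar s' vq = i].
apply: (wp_while (I := I) (N := (a %/ Q)%N)) => //.
- by rewrite ltnW// (leq_ltn_trans (leq_div _ _)).
- split=> //; first by apply: frame_setn; rewrite ?inE.
  by rewrite /= /upd /= sx mul0n subn0.
- move=> i s' ia [f xE qE]; case: (f) => f1 _ _.
  have QE : nvar s' vQ = Q by rewrite f1.
  have iQ : (i.+1 * Q <= a)%N by rewrite -leq_divRL.
  split; first by rewrite /= QE xE; move: iQ; rewrite mulSn; lia.
  step; rewrite /= /upd /=; split=> /=.
  + by apply: frame_setn => //; apply: frame_setn.
  + by rewrite /= /upd /= xE QE mulSn; lia.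
  + by rewrite /= /upd /= qE addn1.
- move=> s' [f xE qE]; case: (f) => f1 _ _.
  have QE : nvar s' vQ = Q by rewrite f1.
  have E := divn_eq a Q; have L := ltn_pmod a Q0.
  split; first by rewrite /= QE xE; lia.
  by apply: post => //; rewrite xE; lia.
Qed.

Lemma wp_zero_t (P : state -> Prop) (s : state) :
  nvar s vd = d -> (d <= K.+4)%N ->
  (forall s', frame [:: vj] (is_t d) s s' ->
     (forall j, (j < d)%N -> cell s' (40 + j)%N = 0) -> P s') ->
  wp (For vj $vd (SetR (at_t $vj) (RNat (nc 0)))) P s.
Proof.
move=> sd dK post.
pose I i s' := [/\ frame [:: vj] (is_t d) s s', nvar s' vj = i &
  forall j, (j < i)%N -> cell s' (40 + j)%N = 0].
apply: (wp_for (I := I) (N := d)) => //.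
- by split; [fr|upds|].
- by move=> i s' [f jE _]; split=> //; rewrite /= (frN f).
- move=> i s' id [f jE tE]; step; split; upds; [fr; upds; addr|by rewrite jE addn1|].
  move=> j ji; case: eqP => [//|jn]; apply: tE; lia.
- by move=> s' [f _ tE]; apply: post.
Qed.

Lemma wp_add_t (P : state -> Prop) (s : state) :
  nvar s vd = d -> (d <= K.+4)%N ->
  (forall s', frame [:: vj; vp] (is_t d) s s' ->
     nvar s' vp = (nvar s vp + d)%N ->
     (forall j, (j < d)%N -> cell s' (40 + j)%N = cell s (40 + j)%N +
        (nvar s vx)%:R * cell s (arr d 0 (nvar s vp + j))) -> P s') ->
  wp (For vj $vd (
        SetR (at_t $vj) (RAdd (RCell (at_t $vj))
                           (RMul (RNat $vx) (RCell (at_arr 0 $vp)))) ;;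
        vp ::= NAdd $vp (nc 1))) P s.
Proof.
move=> sd dK post.
pose I i s' := [/\ frame [:: vj; vp] (is_t d) s s', nvar s' vj = i,
  nvar s' vp = (nvar s vp + i)%N,
  forall j, (j < i)%N -> cell s' (40 + j)%N = cell s (40 + j)%N +
        (nvar s vx)%:R * cell s (arr d 0 (nvar s vp + j)) &
  forall j, (i <= j)%N -> cell s' (40 + j)%N = cell s (40 + j)%N].
apply: (wp_for (I := I) (N := d)) => //.
- by split=> //; upds; [fr|rewrite addn0].
- by move=> i s' [f jE _ _ _]; split=> //; rewrite /= (frN f).
- move=> i s' id [f jE pE tE tE']; step; split; upds.
  + by fr; upds; addr.
  + by rewrite jE addn1.
  + by rewrite pE addn1 addnS.
  + move=> j ji; rewrite jE eqn_add2l; case: eqP => [->|jn].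
      rewrite tE'// pE (frN f)// (frN f)// sd -/(arr d 0 _) (frC f)//; addr.
    by apply: tE; lia.
  + move=> j ji; rewrite jE eqn_add2l; case: eqP => [jn|_]; first by lia.
    apply: tE'; lia.
- by move=> s' [f _ pE tE _]; apply: post.
Qed.

Definition evalA (a : nat) : bool := (4 < a < 15)%N || is_t d a.

Lemma divn_digit Q idx i : (idx %/ Q ^ i %/ Q)%N = (idx %/ Q ^ i.+1)%N.
Proof. by rewrite expnS mulnC divnMA. Qed.

Lemma wp_digits (m Q idx : nat) (P : state -> Prop) (s : state) :
  nvar s vd = d -> nvar s vm = m -> nvar s vQ = Q -> (0 < Q)%N ->
  nvar s vx = idx -> nvar s vp = 0%N ->
  (d <= K.+4)%N -> (m <= K.+4)%N -> (idx < K.+4)%N ->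
  (forall s', frame [:: vx; vq; vj; vp; vi] evalA s s' ->
     cell s' 8 = cell s 8 * \prod_(i < m) cell s (arr d 1 (digit Q idx i)) ->
     cell s' 7 = cell s 7 +
       \sum_(i < m) (digit Q idx i)%:R * cell s (arr d 2 i) ->
     (forall j, (j < d)%N -> cell s' (40 + j)%N = cell s (40 + j)%N +
        \sum_(i < m) (digit Q idx i)%:R * cell s (arr d 0 (i * d + j))) ->
     (forall a, (8 < a < 15)%N -> cell s' a = cell s a) ->
     cell s' 5 = cell s 5 -> cell s' 6 = cell s 6 -> P s') ->
  wp (For vi $vm (
      digit_div ;;
      8 <-- RMul (rc 8) (RCell (at_arr 1 $vx)) ;;
      7 <-- RAdd (rc 7) (RMul (RNat $vx) (RCell (at_arr 2 $vi))) ;;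
      For vj $vd (
        SetR (at_t $vj) (RAdd (RCell (at_t $vj))
                           (RMul (RNat $vx) (RCell (at_arr 0 $vp)))) ;;
        vp ::= NAdd $vp (nc 1)) ;;
      vx ::= $vq)) P s.
Proof.
move=> sd sm sQ Q0 sx sp dK mK iK post.
(* This set is smaller than [evalA]: the loop spares the accumulators 5 and 6 and the cells 9 to 14.
   In the invariant, [vp] equals [i * d], so the row-major array of directions is traversed without
   a multiplication. *)
pose B a := (6 < a < 9)%N || is_t d a.
pose I i s' := [/\ frame [:: vx; vq; vj; vp; vi] B s s', nvar s' vi = i,
  nvar s' vx = (idx %/ Q ^ i)%N, nvar s' vp = (i * d)%N &
  [/\ cell s' 8 = cell s 8 * \prod_(i < i) cell s (arr d 1 (digit Q idx i)),
     cell s' 7 = cell s 7 +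
       \sum_(i < i) (digit Q idx i)%:R * cell s (arr d 2 i) &
     (forall j, (j < d)%N -> cell s' (40 + j)%N = cell s (40 + j)%N +
        \sum_(i < i) (digit Q idx i)%:R * cell s (arr d 0 (i * d + j)))]].
apply: (wp_for (I := I) (N := m)) => //.
- split=> //; upds; [by fr|by rewrite expn0 divn1|split].
  + by rewrite big_ord0 mulr1.
  + by rewrite big_ord0 addr0.
  + by move=> j _; rewrite big_ord0 addr0.
- by move=> i s' [f iE _ _ _]; split=> //; rewrite /= (frN f).
- move=> i s' im [f iE xE pE [c8 c7 ct]].
  apply: wp_seq; apply: (wp_digit_div Q0 _ _ xE).
  + by rewrite (leq_ltn_trans (leq_div _ _)).
  + by rewrite (frN f).
  move=> s1 f1 x1 q1; step; upds.
  have f01 : frame [:: vx; vq; vj; vp; vi] B s s1.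
    by apply: frame_trans f _; apply: frame_sub f1 => // x; rewrite !inE; lia.
  apply: wp_add_t; upds => //.
    by rewrite (frN f01).
  move=> s2 f2 p2 t2; step; upds; split; upds.
  + apply: frame_setn => //; apply: frame_setn => //.
    apply: (frame_trans (s2 := set_cell (set_cell s1 8 0) 7 0)).
      by do 2 (apply: frame_setr; rewrite ?/B//).
    case: f2 => g1 g2 g3; split=> //.
    + move=> x xn; rewrite g1//; move: xn; rewrite !inE; lia.
    + move=> a; rewrite /B negb_or => /andP[a1 a2]; rewrite g2//; upds.
      by case: eqP a1 => [->//|]; case: eqP => [->//|].
  + by rewrite (frN f2)//= (frN f1)//= iE addn1.
  + by rewrite (frN f2)//= q1 divn_digit.
  + by rewrite p2 /= (frN f1)// pE mulSn addnC.
  + split.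
    * rewrite (frC f2); last by addr.
      upds; rewrite (frC f1)// c8 big_ord_recr /= x1 -/(digit _ _ _).
      rewrite (frN f01)// sd -/(arr d 1 _) (frC f01) ?mulrA//; rewrite /B; addr.
    * rewrite (frC f2); last by addr.
      upds; rewrite (frC f1)// c7 big_ord_recr /= x1 -/(digit _ _ _).
      rewrite (frN f01)// (frN f1)// sd iE -/(arr d 2 _) (frC f01) ?addrA//.
      by rewrite /B; addr.
    * move=> j jd; rewrite t2//; upds; rewrite (frC f1)// ct// big_ord_recr /=.
      rewrite addrA x1 -/(digit _ _ _) (frN f1)// pE.
      by rewrite (frC f01)// /B; addr.
- move=> s' [f iE xE pE [c8 c7 ct]]; apply: post => //.
  + apply: frame_sub f => // a; rewrite /B /evalA => /orP[?|->]; rewrite ?orbT//.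
    by apply/orP; left; lia.
  + by move=> a al; rewrite (frC f)// /B; addr.
  + by rewrite (frC f)// /B; addr.
  + by rewrite (frC f)// /B; addr.
Qed.

Lemma wp_samples (n : nat) (P : state -> Prop) (s : state) :
  nvar s vd = d -> nvar s vn = n -> (d <= K.+4)%N -> (n <= K.+4)%N ->
  cell s 9 = 0 -> cell s 10 = 0 ->
  let ph l := - cell s 7 + \sum_(j < d) cell s (40 + j)%N * sample l j in
  (forall s', frame [:: vj; vs] (fun a => a \in [:: 9; 10; 13]%N) s s' ->
     cell s' 9 = \sum_(l < n) cos (ph l) ->
     cell s' 10 = \sum_(l < n) sin (ph l) -> P s') ->
  wp (For vs $vn (
      13 <-- RSub (RNat (nc 0)) (rc 7) ;;
      For vj $vd (
        13 <-- RAdd (rc 13) (RMul (RCell (at_t $vj)) (RSample $vs $vj))) ;;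
      9 <-- RAdd (rc 9) (RCos (rc 13)) ;;
      10 <-- RAdd (rc 10) (RSin (rc 13)))) P s.
Proof.
move=> sd sn dK nK s9 s10 ph post.
pose B a := a \in [:: 9; 10; 13]%N.
pose I l s' := [/\ frame [:: vj; vs] B s s', nvar s' vs = l,
   cell s' 9 = \sum_(l < l) cos (ph l) &
   cell s' 10 = \sum_(l < l) sin (ph l)].
apply: (wp_for (I := I) (N := n)) => //.
- by split=> //; upds; [fr|by rewrite big_ord0|by rewrite big_ord0].
- by move=> l s' [f lE _ _]; split=> //; rewrite /= (frN f).
- move=> l s' ln [f lE c9 c10]; step.
  pose J j s2 := [/\ frame [:: vj; vs] B s s2, nvar s2 vs = l,
     cell s2 9 = cell s' 9, cell s2 10 = cell s' 10 & nvar s2 vj = j /\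
     cell s2 13 = - cell s 7 + \sum_(j < j) cell s (40 + j)%N * sample l j].
  apply: (wp_for (I := J) (N := d)) => //.
  + split=> //; upds; first by rewrite /B; fr.
    by split=> //; rewrite big_ord0 addr0 sub0r (frC f).
  + by move=> j s2 [f2 _ _ _ [-> _]]; split=> //; rewrite /= (frN f2).
  + move=> j s2 jd [f2 l2 a9 a10 [jE a13]]; step; upds; split; upds => //.
      by rewrite /B; fr.
    split; first by rewrite jE addn1.
    rewrite a13 big_ord_recr /= l2 jE addrA (frC f2)//; rewrite /B !inE; addr.
  move=> s2 [f2 l2 a9 a10 [jE a13]]; step; upds; split; upds.
  + by rewrite /B; fr.
  + by rewrite l2 addn1.
  + by rewrite big_ord_recr /= a9 c9 a13.
  + by rewrite big_ord_recr /= a10 c10 a13.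
- by move=> s' [f _ c9 c10]; apply: post.
Qed.

Lemma wp_eval_G (m n Q j0 : nat) (P : state -> Prop) (s : state) :
  nvar s vd = d -> nvar s vm = m -> nvar s vn = n -> nvar s vQ = Q ->
  nvar s vQm = (Q ^ m)%N -> nvar s vj0 = j0 -> (j0 < d)%N -> (0 < Q)%N ->
  (d <= K.+4)%N -> (m <= K.+4)%N -> (n <= K.+4)%N -> (Q ^ m <= K.+4)%N ->
  let W a := cell s (arr d 1 a) in
  let u x := cell s (arr d 0 x) in
  let c i := cell s (arr d 2 i) in
  (forall s', frame [:: vx; vq; vj; vp; vi; vs; vidx] evalA s s' ->
     cell s' 5 = Gre sample phi m n Q W u c (cell s 4) j0 ->
     cell s' 6 = Gim sample phi m n Q W u c (cell s 4) j0 -> P s') ->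
  wp eval_G P s.
Proof.
move=> sd sm sn sQ sQm sj j0d Q0 dK mK nK QK W u c post; rewrite /eval_G; step.
pose fv := [:: vx; vq; vj; vp; vi; vs; vidx].
pose I i s' := [/\ frame fv evalA s s', nvar s' vidx = i,
  cell s' 5 = \sum_(idx < i) Gre_term sample phi m n Q W u c (cell s 4) j0 idx &
  cell s' 6 = \sum_(idx < i) Gim_term sample phi m n Q W u c (cell s 4) j0 idx].
apply: (wp_for (I := I) (N := (Q ^ m)%N)) => //.
- by split=> //; upds; [fr|rewrite big_ord0|rewrite big_ord0].
- by move=> i s' [f iE _ _]; split=> //; rewrite /= (frN f).
move=> i s' im [f iE c5 c6]; step.
apply: wp_zero_t => //; first by upds; rewrite (frN f).
move=> s1 f1 t1; step.
have g1 : frame fv evalA s s1.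
  apply: (frame_trans f); apply: frame_trans
    (_ : frame fv evalA (set_cell (set_cell (set_nvar s' vx (nvar s' vidx)) 7 0) 8 1) _).
    by fr.
  apply: frame_sub f1 => [x|a]; first by rewrite !inE /=; lia.
  by rewrite /evalA => ->; rewrite orbT.
have c15 : cell s1 5 = cell s' 5 by rewrite (frC f1).
have c16 : cell s1 6 = cell s' 6 by rewrite (frC f1).
have c17 : cell s1 7 = 0 by rewrite (frC f1).
have c18 : cell s1 8 = 1 by rewrite (frC f1).
have x1 : nvar s1 vx = i by rewrite (frN f1)//= iE.
have idx1 : nvar s1 vidx = i by rewrite (frN f1)//= iE.
pose s2 := set_nvar (set_cell s1 (40 + j0)%N (cell s 4)) vp 0.
have -> : set_nvar (set_cell s1 (neval s1 (at_t $vj0)) (reval sample s1 (rc 4))) vp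
   (neval (set_cell s1 (neval s1 (at_t $vj0)) (reval sample s1 (rc 4))) (nc 0)) = s2.
  by rewrite /= (frN g1)// sj (frC g1).
have g2 : frame fv evalA s s2.
  apply: (frame_trans g1); fr; rewrite /evalA; addr.
apply: (@wp_digits m Q i) => //; try by rewrite (frN g2).
  exact: leq_trans im _.
move=> s3 f3 c38 c37 t3 o3 c35 c36; step.
have g3 : frame fv evalA s s3.
  apply: (frame_trans g2); apply: frame_sub f3 => // x; rewrite !inE /=; lia.
have W3 a : cell s2 (arr d 1 a) = W a by rewrite (frC g2)//= /evalA; addr.
have u3 a : cell s2 (arr d 0 a) = u a by rewrite (frC g2)//= /evalA; addr.
have c3 a : cell s2 (arr d 2 a) = c a by rewrite (frC g2)//= /evalA; addr.
have c28 : cell s2 8 = 1 by upds.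
have c27 : cell s2 7 = 0 by upds.
have c25 : cell s2 5 = cell s1 5 by upds.
have c26 : cell s2 6 = cell s1 6 by upds.
have t2 j : (j < d)%N -> cell s2 (40 + j)%N = if j == j0 then cell s 4 else 0.
  by move=> jd; upds; rewrite eqn_add2l; case: eqP => // _; apply: t1.
apply: (@wp_samples n) => //; try by rewrite /= (frN g3).
move=> s4 f4 c9 c10; step.
pose ph l := - cell s3 7 + \sum_(j < d) cell s3 (40 + j)%N * sample l j.
have ct a : (10 < a)%N -> cell (set_cell (set_cell s3 9 0) 10 0) a = cell s3 a.
  by move=> a10; upds; do 2 (case: eqP => [?|_]; first lia).
have ctE l : - cell (set_cell (set_cell s3 9 0) 10 0) 7 + \sum_(j < d)
    cell (set_cell (set_cell s3 9 0) 10 0) (40 + j)%N * sample l j = ph l.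
  by congr (_ + _); apply: eq_bigr => j _; rewrite ct.
have {}c9 : cell s4 9 = \sum_(l < n) cos (ph l).
  by rewrite c9; apply: eq_bigr => l _; rewrite -ctE.
have {}c10 : cell s4 10 = \sum_(l < n) sin (ph l).
  by rewrite c10; apply: eq_bigr => l _; rewrite -ctE.
have t4 j : (j < d)%N -> cell s3 (40 + j)%N = freq_coord d m Q u (cell s 4) j0 i j.
  move=> jd; rewrite t3// t2//; congr (_ + _).
  by apply: eq_bigr => b _; rewrite u3.
have phE l : ph l = phase d sample m Q u c (cell s 4) j0 i l.
  rewrite /ph /phase; congr (- _ + _).
    by rewrite c37 c27 add0r; apply: eq_bigr => b _; rewrite c3.
  by apply: eq_bigr => b _; rewrite t4.
have cosE : \sum_(l < n) cos (ph l) =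
    \sum_(l < n) cos (phase d sample m Q u c (cell s 4) j0 i l).
  by apply: eq_bigr => l _; rewrite phE.
have sinE : \sum_(l < n) sin (ph l) =
    \sum_(l < n) sin (phase d sample m Q u c (cell s 4) j0 i l).
  by apply: eq_bigr => l _; rewrite phE.
set z := phi (freq d m Q u (cell s 4) j0 i).
have g4 : frame fv evalA s s4.
  apply: (frame_trans g3); apply: frame_trans
   (_ : frame fv evalA (set_cell (set_cell s3 9 0) 10 0) _); first by fr.
  apply: frame_sub f4 => [x|a]; first by rewrite !inE /=; lia.
  by rewrite /evalA !inE; lia.
have c45 : cell s4 5 = cell s' 5 by rewrite (frC f4)//= /upd /= c35 c25 c15.
have c46 : cell s4 6 = cell s' 6 by rewrite (frC f4)//= /upd /= c36 c26 c16.
have c48 : cell s4 8 = weight_of m Q W i.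
  rewrite (frC f4)//= /upd /= c38 c28 mul1r /weight_of; apply: eq_bigr => b _.
  by rewrite W3.
have zE : phi [tuple cell s4 (40 + i)%N | i < d] = z.
  congr phi; apply: eq_from_tnth => j; rewrite !tnth_mktuple -t4//.
  have jd := ltn_ord j.
  by rewrite (frC f4) ?upd//= /upd ?inE; repeat case: eqP; lia.
rewrite /query /= zE; upds.
have n4 : nvar s4 vn = n by rewrite (frN g4).
have idx4 : nvar s4 vidx = i.
  by rewrite (frN f4)//= (frN f3)//= idx1.
split; upds.
- by fr.
- by rewrite idx4 addn1.
- rewrite big_ord_recr /= -c5 c45 n4 c48 c9 c10; congr (_ + _).
  by rewrite /Gre_term -/z cosE sinE.
- rewrite big_ord_recr /= -c6 c46 n4 c48 c9 c10; congr (_ + _).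
  by rewrite /Gim_term -/z cosE sinE.
- by move=> s' [f _ c5 c6]; apply: post.
Qed.

End Eval.

(** * Mean and weight read off at one center *)

Notation vptr := 30%N. Notation vmd := 31%N. Notation vkd := 32%N.

(** Cells 20 and 21 hold [G_0] at the center, 22 the current estimate [v], 4 the scale [s]. Cells 23
    and 24 are [G_s * conj G_0], cells 26 and 27 the same after rotation by [- s * v]. There are
    [n + 1] rounds, because both ends [2 ^ - n] and 1 of the range of scales are visited. *)
Definition refine_coord : program :=
  22 <-- RNat (nc 0) ;; 4 <-- RNat (nc 1) ;;
  For ve $vn (4 <-- RDiv (rc 4) (RNat (nc 2))) ;;
  For ve (NAdd $vn (nc 1)) (
    eval_G ;;
    23 <-- RAdd (RMul (rc 5) (rc 20)) (RMul (rc 6) (rc 21)) ;;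
    24 <-- RSub (RMul (rc 6) (rc 20)) (RMul (rc 5) (rc 21)) ;;
    25 <-- RMul (rc 4) (rc 22) ;;
    26 <-- RAdd (RMul (rc 23) (RCos (rc 25))) (RMul (rc 24) (RSin (rc 25))) ;;
    27 <-- RSub (RMul (rc 24) (RCos (rc 25))) (RMul (rc 23) (RSin (rc 25))) ;;
    22 <-- RAdd (rc 22) (RDiv (RAtan (RDiv (rc 27) (rc 26))) (rc 4)) ;;
    4 <-- RAdd (rc 4) (rc 4)).

(** A grid center near a location need not be close enough for the kernel to be near 1. The weight
    is therefore read only after moving to the scalar products of the directions with the means just
    found, where the kernel loses little. *)
Definition emit : program :=
  For vj' $vd (
    vj0 ::= $vj' ;; refine_coord ;;
    SetR (at_arr 4 (NAdd (NAdd $vop0 (nc 1)) $vj')) (rc 22)) ;;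
  vptr ::= nc 0 ;;
  For vi' $vm (
    28 <-- RNat (nc 0) ;;
    For vj' $vd (
      28 <-- RAdd (rc 28) (RMul (RCell (at_arr 0 $vptr))
               (RCell (at_arr 4 (NAdd (NAdd $vop0 (nc 1)) $vj')))) ;;
      vptr ::= NAdd $vptr (nc 1)) ;;
    SetR (at_arr 2 $vi') (rc 28)) ;;
  4 <-- RNat (nc 0) ;; vj0 ::= nc 0 ;; eval_G ;;
  SetR (at_arr 4 $vop0) (RSqrt (RAdd (RMul (rc 5) (rc 5)) (RMul (rc 6) (rc 6)))).

Section Spec2.
Variables (R : realType) (d : nat) (sample : nat -> nat -> R).
Variables (phi : d.-tuple R -> R[i]) (m n Q : nat).
Variables (W u : nat -> R).
Local Notation Gre := (Gre sample phi m n Q W u).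
Local Notation Gim := (Gim sample phi m n Q W u).

(* Near a mean [x], the phase of [G_s * conj G_0 * e^{- i s v}] is about
   [s * (x - v)]: it is small as soon as [v] is accurate at the scale [2 * s], and
   then its arctangent corrects [v]. *)
Definition refine_step (a0 b0 a b s v : R) : R :=
  let x := a * a0 + b * b0 in
  let y := b * a0 - a * b0 in
  v + atan ((y * cos (s * v) - x * sin (s * v)) /
            (x * cos (s * v) + y * sin (s * v))) / s.

Fixpoint refine (c : nat -> R) (j l : nat) : R :=
  if l is l'.+1 then
    let s := 2 ^+ l' / 2 ^+ n in
    refine_step (Gre c 0 0) (Gim c 0 0) (Gre c s j) (Gim c s j) s (refine c j l')
  else 0.

Definition mean_of (c : nat -> R) (j : nat) : R := refine c j n.+1.
Definition recenter (c : nat -> R) (i : nat) : R :=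
  \sum_(j < d) u (i * d + j)%N * mean_of c j.
Definition mass (c : nat -> R) : R :=
  Num.sqrt (Gre c 0 0 * Gre c 0 0 + Gim c 0 0 * Gim c 0 0).
Definition weight_est (c : nat -> R) : R := mass (recenter c).

(** Centers are read from an array whose cells beyond the first [m] hold unrelated data, so each
    quantity has to be seen to depend on the first [m] entries only. *)
Lemma Gre_ext c c' s j : (forall i, (i < m)%N -> c i = c' i) -> Gre c s j = Gre c' s j.
Proof.
move=> cc'; apply: eq_bigr => idx _; rewrite /Gre_term.
have shE : shift_of m Q c idx = shift_of m Q c' idx.
  by apply: eq_bigr => i _; rewrite cc'.
by rewrite /phase shE.
Qed.

Lemma Gim_ext c c' s j : (forall i, (i < m)%N -> c i = c' i) -> Gim c s j = Gim c' s j.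
Proof.
move=> cc'; apply: eq_bigr => idx _; rewrite /Gim_term.
have shE : shift_of m Q c idx = shift_of m Q c' idx.
  by apply: eq_bigr => i _; rewrite cc'.
by rewrite /phase shE.
Qed.

Lemma refine_ext c c' j l : (forall i, (i < m)%N -> c i = c' i) ->
  refine c j l = refine c' j l.
Proof.
by move=> cc'; elim: l => //= l ->; rewrite !(Gre_ext _ _ cc') !(Gim_ext _ _ cc').
Qed.

Lemma mass_ext c c' : (forall i, (i < m)%N -> c i = c' i) -> mass c = mass c'.
Proof. by move=> cc'; rewrite /mass (@Gre_ext c c')// (@Gim_ext c c'). Qed.

Lemma weight_est_ext c c' : (forall i, (i < m)%N -> c i = c' i) ->
  weight_est c = weight_est c'.
Proof.
move=> cc'; apply: mass_ext => i _; apply: eq_bigr => j _.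
by congr (_ * _); apply: refine_ext.
Qed.

End Spec2.

Definition in_out (d lo hi a : nat) : bool :=
  is_arr d 4 a && (lo <= (a - 40 - d) %/ 5 <= hi)%N.

Section Params.
Variables (R : realType) (d k n m Q K : nat).

Definition params (s : state R) : Prop :=
  [/\ nvar s vd = d, nvar s vk = k, nvar s vn = n, nvar s vm = m
    & [/\ nvar s vQ = Q, nvar s vQm = (Q ^ m)%N, nvar s vmd = (m * d)%N
        & nvar s vkd = (k * d.+1)%N]].

(** The upper bounds are numbers of rounds of the loops; [n.+1] is the number of scales in the phase
    refinement. *)
Definition sizes : Prop :=
  [/\ (0 < d)%N, (0 < Q)%N, (d <= K.+4)%N, (k <= K.+4)%N
    & [/\ (n.+1 <= K.+4)%N, (m <= K.+4)%N, (Q ^ m <= K.+4)%N,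
          (m * d <= K.+4)%N & (k * d.+1 <= K.+4)%N]].

Lemma frame_params vars A s s' : frame vars A s s' ->
  all (fun x => x \notin vars) [:: vd; vk; vn; vm; vQ; vQm; vmd; vkd] ->
  params s -> params s'.
Proof.
move=> [f _ _] /= /and5P[? ? ? ? /and5P[? ? ? ? _]] [? ? ? ? [? ? ? ?]].
by split; [| | | |split]; rewrite f.
Qed.

End Params.

Section Emit.
Variables (R : realType) (d : nat) (sample : nat -> nat -> R) (coin : nat -> R).
Variables (phi : d.-tuple R -> R[i]) (k n m Q K : nat).
Hypothesis Hsizes : sizes d k n m Q K.
Local Notation state := (state R).
Local Notation wp := (@wp R d sample coin phi K).
Local Notation params := (@params R d k n m Q).
Local Notation Wst s := (fun a => cell s (arr d 1 a)).
Local Notation ust s := (fun a => cell s (arr d 0 a)).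
Local Notation cst s := (fun a => cell s (arr d 2 a)).
Local Notation pst s := (fun a => cell s (arr d 3 a)).
Local Notation ost s := (fun a => cell s (arr d 4 a)).
Local Notation Gre s := (Gre sample phi m n Q (Wst s) (ust s)).
Local Notation Gim s := (Gim sample phi m n Q (Wst s) (ust s)).
Local Notation refine s := (refine sample phi m n Q (Wst s) (ust s)).
Local Notation mean_of s := (mean_of sample phi m n Q (Wst s) (ust s)).
Local Notation weight_est s := (weight_est sample phi m n Q (Wst s) (ust s)).
Local Notation recenter s := (recenter sample phi m n Q (Wst s) (ust s)).

Definition eval_vars := [:: vx; vq; vj; vp; vi; vs; vidx].

Lemma wp_eval (s0 s : state) (P : state -> Prop) (j : nat) :
  params s -> nvar s vj0 = j -> (j < d)%N ->
  ust s = ust s0 -> Wst s = Wst s0 ->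
  (forall s', frame eval_vars (evalA d) s s' ->
     cell s' 5 = Gre s0 (cst s) (cell s 4) j ->
     cell s' 6 = Gim s0 (cst s) (cell s 4) j -> P s') ->
  wp eval_G P s.
Proof.
case: Hsizes => d0 Q0 dK kK [nK mK QmK mdK kdK].
move=> [sd sk sn sm [sQ sQm smd skd]] sj jd uE WE post.
apply: (@wp_eval_G _ _ _ _ _ _ m n Q j) => //; first exact: ltnW.
by move=> s' f h5 h6; apply: post => //; rewrite -uE -WE.
Qed.

Definition refA (a : nat) : bool := (3 < a < 40)%N || is_t d a.

Lemma wp_refine_coord (s0 s : state) (P : state -> Prop) (j : nat) :
  params s -> nvar s vj0 = j -> (j < d)%N ->
  ust s = ust s0 -> Wst s = Wst s0 ->
  cell s 20 = Gre s0 (cst s) 0 0 -> cell s 21 = Gim s0 (cst s) 0 0 ->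
  (forall s', frame (ve :: eval_vars) refA s s' ->
     cell s' 20 = cell s 20 -> cell s' 21 = cell s 21 ->
     cell s' 22 = mean_of s0 (cst s) j -> P s') ->
  wp refine_coord P s.
Proof.
move=> ps sj jd uE WE s20 s21 post; rewrite /refine_coord; step.
case: (Hsizes) => d0 Q0 dK kK [nK mK QmK mdK kdK].
case: (ps) => sd sk sn sm [sQ sQm smd skd].
pose fv := ve :: eval_vars.
pose I l s' := [/\ frame fv refA s s', nvar s' ve = l,
  cell s' 20 = cell s 20, cell s' 21 = cell s 21 &
  cell s' 22 = 0 /\ cell s' 4 = 2 ^- l].
apply: (wp_for (I := I) (N := n)) => //.
- exact: ltnW.
- by split=> //; upds; [fr|split=> //; rewrite expr0 invr1].
- by move=> l s' [f lE _ _ _]; split=> //; rewrite /= (frN f).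
- move=> l s' ln [f lE c20 c21 [c22 c4]]; step; upds; split; upds => //.
  + by fr.
  + by rewrite lE addn1.
  + by split=> //; rewrite c4 exprS invfM mulrC.
move=> s1 [f1 _ c120 c121 [c122 c14]].
pose J l s' := [/\ frame fv refA s s', nvar s' ve = l,
  cell s' 20 = cell s 20, cell s' 21 = cell s 21 &
  cell s' 22 = refine s0 (cst s) j l /\ cell s' 4 = 2 ^+ l / 2 ^+ n].
apply: (wp_for (I := J) (N := n.+1)) => //.
- by split=> //; upds; [fr|split=> //; rewrite expr0 mul1r].
- by move=> l s' [f lE _ _ _]; split=> //; rewrite /= (frN f)// sn addn1.
- move=> l s' ln [f lE c20 c21 [c22 c4]]; step.
  have us : ust s' = ust s0.
    by rewrite -uE; apply: funext => a; rewrite (frC f)// /refA; addr.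
  have Ws : Wst s' = Wst s0.
    by rewrite -WE; apply: funext => a; rewrite (frC f)// /refA; addr.
  have cs : cst s' = cst s.
    by apply: funext => a; rewrite (frC f)// /refA; addr.
  apply: (@wp_eval s0 s' _ j) => //; first exact: frame_params f _ _.
    by rewrite (frN f).
  rewrite cs c4 => s2 f2 c5 c6; step; split; upds.
  + fr; apply: (frame_trans f); apply: frame_sub f2 => [x|a].
      by rewrite /fv !inE /= => ->; rewrite orbT.
    by rewrite /evalA /refA; lia.
  + by rewrite (frN f2)// lE addn1.
  + by rewrite (frC f2).
  + by rewrite (frC f2).
  + rewrite c5 c6 (frC f2 (a := 20%N))// (frC f2 (a := 21%N))//.
    rewrite (frC f2 (a := 22%N))// (frC f2 (a := 4%N))//.
    rewrite c20 c21 c22 c4 s20 s21; split=> //.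
    by rewrite exprS; lra.
move=> s' [f _ c20 c21 [c22 _]]; exact: post.
Qed.

Definition emit_vars := [:: vj0, vj', vi', vptr, ve & eval_vars].
Definition emitA (o a : nat) : bool :=
  [|| (3 < a < 40)%N, is_t d a, is_arr d 2 a | in_out d o (o + d) a].

Lemma wp_emit (s : state) (P : state -> Prop) (o : nat) :
  params s -> nvar s vop0 = o ->
  cell s 20 = Gre s (cst s) 0 0 -> cell s 21 = Gim s (cst s) 0 0 ->
  (forall s', frame emit_vars (emitA o) s s' ->
     ost s' o = weight_est s (cst s) ->
     (forall j, (j < d)%N -> ost s' (o + 1 + j)%N = mean_of s (cst s) j) -> P s') ->
  wp emit P s.
Proof.
move=> ps so s20 s21 post; rewrite /emit; step.
case: (Hsizes) => d0 Q0 dK kK [nK mK QmK mdK kdK].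
case: (ps) => sd sk sn sm [sQ sQm smd skd].
pose A1 a := [|| (3 < a < 40)%N, is_t d a | in_out d (o + 1) (o + d) a].
pose I j s' := [/\ frame emit_vars A1 s s', nvar s' vj' = j,
  cell s' 20 = cell s 20, cell s' 21 = cell s 21 &
  forall i, (i < j)%N -> ost s' (o + 1 + i)%N = mean_of s (cst s) i].
apply: (wp_for (I := I) (N := d)) => //.
- by split=> //; upds; fr.
- by move=> l s' [f lE _ _ _]; split=> //; rewrite /= (frN f).
- move=> j s' jd [f jE c20 c21 cE]; step.
  have us : ust s' = ust s by apply: funext => a; rewrite (frC f)// /A1 /in_out; addr.
  have Ws : Wst s' = Wst s by apply: funext => a; rewrite (frC f)// /A1 /in_out; addr.
  have cs : cst s' = cst s by apply: funext => a; rewrite (frC f)// /A1 /in_out; addr.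
  apply: (@wp_refine_coord s _ _ j) => //.
  + by apply: (@frame_params _ d k n m Q emit_vars A1 s) => //; fr.
  + by rewrite /= c20 s20 -cs.
  + by rewrite /= c21 s21 -cs.
  move=> s2 f2 c20' c21' c22; step.
  have f2' : frame emit_vars A1 s s2.
    apply: (frame_trans f); apply: frame_trans
      (_ : frame emit_vars A1 (set_nvar s' vj0 (neval s' $vj')) _); first by fr.
    apply: frame_sub f2 => [x|a].
      by rewrite /emit_vars !inE; lia.
    by rewrite /refA /A1; lia.
  have aE : neval s2 (at_arr 4 (NAdd (NAdd $vop0 (nc 1)) $vj')) = arr d 4 (o + 1 + j).
    rewrite /= !(frN f2)//= /upd /= (frN f (x := 0%N))// (frN f (x := vop0))//.
    by rewrite so sd jE.
  rewrite aE; split; upds.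
  + by rewrite /A1 /in_out; fr.
  + by rewrite (frN f2)//= /upd /= jE addn1.
  + by rewrite c20'.
  + by rewrite c21'.
  + move=> i ij; rewrite c22 /= cs; case: ifP => [/eqP|ne].
      by move=> e; have -> : i = j by move: e; rewrite /arr; lia.
    rewrite (frC f2)//=; last by rewrite /refA; addr.
    by apply: cE; move: ne; rewrite /arr; lia.
move=> s1 [f1 _ _ _ o1]; step.
have u1 : ust s1 = ust s by apply: funext => a; rewrite (frC f1)// /A1 /in_out; addr.
pose A2 a := [|| (3 < a < 40)%N, is_t d a, is_arr d 2 a | in_out d (o + 1) (o + d) a].
pose J i s' := [/\ frame emit_vars A2 s s', nvar s' vi' = i,
  nvar s' vptr = (i * d)%N, ost s' = ost s1 &
  forall x, (x < i)%N -> cst s' x = recenter s (cst s) x].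
have A12 a : A1 a -> A2 a by rewrite /A1 /A2; lia.
apply: (wp_for (I := J) (N := m)) => //.
- split=> //; upds; fr; exact: frame_sub f1.
- by move=> l s' [f lE _ _ _]; split=> //; rewrite /= (frN f).
- move=> i s' im [f iE pE oE cE]; step.
  pose L j s2 := [/\ frame [:: vj'; vptr] (pred1 28%N) s' s2, nvar s2 vj' = j,
    nvar s2 vptr = (i * d + j)%N &
    cell s2 28 = \sum_(j < j) ust s (i * d + j)%N * mean_of s (cst s) j].
  have us : ust s' = ust s by apply: funext => a; rewrite (frC f)// /A2 /in_out; addr.
  apply: (wp_for (I := L) (N := d)) => //.
  + by split=> //; upds; [fr|rewrite pE addn0|rewrite big_ord0].
  + by move=> l s2 [f2 lE _ _]; split=> //; rewrite /= (frN f2)// (frN f).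
  + move=> j s2 jd [f2 jE ptE c28]; step; split; upds.
    * by fr.
    * by rewrite jE addn1.
    * by rewrite ptE addn1 addnS.
    * rewrite big_ord_recr /= c28 ptE jE (frN f2 (x := 0%N))// (frN f2 (x := vop0))//.
      rewrite (frN f (x := 0%N))// (frN f (x := vop0))// so sd.
      rewrite -/(arr d 0 (i * d + j)) -/(arr d 4 (o + 1 + j)).
      rewrite (frC f2); last by rewrite /= /arr; lia.
      rewrite (frC f2); last by rewrite /= /arr; lia.
      by rewrite -(congr1 (fun g => g (i * d + j)%N) us) -(o1 j jd) -(congr1 (fun g => g (o + 1 + j)%N) oE).
  move=> s2 [f2 jE ptE c28]; step.
  have f2' : frame emit_vars A2 s s2.
    apply: (frame_trans f); apply: frame_sub f2 => [x|a].
      by rewrite /emit_vars !inE; lia.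
    by move=> /eqP ->.
  have aE : neval s2 (at_arr 2 $vi') = arr d 2 i.
    by rewrite /= (frN f2 (x := vi'))// (frN f2' (x := 0%N))// iE sd.
  rewrite aE; split; upds.
  + by rewrite /A2; fr.
  + by rewrite (frN f2)// iE addn1.
  + by rewrite ptE mulSn addnC.
  + apply: funext => a; case: eqP => [|_]; first by addr.
    by rewrite -(congr1 (fun g => g a) oE) (frC f2)//= /arr; lia.
  + move=> x xi; case: ifP => [/eqP e|ne].
      have -> : x = i by move: e; rewrite /arr; lia.
      by rewrite c28.
    rewrite (frC f2); last by rewrite /= /arr; lia.
    by apply: cE; move: ne; rewrite /arr; lia.
move=> s2 [f2 _ _ o2 c2]; step.
have u2 : ust s2 = ust s by apply: funext => a; rewrite (frC f2)// /A2 /in_out; addr.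
have W2 : Wst s2 = Wst s by apply: funext => a; rewrite (frC f2)// /A2 /in_out; addr.
have A23 a : A2 a -> emitA o a.
  rewrite /A2 /emitA /in_out /is_arr; case: (is_t d a) => /=; lia.
apply: (@wp_eval s _ _ 0) => //.
  by apply: (@frame_params _ d k n m Q emit_vars A2 s) => //; fr.
move=> s3 f3 c5 c6; step.
have f3' : frame emit_vars (emitA o) s s3.
  apply: (@frame_trans _ _ _ _ s2); first exact: frame_sub f2.
  apply: frame_trans (_ : frame emit_vars (emitA o)
    (set_nvar (set_cell s2 4 0) vj0 0) _); first by fr.
  apply: frame_sub f3 => [x|a]; first by rewrite /emit_vars !inE => /= ->; rewrite !orbT.
  by rewrite /evalA /emitA; lia.
have aE : neval s3 (at_arr 4 $vop0) = arr d 4 o.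
  by rewrite /= (frN f3' (x := 0%N))// (frN f3' (x := vop0))// so sd.
have cE i : (i < m)%N -> cst (set_nvar (set_cell s2 4 0) vj0 0) i = recenter s (cst s) i.
  by move=> im; upds; apply: c2.
rewrite aE; apply: post; upds.
- by rewrite /emitA /in_out; fr.
- rewrite eqxx c5 c6 /= /(weight_est _) /mass.
  by rewrite (Gre_ext _ _ _ _ _ _ _ _ cE) (Gim_ext _ _ _ _ _ _ _ _ cE).
- move=> j jd; case: eqP => [|_]; first by addr.
  rewrite (frC f3); last by rewrite /evalA; addr.
  by upds; rewrite -(o1 j jd) -(congr1 (fun g => g (o + 1 + j)%N) o2).
Qed.

End Emit.

(** * Greedy choice of candidates; random directions *)

Definition far_check : program :=
  vfar ::= nc 1 ;; vpp ::= nc 0 ;;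
  For vpk $vcnt (
    vsep ::= nc 0 ;;
    For vi' $vm (
      If (RLt (RDiv (RNat (nc 1)) (RMul (RNat (nc 256)) (RMul (RNat $vr) (RNat $vr))))
           (RMul (RSin (RDiv (RSub (RCell (at_arr 2 $vi')) (RCell (at_arr 3 $vpp)))
                             (RNat (nc 2))))
                 (RSin (RDiv (RSub (RCell (at_arr 2 $vi')) (RCell (at_arr 3 $vpp)))
                             (RNat (nc 2))))))
        (vsep ::= nc 1) Skip ;;
      vpp ::= NAdd $vpp (nc 1)) ;;
    If (NLt $vsep (nc 1)) (vfar ::= nc 0) Skip).

Definition load_candidate : program :=
  vx ::= $vci ;;
  For vi' $vm (
    digit_div ;;
    SetR (at_arr 2 $vi') (RDiv (RMul (RNat (nc 8)) (RNat $vx)) (RNat $vQ)) ;;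
    vx ::= $vq).

Definition try_candidate : program :=
  load_candidate ;; 4 <-- RNat (nc 0) ;; vj0 ::= nc 0 ;; eval_G ;;
  29 <-- RAdd (RMul (rc 5) (rc 5)) (RMul (rc 6) (rc 6)) ;;
  If (RLt (rc 29) (rc 3)) Skip (
    far_check ;;
    If (NLt (nc 0) $vfar) (
      If (NLt $vcnt $vk) (
        20 <-- rc 5 ;; 21 <-- rc 6 ;;
        For vi' $vm (
          SetR (at_arr 3 $vpp) (RCell (at_arr 2 $vi')) ;;
          vpp ::= NAdd $vpp (nc 1)) ;;
        vop0 ::= $vop ;; emit ;;
        vcnt ::= NAdd $vcnt (nc 1) ;;
        vop ::= NAdd $vop (NAdd $vd (nc 1))) Skip) Skip).

(** Each entry is [M] times a random binary expansion with digit weights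
    [1, 1/2, ..., 2 ^ - (n - 1)]. A uniform coin is used only through its comparison with 1/2, so
    the directions take finitely many values, one for each pattern of bits. *)
Definition gen_directions : program :=
  For vptr $vmd (
    20 <-- RNat (nc 0) ;; 21 <-- rc 2 ;;
    For vb $vn (
      Coin (nc 22) ;;
      If (RLt (rc 22) (RDiv (RNat (nc 1)) (RNat (nc 2)))) Skip
         (20 <-- RAdd (rc 20) (rc 21)) ;;
      21 <-- RDiv (rc 21) (RNat (nc 2))) ;;
    SetR (at_arr 0 $vptr) (rc 20)).

Section Spec3.
Variables (R : realType) (d : nat) (sample : nat -> nat -> R).
Variables (phi : d.-tuple R -> R[i]) (k m n Q rr : nat).

Definition sin2h (x : R) : R := sin (x / 2) * sin (x / 2).
(* [(4 * rho) ^ 2] for the resolution [rho = 1 / (64 * rr)]. *)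
Definition sep_bound : R := 1 / (256%:R * (rr%:R * rr%:R)).
Definition apart (c p : nat -> R) : bool :=
  \big[orb/false]_(i < m) (sep_bound < sin2h (c i - p i)).
(* A grid in [0, 8)^m, which covers a period of every coordinate. *)
Definition candidate (ci i : nat) : R := 8%:R * (digit Q ci i)%:R / Q%:R.

Definition gen_dir (coin : nat -> R) (M : R) (start x : nat) : R :=
  \sum_(b < n) if coin (start + (x * n + b))%N < 1 / 2 then 0 else M / 2 ^+ b.

Variables (W u : nat -> R) (th2 : R).
Local Notation Gre := (Gre sample phi m n Q W u).
Local Notation Gim := (Gim sample phi m n Q W u).
Definition accepted (c : nat -> R) : bool :=
  ~~ (Gre c 0 0 * Gre c 0 0 + Gim c 0 0 * Gim c 0 0 < th2).

(** Invariant of the greedy scan after the candidates below [bound]. The last clause, maximality, is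
    claimed only while fewer than [k] picks are present, because after that no candidate is added
    any more. *)
Definition picks_spec (bound cnt : nat) (pick : nat -> nat) : Prop :=
  [/\ (cnt <= k)%N,
      forall p, (p < cnt)%N -> (pick p < Q ^ m)%N /\ accepted (candidate (pick p)),
      forall p q, (p < q < cnt)%N ->
        apart (candidate (pick q)) (candidate (pick p))
    & (cnt < k)%N -> forall ci, (ci < bound)%N -> accepted (candidate ci) ->
        exists2 p, (p < cnt)%N & ~~ apart (candidate ci) (candidate (pick p))].

Definition outs_spec (cnt : nat) (pick : nat -> nat) (out : nat -> R) : Prop :=
  forall p, (p < cnt)%N ->
    out (p * d.+1)%N = weight_est sample phi m n Q W u (candidate (pick p)) /\
    forall j, (j < d)%N ->
      out (p * d.+1 + 1 + j)%N = mean_of sample phi m n Q W u (candidate (pick p)) j.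

End Spec3.

Section Trial.
Variables (R : realType) (d : nat) (sample : nat -> nat -> R) (coin : nat -> R).
Variables (phi : d.-tuple R -> R[i]) (k n m Q K rr : nat).
Hypothesis Hsizes : sizes d k n m Q K.
Local Notation state := (state R).
Local Notation wp := (@wp R d sample coin phi K).
Local Notation params := (@params R d k n m Q).
Local Notation Wst s := (fun a => cell s (arr d 1 a)).
Local Notation ust s := (fun a => cell s (arr d 0 a)).
Local Notation cst s := (fun a => cell s (arr d 2 a)).
Local Notation pst s := (fun a => cell s (arr d 3 a)).
Local Notation ost s := (fun a => cell s (arr d 4 a)).
Local Notation apart := (@apart R m rr).
Local Notation candidate := (@candidate R Q).

Definition far_vars := [:: vfar; vpp; vpk; vsep; vi'].

(** Besides the outcome of the test, the final value of [vpp] matters: it is the first free slot of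
    the array of picks, where an accepted candidate is then stored. *)
Lemma wp_far_check (cnt : nat) (P : state -> Prop) (s : state) :
  params s -> nvar s vr = rr -> nvar s vcnt = cnt -> (cnt <= k)%N ->
  (forall s', frame far_vars pred0 s s' -> nvar s' vpp = (cnt * m)%N ->
     nvar s' vfar = (\big[andb/true]_(p < cnt)
       apart (cst s) (fun i => pst s (p * m + i)%N)) :> nat -> P s') ->
  wp far_check P s.
Proof.
move=> ps sr sc ck post; rewrite /far_check; step.
case: (Hsizes) => d0 Q0 dK kK [nK mK QmK mdK kdK].
case: (ps) => sd sk sn sm [sQ sQm smd skd].
pose far p := apart (cst s) (fun i => pst s (p * m + i)%N).
pose I p s' := [/\ frame far_vars pred0 s s', nvar s' vpk = p,
  nvar s' vpp = (p * m)%N & nvar s' vfar = (\big[andb/true]_(p < p) far p) :> nat].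
apply: (wp_for (I := I) (N := cnt)) => //.
- exact: leq_trans kK.
- by split=> //; upds; [fr|rewrite big_ord0].
- by move=> l s' [f lE _ _]; split=> //; rewrite /= (frN f).
- move=> p s' pc [f pE ppE fE]; step.
  pose J i s2 := [/\ frame [:: vpp; vsep; vi'] pred0 s' s2, nvar s2 vi' = i,
    nvar s2 vpp = (p * m + i)%N & nvar s2 vsep = (\big[orb/false]_(i < i)
      (sep_bound R rr < sin2h (cst s i - pst s (p * m + i)%N))) :> nat].
  apply: (wp_for (I := J) (N := m)) => //.
  + by split=> //; upds; [fr|rewrite addn0|rewrite big_ord0].
  + by move=> l s2 [f2 lE _ _]; split=> //; rewrite /= (frN f2)// (frN f).
  + move=> i s2 im [f2 iE ppE2 sE]; step.
    have f02 : frame far_vars pred0 s s2.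
      apply: (frame_trans f); apply: frame_sub f2 => // x; rewrite !inE; lia.
    have tE : teval sample s2 (RLt
        (RDiv (RNat (nc 1)) (RMul (RNat (nc 256)) (RMul (RNat $vr) (RNat $vr))))
           (RMul (RSin (RDiv (RSub (RCell (at_arr 2 $vi')) (RCell (at_arr 3 $vpp)))
                             (RNat (nc 2))))
                 (RSin (RDiv (RSub (RCell (at_arr 2 $vi')) (RCell (at_arr 3 $vpp)))
                             (RNat (nc 2)))))) =
      (sep_bound R rr < sin2h (cst s i - pst s (p * m + i)%N)).
      rewrite /= iE ppE2 (frN f02 (x := vr))// (frN f02 (x := vd))// sr sd.
      by rewrite -/(arr d 2 i) -/(arr d 3 (p * m + i)) !(frC f02).
    apply: wp_if; rewrite tE; set b := (_ < _).
    have sE' : (0 < nvar s2 vsep)%N || b = \big[orb/false]_(i < i.+1)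
      (sep_bound R rr < sin2h (cst s i - pst s (p * m + i)%N)) :> bool.
      by rewrite big_ord_recr /= sE; case: (\big[_/_]_(_ < _) _).
    case: b sE' => sE'; step; step; split; upds.
    * by fr.
    * by rewrite iE addn1.
    * by rewrite ppE2 addn1 addnS.
    * by rewrite -sE' orbT.
    * by fr.
    * by rewrite iE addn1.
    * by rewrite ppE2 addn1 addnS.
    * by rewrite -sE' orbF sE; case: (\big[_/_]_(_ < _) _).
  move=> s2 [f2 _ ppE2 sE]; apply: wp_if.
  have f02 : frame far_vars pred0 s s2.
    apply: (frame_trans f); apply: frame_sub f2 => // x; rewrite !inE; lia.
  have -> : teval sample s2 (NLt $vsep (nc 1)) = ~~ far p.
    by rewrite /= sE /far /apart; case: (\big[_/_]_(_ < _) _).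
  case: ifP => fp; step; split; upds.
  + by fr.
  + by rewrite (frN f2)// pE addn1.
  + by rewrite ppE2 mulSn addnC.
  + by rewrite big_ord_recr /= (negbTE fp) andbF.
  + by fr.
  + by rewrite (frN f2)// pE addn1.
  + by rewrite ppE2 mulSn addnC.
  + by rewrite big_ord_recr /= (negbFE fp) andbT (frN f2).
- by move=> s' [f _ ppE fE]; apply: post.
Qed.

Definition cand_vars := [:: vx; vq; vi'].

Lemma wp_load_candidate (ci : nat) (P : state -> Prop) (s : state) :
  params s -> nvar s vci = ci -> (ci < Q ^ m)%N ->
  (forall s', frame cand_vars (is_arr d 2) s s' ->
     (forall i, (i < m)%N -> cst s' i = candidate ci i) -> P s') ->
  wp load_candidate P s.
Proof.
move=> ps sci ciQ post; rewrite /load_candidate; step.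
case: (Hsizes) => d0 Q0 dK kK [nK mK QmK mdK kdK].
case: (ps) => sd sk sn sm [sQ sQm smd skd].
pose I i s' := [/\ frame cand_vars (is_arr d 2) s s', nvar s' vi' = i,
  nvar s' vx = (ci %/ Q ^ i)%N & forall j, (j < i)%N -> cst s' j = candidate ci j].
apply: (wp_for (I := I) (N := m)) => //.
- by split=> //; upds; [fr|rewrite expn0 divn1].
- by move=> l s' [f lE _ _]; split=> //; rewrite /= (frN f).
- move=> i s' im [f iE xE cE].
  apply: wp_seq; apply: (@wp_digit_div _ _ _ _ _ _ _ _ _ _ Q0 _ _ xE).
  + by rewrite (leq_ltn_trans (leq_div _ _)) ?(leq_trans ciQ).
  + by rewrite (frN f).
  move=> s1 f1 x1 q1; step.
  have f01 : frame cand_vars (is_arr d 2) s s1.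
    by apply: frame_trans f _; apply: frame_sub f1 => // x; rewrite !inE; lia.
  have aE : neval s1 (at_arr 2 $vi') = arr d 2 i.
    by rewrite /= (frN f1 (x := vi'))// (frN f01 (x := 0%N))// iE sd.
  rewrite aE; split; upds.
  + by fr.
  + by rewrite (frN f1)// iE addn1.
  + by rewrite q1 divn_digit.
  + move=> j ji; case: ifP => [/eqP e|ne].
      have -> : j = i by move: e; rewrite /arr; lia.
      by rewrite x1 (frN f01 (x := vQ))// sQ.
    by rewrite (frC f1)// cE//; move: ne; rewrite /arr; lia.
- by move=> s' [f _ _ cE]; apply: post.
Qed.

Definition with_coins (s : state) (c : nat) : state := State (nvar s) (cell s) c.

Definition gen_vars := [:: vptr; vb].
Definition genA (a : nat) : bool := (19 < a < 23)%N || is_arr d 0 a.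

Lemma wp_gen_directions (M : R) (start : nat) (P : state -> Prop) (s : state) :
  params s -> cell s 2 = M -> coins_used s = start ->
  (forall s', frame gen_vars genA (with_coins s (start + m * d * n)%N) s' ->
     (forall x, (x < m * d)%N -> ust s' x = gen_dir n coin M start x) -> P s') ->
  wp gen_directions P s.
Proof.
move=> ps s2 sc post; rewrite /gen_directions; step.
case: (Hsizes) => d0 Q0 dK kK [nK mK QmK mdK kdK].
case: (ps) => sd sk sn sm [sQ sQm smd skd].
pose I x s' := [/\ frame gen_vars genA (with_coins s (start + x * n)%N) s',
  nvar s' vptr = x & forall y, (y < x)%N -> ust s' y = gen_dir n coin M start y].
apply: (wp_for (I := I) (N := (m * d)%N)) => //.
- split=> //; split=> //= [x|]; last by rewrite sc mul0n addn0.
  by rewrite /upd inE negb_or => /andP[/negbTE ->].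
- by move=> l s' [f lE _]; split=> //; rewrite /= (frN f).
- move=> x s' xmd [f xE uE]; step.
  pose J b s1 := [/\ frame gen_vars genA (with_coins s' (start + (x * n + b))%N) s1,
    nvar s1 vb = b, nvar s1 vptr = x, ust s1 = ust s' & cell s1 21 = M / 2 ^+ b /\
    cell s1 20 = \sum_(b < b) if coin (start + (x * n + b))%N < 1 / 2 then 0
                              else M / 2 ^+ b].
  apply: (wp_for (I := J) (N := n)) => //.
  + exact: ltnW.
  + split=> //; upds.
    * split=> //= [y|a|].
      - by rewrite /upd !inE negb_or => /andP[_ /negbTE ->].
      - by rewrite /upd /genA; do 2 (case: eqP => [-> //|_]).
      - by rewrite (frK f) /= addn0.
    * split; last by rewrite big_ord0.
      by rewrite expr0 divr1 (frC f)//= s2.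
  + by move=> l s1 [f1 lE _ _ _]; split=> //; rewrite /= (frN f1)//= (frN f).
  + move=> b s1 bn [f1 bE xE1 uE1 [c21 c20]]; step.
    apply: wp_if; upds.
    have cE : coins_used s1 = (start + (x * n + b))%N by rewrite (frK f1).
    have ff s2' : (forall y, y != vb -> nvar s2' y = nvar s1 y) ->
       nvar s2' vb = b.+1 ->
       (forall a, ~~ (19 < a < 23)%N -> cell s2' a = cell s1 a) ->
       coins_used s2' = (coins_used s1).+1 -> cell s2' 21 = M / 2 ^+ b.+1 ->
       cell s2' 20 = cell s1 20 + (if coin (coins_used s1) < 1 / 2 then 0
                              else M / 2 ^+ b) -> J b.+1 s2'.
      move=> g1 g2 g3 g4 g5 g6; split=> //.
      * split=> [y|a|]; first by rewrite !inE negb_or => /andP[yp yb];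
          rewrite g1// (frN f1)// !inE negb_or yp.
        - by rewrite /genA negb_or => /andP[a1 a2]; rewrite g3// (frC f1)// /genA negb_or a1.
        - by rewrite g4 cE /= !addnS.
      * by rewrite g1.
      * by rewrite -uE1; apply: funext => a; rewrite g3//; addr.
      * by split=> //; rewrite big_ord_recr /= -c20 g6 cE.
    have h21 : cell s1 21 / 2 = M / 2 ^+ b.+1 by rewrite c21 exprS invfM; lra.
    case: ifP => h; step; apply: ff; upds => //.
    * by move=> y /negbTE ->.
    * by rewrite bE addn1.
    * by move=> a ah; do 2 (case: eqP => [e|_]; first by move: ah; rewrite e).
    * by rewrite h addr0.
    * by move=> y /negbTE ->.
    * by rewrite bE addn1.
    * by move=> a ah; do 3 (case: eqP => [e|_]; first by move: ah; rewrite e).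
    * by rewrite h c21.
  move=> s1 [f1 _ xE1 uE1 [_ c20]]; step.
  have aE : neval s1 (at_arr 0 $vptr) = arr d 0 x.
    by rewrite /= xE1 (frN f1 (x := 0%N))//= (frN f)//= sd.
  rewrite aE; split; upds.
  + split=> [y|a|]; first by move=> yv; rewrite /= /upd; case: eqP yv => [->//|_] yv;
      rewrite (frN f1)//= (frN f).
    * move=> av; rewrite /= /upd; case: eqP => [e|_]; last by rewrite (frC f1)//= (frC f).
      by move: av; rewrite e /genA; addr.
    * by rewrite /= (frK f1) /= mulSn; lia.
  + by rewrite xE1 addn1.
  + move=> y yx; case: ifP => [/eqP e|ne].
      by have -> : y = x by move: e; rewrite /arr; lia.
    by rewrite (congr1 (fun g => g y) uE1) uE//; move: ne; rewrite /arr; lia.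
- by move=> s' [f _ uE]; apply: post.
Qed.

End Trial.

Section Candidates.
Variables (R : realType) (d : nat) (sample : nat -> nat -> R) (coin : nat -> R).
Variables (phi : d.-tuple R -> R[i]) (k n m Q K rr : nat).
Hypothesis Hsizes : sizes d k n m Q K.
Local Notation state := (state R).
Local Notation wp := (@wp R d sample coin phi K).
Local Notation params := (@params R d k n m Q).
Local Notation Wst s := (fun a => cell s (arr d 1 a)).
Local Notation ust s := (fun a => cell s (arr d 0 a)).
Local Notation cst s := (fun a => cell s (arr d 2 a)).
Local Notation pst s := (fun a => cell s (arr d 3 a)).
Local Notation ost s := (fun a => cell s (arr d 4 a)).
Local Notation apart := (@apart R m rr).
Local Notation candidate := (@candidate R Q).

Lemma apart_ext (c c' p p' : nat -> R) : (forall i, (i < m)%N -> c i = c' i) ->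
  (forall i, (i < m)%N -> p i = p' i) -> apart c p = apart c' p'.
Proof. by move=> cc pp; apply: eq_bigr => i _; rewrite cc// pp. Qed.

Lemma apartxx (c : nat -> R) : ~~ apart c c.
Proof.
rewrite /apart; elim/big_rec: _ => // i b _ /negbTE ->; rewrite orbF.
rewrite subrr /sin2h mul0r sin0 mulr0 -leNgt /sep_bound.
by rewrite divr_ge0// mulr_ge0// -expr2 sqr_ge0.
Qed.

Lemma big_andP N (f : nat -> bool) :
  reflect (forall p, (p < N)%N -> f p) (\big[andb/true]_(p < N) f p).
Proof.
elim: N => [|N IH]; first by rewrite big_ord0; constructor.
rewrite big_ord_recr /=; apply: (iffP andP) => [[/IH h fN] p|h].
  by rewrite ltnS leq_eqVlt => /predU1P[->//|]; exact: h.
by split; [apply/IH => p pN; apply: h; exact: ltnW|exact: h].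
Qed.

Definition cand_all_vars :=
  [:: vcnt, vop, vop0, vx, vq, vi', vfar, vpp, vpk, vsep & emit_vars].
Definition candA (a : nat) : bool :=
  [|| (3 < a < 40)%N, is_t d a, is_arr d 2 a, is_arr d 3 a | is_arr d 4 a].

Definition picks_inv (s0 : state) (bound cnt : nat) (pick : nat -> nat) (s : state) :=
  [/\ nvar s vcnt = cnt, nvar s vop = (cnt * d.+1)%N,
      picks_spec sample phi k m n Q rr (Wst s0) (ust s0) (cell s0 3) bound cnt pick,
      forall p i, (p < cnt)%N -> (i < m)%N ->
        pst s (p * m + i)%N = candidate (pick p) i
    & outs_spec sample phi m n Q (Wst s0) (ust s0) cnt pick (ost s)].

Lemma wp_try_candidate (s0 s : state) (ci cnt : nat) pick (P : state -> Prop) :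
  params s -> nvar s vr = rr -> nvar s vci = ci -> (ci < Q ^ m)%N ->
  ust s = ust s0 -> Wst s = Wst s0 -> cell s 3 = cell s0 3 ->
  picks_inv s0 ci cnt pick s ->
  (forall s' cnt' pick', frame cand_all_vars candA s s' ->
     picks_inv s0 ci.+1 cnt' pick' s' -> P s') ->
  wp try_candidate P s.
Proof.
move=> ps sr sci ciQ us Ws s3 [scnt sop [ck pickA pickS pickC] pE oE] post.
rewrite /try_candidate; step.
case: (Hsizes) => d0 Q0 dK kK [nK mK QmK mdK kdK].
case: (ps) => sd sk sn sm [sQ sQm smd skd].
apply: (@wp_load_candidate _ _ _ _ _ _ _ _ _ _ Hsizes ci) => // s1 f1 c1; step.
have p1 : params s1 by apply: (frame_params f1).
have u1 : ust s1 = ust s0.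
  by rewrite -us; apply: funext => a; rewrite (frC f1)//; addr.
have W1 : Wst s1 = Wst s0.
  by rewrite -Ws; apply: funext => a; rewrite (frC f1)//; addr.
pose s1' := set_nvar (set_cell s1 4 0) vj0 0.
have f1' : frame cand_all_vars candA s s1'.
  rewrite /candA; fr; apply: frame_sub f1 => // [x|a].
    by rewrite /cand_all_vars !inE; lia.
  by move=> ->; rewrite !orbT.
apply: (@wp_eval _ _ _ _ _ _ _ _ _ _ Hsizes s0 _ _ 0%N) => //.
move=> s2 f2 c5 c6; step.
have f02 : frame cand_all_vars candA s s2.
  apply: (frame_trans f1'); apply: frame_sub f2 => [x|a].
    by rewrite /cand_all_vars !inE; lia.
  by rewrite /evalA /candA; lia.
have cE i : (i < m)%N -> cst s1' i = candidate ci i by move=> im; upds; apply: c1.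
have {}c5 : cell s2 5 = Gre sample phi m n Q (Wst s0) (ust s0) (candidate ci) 0 0.
  by rewrite c5; exact: Gre_ext.
have {}c6 : cell s2 6 = Gim sample phi m n Q (Wst s0) (ust s0) (candidate ci) 0 0.
  by rewrite c6; exact: Gim_ext.
pose s3' := set_cell s2 29 (cell s2 5 * cell s2 5 + cell s2 6 * cell s2 6).
rewrite -[X in wp _ _ X]/s3'.
have f03 : frame cand_all_vars candA s s3' by rewrite /candA; fr.
apply: wp_if.
have -> : teval sample s3' (RLt (rc 29) (rc 3)) =
   ~~ accepted sample phi m n Q (Wst s0) (ust s0) (cell s0 3) (candidate ci).
  by rewrite /accepted negbK -c5 -c6 -s3 /s3'; upds; rewrite (frC f02 (a := 3%N)).
have pk x : (x < cnt)%N -> forall i, (i < m)%N -> pst s3' (x * m + i)%N = candidate (pick x) i.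
  move=> xc i im; rewrite -pE// /s3'; upds.
  rewrite (frC f2); last by rewrite /evalA; addr.
  by upds; rewrite (frC f1)//; addr.
have ok3 : ost s3' = ost s.
  apply: funext => x; rewrite /s3'; upds.
  rewrite (frC f2); last by rewrite /evalA; addr.
  by upds; rewrite (frC f1)//; addr.
case: ifPn => [nacc|/negPn acc]; step.
  apply: (post _ cnt pick) => //; split=> //.
  - by rewrite /s3' /= (frN f2)//= /upd /= (frN f1).
  - by rewrite /s3' /= (frN f2)//= /upd /= (frN f1).
  - split=> // cntk c'; rewrite ltnS leq_eqVlt => /predU1P[->|]; last exact: pickC.
    by rewrite (negbTE nacc).
  - by move=> p i pc im; apply: pk.
  - by rewrite ok3.
have p1' : params s1' by [].
have p3 : params s3' by exact: (frame_params f2 _ p1').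
have r3 : nvar s3' vr = rr by rewrite (frN f03).
have cnt3 : nvar s3' vcnt = cnt by rewrite /s3' /= (frN f2)//= /upd /= (frN f1).
apply: (@wp_far_check _ _ _ _ _ _ _ _ _ _ _ Hsizes cnt) => //.
move=> s4 f4 pp4 far4.
have f04 : frame cand_all_vars candA s s4.
  apply: (frame_trans f03); apply: frame_sub f4 => // x.
  by rewrite /cand_all_vars !inE; lia.
have cst3 i : (i < m)%N -> cst s3' i = candidate ci i.
  move=> im; rewrite /s3'; upds; rewrite (frC f2) ?cE//.
  by rewrite /evalA; addr.
have {}far4 : nvar s4 vfar = (\big[andb/true]_(p < cnt)
    apart (candidate ci) (candidate (pick p))) :> nat.
  rewrite far4; congr (nat_of_bool _); apply: eq_bigr => p _.
  by rewrite r3; apply: apart_ext => // i im; exact: pk.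
have cnt4 : nvar s4 vcnt = cnt by rewrite (frN f4).
have op4 : nvar s4 vop = (cnt * d.+1)%N by rewrite (frN f4)//= (frN f2)//= /upd /= (frN f1).
have pk4 x : pst s4 x = pst s3' x by rewrite (frC f4).
have ok4 : ost s4 = ost s.
  by rewrite -ok3; apply: funext => x; rewrite (frC f4).
apply: wp_if => /=; rewrite far4.
case: (big_andP cnt (fun p => apart (candidate ci) (candidate (pick p)))) => far; last first.
  rewrite /=; step; apply: (post _ cnt pick) => //; split=> //.
  - split=> // cntk c'; rewrite ltnS leq_eqVlt => /predU1P[->|]; last exact: pickC.
    move=> _; move: far => /existsNP[p] /not_implyP[pc] /negP ns.
    by exists p.
  - by move=> p i pc im; rewrite pk4 pk.
  - by rewrite ok4.
rewrite /=; apply: wp_if => /=; rewrite cnt4 (frN f4)// (_ : nvar s3' vk = k); last by case: p3.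
case: ifPn => cntk; last first.
  step; apply: (post _ cnt pick) => //; split=> //.
  - by split=> // cntk'; rewrite cntk' in cntk.
  - by move=> p i pc im; rewrite pk4 pk.
  - by rewrite ok4.
step.
have p4 : params s4 by apply: frame_params f4 _ p3.
case: (p4) => sd4 sk4 sn4 sm4 [sQ4 sQm4 smd4 skd4].
pose s5 := set_cell (set_cell s4 20 (cell s4 5)) 21 (cell s4 6).
pose A5 a := [|| a == 20%N, a == 21%N | is_arr d 3 a].
pose I i s' := [/\ frame [:: vi'; vpp] A5 s4 s', nvar s' vi' = i,
  nvar s' vpp = (cnt * m + i)%N, cell s' 20 = cell s4 5 /\ cell s' 21 = cell s4 6 &
  (forall j, (j < i)%N -> pst s' (cnt * m + j)%N = candidate ci j) /\
  (forall j, (j < cnt * m)%N -> pst s' j = pst s4 j)].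
have cst4 i : (i < m)%N -> cst s4 i = candidate ci i.
  by move=> im; rewrite (frC f4)// cst3.
apply: (wp_for (I := I) (N := m)) => //.
- split=> //; upds.
  + by rewrite /A5; fr.
  + by rewrite pp4 addn0.
- by move=> l s' [f lE _ _ _]; split=> //; rewrite /= (frN f).
- move=> i s' im [f iE ppE c20 [pE1 pE2]]; step.
  have aE : neval s' (at_arr 3 $vpp) = arr d 3 (cnt * m + i).
    by rewrite /= ppE (frN f)//= sd4.
  rewrite aE; split; upds.
  + by rewrite /A5; fr.
  + by rewrite iE addn1.
  + by rewrite ppE addn1 addnS.
  + by [].
  + split=> j ji; case: ifP => [/eqP e|ne].
    * have -> : j = i by move: e; rewrite /arr; lia.
      rewrite iE (frN f (x := vd))// sd4 -/(arr d 2 i) (frC f) ?cst4// /A5; addr.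
    * by apply: pE1; move: ne; rewrite /arr; lia.
    * by move: e; rewrite /arr; lia.
    * exact: pE2.
move=> s6 [f6 _ _ [c20 c21] [pE1 pE2]]; step.
pose s7 := set_nvar s6 vop0 (nvar s6 vop).
rewrite -[X in wp _ _ X]/s7.
have f07 : frame cand_all_vars candA s s7.
  fr; apply: (frame_trans f04); apply: frame_sub f6 => [x|a].
    by rewrite /cand_all_vars !inE; lia.
  by rewrite /A5 /candA; case: (is_arr d 3 a); rewrite ?orbT ?orbF//; lia.
have p7 : params s7.
  have : params s6 by apply: frame_params f6 _ p4.
  by [].
have W7 : Wst s7 = Wst s0.
  by rewrite -Ws; apply: funext => a; rewrite (frC f07)// /candA; addr.
have u7 : ust s7 = ust s0.
  by rewrite -us; apply: funext => a; rewrite (frC f07)// /candA; addr.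
have c7 i : (i < m)%N -> cst s7 i = candidate ci i.
  by move=> im; rewrite /s7 /= (frC f6) ?cst4// /A5; addr.
have c45 : cell s4 5 = Gre sample phi m n Q (Wst s0) (ust s0) (candidate ci) 0 0.
  by rewrite (frC f4).
have c46 : cell s4 6 = Gim sample phi m n Q (Wst s0) (ust s0) (candidate ci) 0 0.
  by rewrite (frC f4).
apply: (@wp_emit _ _ _ _ _ _ _ _ _ _ Hsizes _ _ (cnt * d.+1)) => //.
- by rewrite /s7; upds; rewrite (frN f6).
- by rewrite u7 W7 /s7 /= c20 c45; apply: Gre_ext => i im; rewrite -c7.
- by rewrite u7 W7 /s7 /= c21 c46; apply: Gim_ext => i im; rewrite -c7.
rewrite u7 W7 => s8 f8 wE mE; step.
have f08 : frame cand_all_vars candA s s8.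
  apply: (frame_trans f07); apply: frame_sub f8 => [x|a].
    by rewrite /cand_all_vars !inE => ->; rewrite !orbT.
  by rewrite /emitA /candA /in_out; case: (is_arr d 2 a); rewrite ?orbT//; lia.
have cnt8 : nvar s8 vcnt = cnt by rewrite (frN f8)// /s7 /= /upd /= (frN f6).
have op8 : nvar s8 vop = (cnt * d.+1)%N by rewrite (frN f8)// /s7 /= /upd /= (frN f6).
have d8 : nvar s8 vd = d by rewrite (frN f8)// /s7 /= /upd /= (frN f6).
pose pick' p := if p == cnt then ci else pick p.
have pickN p : (p < cnt)%N -> pick' p = pick p.
  by rewrite /pick'; case: eqP => // ->; rewrite ltnn.
have pickE : pick' cnt = ci by rewrite /pick' eqxx.
apply: (post _ cnt.+1 pick'); first by fr.
split; upds.
- by rewrite cnt8 addn1.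
- by rewrite op8 d8 mulSn; lia.
- split=> //.
  + move=> p; rewrite ltnS leq_eqVlt => /predU1P[->|pc]; first by rewrite pickE.
    by rewrite pickN//; apply: pickA.
  + move=> p q /andP[pq]; rewrite ltnS leq_eqVlt => /predU1P[qc|qc].
      by rewrite qc pickE pickN -?qc//; apply: far; rewrite -qc.
    by rewrite !pickN ?(ltn_trans pq)//; apply: pickS; rewrite pq.
  + move=> _ c'; rewrite ltnS leq_eqVlt => /predU1P[->|c'ci] acc'.
      by exists cnt => //; rewrite pickE apartxx.
    have [p pc sp] := pickC cntk _ c'ci acc'; exists p; first exact: ltnW.
    by rewrite pickN.
- move=> p i; rewrite ltnS leq_eqVlt => /predU1P[->|pc] im.
    rewrite pickE -pE1// (frC f8)//= /emitA /in_out; addr.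
  rewrite pickN// (frC f8); last by rewrite /emitA /in_out; addr.
  by rewrite /s7 /= pE2 ?pk4 ?pk//; move: pc im; nia.
- move=> p; rewrite ltnS leq_eqVlt => /predU1P[->|pc].
    rewrite pickE; split.
      by rewrite wE; apply: weight_est_ext.
    by move=> j jd; rewrite mE//; apply: refine_ext.
  have oo x : (x < cnt * d.+1)%N -> ost s8 x = ost s x.
    move=> xc; rewrite (frC f8); last by rewrite /emitA /in_out; addr.
    by rewrite /s7 -(congr1 (fun g => g x) ok4) /= (frC f6)// /A5; addr.
  have [h1 h2] := oE p pc; rewrite pickN//; split.
    by rewrite oo//; move: pc; nia.
  by move=> j jd; rewrite oo ?h2//; move: pc jd; nia.
Qed.

End Candidates.

(** * Trials, the sweep over scales, and the complete program *)

Notation vdone := 10%N.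

Fixpoint rpow (e : rexp) (N : nat) : rexp :=
  if N is N'.+1 then RMul e (rpow e N') else RNat (nc 1).

Section Programs.
Variables N0 N1 N2 ce ct : nat.

Definition set_trial_params : program :=
  2 <-- RAdd (RNat (nc 1)) (RDiv (RNat $vtau) (RLn (RDiv (RNat (nc 2)) (rc 1)))) ;;
  3 <-- RDiv (RMul (RMul (RNat (nc ct)) (RSqrt (RDiv (RMul (RNat (nc ce))
           (RMul (RNat $vl) (RLn (RDiv (RNat (nc 2)) (rc 1))))) (RNat $vn))))
         (RMul (RMul (RNat (nc N0)) (RMul (rpow (RNat $vd) N1)
           (rpow (RMul (RMul (RNat (nc 4)) (RMul (RNat $vQ) (RNat $vQ)))
                       (RMul (rc 2) (RNat $vd))) N2)))
          (RMul (RMul (RNat $vQ) (rc 2)) (RNat $vd)))) (rc 0) ;;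
  3 <-- RMul (rc 3) (rc 3).

Definition trial : program :=
  set_trial_params ;; gen_directions ;; vcnt ::= nc 0 ;; vop ::= nc 0 ;;
  For vci $vQm try_candidate.

(** The language has no early exit. Once [k] picks are found, [vdone] makes all later rounds idle,
    so that the output array keeps the result of the successful trial. *)
Definition main_loop : program :=
  For vtau $vn (
    If (NLt (nc 0) $vdone) Skip (
      trial ;; If (NLt $vcnt $vk) Skip (vdone ::= nc 1))).

Definition copy_out : program :=
  For vx $vkd (SetR $vx (RCell (at_arr 4 $vx))).

(** Naturals can only be added and subtracted: the two logarithms come from doubling until a bound
    is exceeded, the base from repeated doubling, the quotient and the products from repeated
    addition. *)
Definition init_sizes : program :=
  vx ::= nc 1 ;; vl ::= nc 0 ;;
  While (NLt $vx (NAdd $vn (nc 1))) (vx ::= NAdd $vx $vx ;; vl ::= NAdd $vl (nc 1)) ;;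
  vr ::= nc 1 ;; vq ::= nc 0 ;;
  While (NLt $vr (NAdd $vl (nc 1))) (vr ::= NAdd $vr $vr ;; vq ::= NAdd $vq (nc 1)) ;;
  vx ::= nc 0 ;; vm ::= nc 0 ;;
  While (NLt $vx (NAdd (NAdd $vl $vl) (nc 1)))
    (vx ::= NAdd $vx $vq ;; vm ::= NAdd $vm (nc 1)) ;;
  vQ ::= nc 1 ;;
  For ve (NAdd (NAdd $vq $vq) (NAdd $vq (nc 13))) (vQ ::= NAdd $vQ $vQ) ;;
  vQm ::= nc 1 ;;
  For vi $vm (
    vx ::= nc 0 ;; For vj $vQ (vx ::= NAdd $vx $vQm) ;; vQm ::= $vx) ;;
  vmd ::= nc 0 ;; For vi $vm (vmd ::= NAdd $vmd $vd) ;;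
  vkd ::= nc 0 ;; For vi $vk (vkd ::= NAdd $vkd (NAdd $vd (nc 1))).

(** Starts from [2 ^ - (Q - 1)] and uses the ratio [(Q - 1 - i) / (i + 1)] of consecutive binomial
    coefficients. *)
Definition init_table : program :=
  20 <-- RNat (nc 1) ;;
  For vi (NSub $vQ (nc 1)) (20 <-- RDiv (rc 20) (RNat (nc 2))) ;;
  For vi $vQ (
    SetR (at_arr 1 $vi) (rc 20) ;;
    20 <-- RDiv (RMul (rc 20) (RNat (NSub (NSub $vQ (nc 1)) $vi)))
                (RNat (NAdd $vi (nc 1)))).

Definition estimator : program :=
  init_sizes ;; init_table ;; vdone ::= nc 0 ;; main_loop ;; copy_out.

Definition ell (n : nat) : nat := up_log 2 n.+1.
Definition loglog (n : nat) : nat := up_log 2 (ell n).+1.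
(** Just enough directions for [loglog n * ndir n >= 2 * ell n], so that [2 ^ (r * m)] exceeds
    [n ^ 2] and with it the number of pairs of means. *)
Definition ndir (n : nat) : nat := ((2 * ell n) %/ loglog n).+1.
(** The exponent makes the kernel smaller than [1 / n] at distance [rho = 2 ^ - r / 64]:
    [Q * rho ^ 2] equals [2 * 2 ^ r], which exceeds [2 * ln n] with room to spare. Of the 13, twelve
    cancel [64 ^ 2]. *)
Definition nbase (n : nat) : nat := (2 ^ (3 * loglog n + 13))%N.

Section Spec5.
Variables (R : realType) (d : nat) (sample : nat -> nat -> R) (coin : nat -> R).
Variables (phi : d.-tuple R -> R[i]) (k m n Q rr l : nat) (eps delta : R).

(* As [gamma] is unknown, the scale [M] of the directions is swept; the increment
   leaves about [ln (2 / delta)] independent trials below any target scale. *)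
Definition trial_M (tau : nat) : R := 1 + tau%:R / ln (2 / delta).
(** Level at which the empirical averages of all cosines and sines are controlled. For
    [ce = 128 * 60] the exponent [n * eta0 ^ 2 / 128] of the tail bound becomes
    [60 * l * ln (2 / delta)]. *)
Definition eta0 : R := Num.sqrt (ce%:R * (l%:R * ln (2 / delta)) / n%:R).
(** Upper bound for the inverse modulus of the characteristic function at every frequency used:
    [N0], [N1], [N2] are natural upper bounds for [c0^-1], [c1], [c2], and [4 * Q ^ 2 * M * d]
    bounds the norm of the frequencies. *)
Definition inv_decay (M : R) : R :=
  N0%:R * (d%:R ^+ N1 * (4%:R * (Q%:R * Q%:R) * (M * d%:R)) ^+ N2).
(** The noise in [G] is of order [eta0 * inv_decay M]; the threshold exceeds it by
    [Q * M * d / eps], up to a constant. Phases at accepted points are then accurate to order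
    [eps / (Q * M * d)], which suffices even after multiplication by directions of size [M]. *)
Definition theta (M : R) : R :=
  ct%:R * eta0 * (inv_decay M * (Q%:R * M * d%:R)) / eps.

Definition trial_result (W : nat -> R) (tau cnt : nat) (pick : nat -> nat)
    (u : nat -> R) : Prop :=
  (forall x, (x < m * d)%N ->
     u x = gen_dir n coin (trial_M tau) (tau * (m * d * n)) x) /\
  picks_spec sample phi k m n Q rr W u
    (theta (trial_M tau) * theta (trial_M tau)) (Q ^ m) cnt pick.

(** This is all that the analysis retains of an execution: a trial with [k] picks and its output, or
    a record that all [n] trials fell short. The second case is excluded later, outside the failure
    event. *)
Definition result_spec (W out : nat -> R) : Prop :=
  (exists tau u pick, [/\ (tau < n)%N, trial_result W tau k pick u
     & outs_spec sample phi m n Q W u k pick out]) \/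
  (forall tau, (tau < n)%N -> exists cnt u pick,
     (cnt < k)%N /\ trial_result W tau cnt pick u).

End Spec5.

Lemma reval_rpow (R : realType) (sample : nat -> nat -> R) s e N :
  reval sample s (rpow e N) = reval sample s e ^+ N.
Proof. by elim: N => //= N ->; rewrite exprS. Qed.

Section Main.
Variables (R : realType) (d : nat) (sample : nat -> nat -> R) (coin : nat -> R).
Variables (phi : d.-tuple R -> R[i]) (k n m Q K rr l : nat) (eps delta : R).
Hypothesis Hsizes : sizes d k n m Q K.
Local Notation state := (state R).
Local Notation wp := (@wp R d sample coin phi K).
Local Notation params := (@params R d k n m Q).
Local Notation Wst s := (fun a => cell s (arr d 1 a)).
Local Notation ust s := (fun a => cell s (arr d 0 a)).
Local Notation ost s := (fun a => cell s (arr d 4 a)).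
Local Notation trial_M := (@trial_M R delta).
Local Notation theta := (@theta R d n Q l eps delta).
Local Notation trial_result := (@trial_result R d sample coin phi k m n Q rr l eps delta).

Definition trial_vars := [:: vci, vcnt, vop & gen_vars ++ cand_all_vars].
Definition trialA (a : nat) : bool :=
  (1 < a < 40)%N || ((40 <= a)%N && ~~ is_arr d 1 a).

Lemma wp_trial (tau : nat) (P : state -> Prop) (s : state) :
  params s -> nvar s vr = rr -> nvar s vl = l -> nvar s vtau = tau ->
  cell s 0 = eps -> cell s 1 = delta -> coins_used s = (tau * (m * d * n))%N ->
  (forall s' cnt u pick,
     frame trial_vars trialA (with_coins s (tau.+1 * (m * d * n))) s' ->
     nvar s' vcnt = cnt -> trial_result (Wst s) tau cnt pick u ->
     outs_spec sample phi m n Q (Wst s) u cnt pick (ost s') -> P s') ->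
  wp trial P s.
Proof.
move=> ps sr sl st s0 s1 sc post; rewrite /trial /set_trial_params; step.
case: (Hsizes) => d0 Q0 dK kK [nK mK QmK mdK kdK].
case: (ps) => sd sk sn sm [sQ sQm smd skd].
set e := reval sample s _.
have eE : e = trial_M tau by rewrite /e /= s1 st.
set e2 := reval sample (set_cell s _ _) _.
have e2E : e2 = theta (trial_M tau).
  by rewrite /e2 /= !reval_rpow /=; upds; rewrite sl sn sQ sd s1 s0 eE.
set sA := set_cell _ _ (reval _ _ (RMul _ _)).
have sAE : sA = set_cell (set_cell (set_cell s 2 (trial_M tau)) 3 e2) 3
     (theta (trial_M tau) * theta (trial_M tau)).
  by rewrite /sA; upds; rewrite e2E eE.
rewrite sAE; set sB := set_cell _ _ _.
have fB : frame trial_vars trialA s sB by rewrite /trialA; fr.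
apply: (@wp_gen_directions _ _ _ _ _ _ _ _ _ _ Hsizes (trial_M tau)
  (tau * (m * d * n))%N) => //.
move=> s2 f2 u2; step.
set sC := set_nvar (set_nvar s2 _ _) _ _.
have fC : frame trial_vars trialA (with_coins s (tau.+1 * (m * d * n))) sC.
  rewrite /sC; fr; split=> [x xv|a av|]; last by rewrite (frK f2) /= mulSn addnC.
  - have gx : x \notin gen_vars by move: xv; rewrite /trial_vars !inE; lia.
    by rewrite (frN f2 gx); exact: frN fB _ xv.
  - have ga : ~~ genA d a by move: av; rewrite /trialA /genA /is_arr; lia.
    by rewrite (frC f2 ga); exact: frC fB _ av.
have pC : params sC by apply: (frame_params (s := with_coins s _) fC _ ps).
have WC : Wst sC = Wst s.
  by apply: funext => a; rewrite (frC fC)// /trialA; addr.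
have c3C : cell sC 3 = theta (trial_M tau) * theta (trial_M tau).
  by rewrite /sC /= (frC f2).
pose I ci s' := frame trial_vars trialA (with_coins s (tau.+1 * (m * d * n))) s' /\
  nvar s' vci = ci /\ (ust s' = ust sC /\ cell s' 3 = cell sC 3) /\
  exists cnt pick, picks_inv sample phi k n m Q rr sC ci cnt pick s'.
apply: (wp_for (I := I) (N := (Q ^ m)%N)) => //.
- split; first by apply: frame_setn.
  split; first by [].
  split; first by [].
  exists 0%N, (fun=> 0%N); split=> //; split=> //.
  by move=> p q; rewrite ltn0 andbF.
- move=> ci s' [f [ciE _]]; split=> //.
  by rewrite /= (frN f)//= sQm.
- move=> ci s' ciQ [f [ciE [[uE c3E] [cnt [pick inv]]]]].
  have p' : params s' by apply: (frame_params (s := with_coins s _) f _ ps).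
  have W' : Wst s' = Wst sC.
    by rewrite WC; apply: funext => a; rewrite (frC f)// /trialA; addr.
  apply: (@wp_try_candidate _ _ _ _ _ _ _ _ _ _ rr Hsizes sC s' ci cnt pick) => //.
    by rewrite (frN f).
  move=> s3 cnt' pick' f3 inv'; split.
    fr; apply: (frame_trans f); apply: frame_sub f3 => [x|a].
      by rewrite /trial_vars !inE => h; rewrite h !orbT.
    by rewrite /candA /trialA /is_t /is_arr; lia.
  split; first by upds; rewrite (frN f3)// ciE addn1.
  split.
    split; last by rewrite /= (frC f3).
    by rewrite -uE; apply: funext => a; rewrite /= (frC f3)// /candA; addr.
  exists cnt', pick'.
  by case: inv' => ? ? ? ? ?; split=> //; upds.
move=> s' [f [_ [[uE _] [cnt [pick [cE _ pS _ oS]]]]]].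
rewrite WC c3C in pS; rewrite WC in oS.
apply: (post _ cnt (ust sC) pick) => //.
Qed.

Definition main_vars := [:: vtau, vdone & trial_vars].

Lemma wp_main_loop (P : state -> Prop) (s : state) :
  params s -> nvar s vr = rr -> nvar s vl = l -> nvar s vdone = 0%N ->
  cell s 0 = eps -> cell s 1 = delta -> coins_used s = 0%N ->
  (forall s', params s' ->
     result_spec sample coin phi k m n Q rr l eps delta (Wst s) (ost s') -> P s') ->
  wp main_loop P s.
Proof.
move=> ps sr sl sdone s0 s1 sc post; rewrite /main_loop.
case: (Hsizes) => d0 Q0 dK kK [nK mK QmK mdK kdK].
case: (ps) => sd sk sn sm [sQ sQm smd skd].
(* The number [c] of coins used is tied to [tau] only while the search is open: each trial then
   consumes exactly [m * d * n] coins, so trial [tau] reads its own block. A finished search tosses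
   no more. *)
pose I tau s' := exists2 c, frame main_vars trialA (with_coins s c) s' &
  nvar s' vtau = tau /\
  ((nvar s' vdone = 0%N /\ c = (tau * (m * d * n))%N /\
     forall t, (t < tau)%N -> exists cnt u pick,
       (cnt < k)%N /\ trial_result (Wst s) t cnt pick u) \/
   (nvar s' vdone = 1%N /\ exists t u pick, [/\ (t < n)%N,
       trial_result (Wst s) t k pick u &
       outs_spec sample phi m n Q (Wst s) u k pick (ost s')])).
apply: (wp_for (I := I) (N := n)) => //.
- exact: ltnW.
- exists 0%N.
    by apply: frame_setn => //; split=> //.
  by split=> //; left; upds.
- by move=> t s' [c f [tE _]]; split=> //; rewrite /= (frN f).
- move=> t s' tn [c f [tE [[done0 [cE allt]]|[done1 ex]]]]; apply: wp_if; last first.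
    rewrite /= done1 /=; step; exists c; first by fr.
    by upds; rewrite tE addn1; split=> //; right.
  rewrite /= done0 /=; step.
  have p' : params s' by apply: (frame_params (s := with_coins s _) f _ ps).
  have W' : Wst s' = Wst s.
    by apply: funext => a; rewrite (frC f)// /trialA; addr.
  apply: (@wp_trial t) => //.
  + by rewrite (frN f).
  + by rewrite (frN f).
  + by rewrite (frC f).
  + by rewrite (frC f).
  + by rewrite (frK f).
  move=> s2 cnt u pick f2 cntE tr os; rewrite W' in tr os.
  have f2' : frame main_vars trialA (with_coins s (t.+1 * (m * d * n))) s2.
    split=> [x xv|a av|]; last by rewrite (frK f2).
    - rewrite (frN f2) /=; last by move: xv; rewrite /main_vars !inE; lia.
      by rewrite (frN f).
    - by rewrite (frC f2)//= (frC f).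
  have done2 : nvar s2 vdone = 0%N by rewrite (frN f2).
  have t2 : nvar s2 vtau = t by rewrite (frN f2).
  have k2 : nvar s2 vk = k by rewrite (frN f2')//= sk.
  apply: wp_if; rewrite /= cntE k2.
  case: ltnP => ck; step; (exists (t.+1 * (m * d * n))%N; first by fr); upds.
    rewrite t2 addn1; split=> //; left; split=> //; split=> // t'.
    rewrite ltnS leq_eqVlt => /predU1P[->|]; last exact: allt.
    by exists cnt, u, pick.
  rewrite t2 addn1; split=> //; right; split=> //; exists t, u, pick.
  have ek : cnt = k by case: tr => _ [ck' _ _ _]; apply/eqP; rewrite eqn_leq ck' ck.
  by rewrite ek in tr os.
move=> s' [c f [tE h]]; apply: post.
  by apply: (frame_params (s := with_coins s _) f _ ps).
by case: h => [[_ [_ h]]|[_ h]]; [right|left].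
Qed.

Lemma wp_copy_out (P : state -> Prop) (s : state) :
  params s ->
  (forall s', (forall a, (a < k * d.+1)%N -> cell s' a = cell s (arr d 4 a)) -> P s') ->
  wp copy_out P s.
Proof.
move=> ps post; rewrite /copy_out.
case: (Hsizes) => d0 Q0 dK kK [nK mK QmK mdK kdK].
case: (ps) => sd sk sn sm [sQ sQm smd skd].
pose I x s' := [/\ frame [:: vx] (fun a => a < x)%N s s', nvar s' vx = x &
  forall a, (a < x)%N -> cell s' a = cell s (arr d 4 a)].
apply: (wp_for (I := I) (N := (k * d.+1)%N)) => //.
- by split=> //; fr.
- by move=> t s' [f tE _]; split=> //; rewrite /= (frN f).
- move=> x s' xk [f xE cE]; step; split; upds.
  + fr; apply: frame_sub f => // a; lia.
  + by rewrite xE addn1.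
  + move=> a; rewrite ltnS leq_eqVlt xE => /predU1P[->|ax].
      rewrite eqxx (frN f (x := vd))// sd -/(arr d 4 x) (frC f)//; addr.
    by rewrite (ltn_eqF ax) cE.
- by move=> s' [f _ cE]; apply: post.
Qed.

End Main.
End Programs.

(** * Initialization and correctness of the complete program *)

Lemma ltn_ell n : (n < 2 ^ ell n)%N.
Proof. exact: up_logP. Qed.

Lemma ell_gt0 n : (0 < n)%N -> (0 < ell n)%N.
Proof. by move=> n0; rewrite lt0n; apply/eqP => e; have := ltn_ell n; rewrite e; lia. Qed.

Lemma ltn_loglog n : (ell n < 2 ^ loglog n)%N.
Proof. exact: up_logP. Qed.

Lemma loglog_gt0 n : (0 < n)%N -> (0 < loglog n)%N.
Proof.
move=> /ell_gt0 n0; rewrite lt0n; apply/eqP => e; have := ltn_loglog n; rewrite e; lia.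
Qed.

Lemma ltn_lt_up_log i n : (i < up_log 2 n)%N -> (2 ^ i < n)%N.
Proof.
move=> h; rewrite ltnNge; apply: contraL h => h; rewrite -leqNgt; exact: up_log_min.
Qed.

Section Init.
Variables (R : realType) (d : nat) (sample : nat -> nat -> R) (coin : nat -> R).
Variables (phi : d.-tuple R -> R[i]) (k n K : nat).
Local Notation m := (ndir n).
Local Notation Q := (nbase n).
Hypotheses (Hsizes : sizes d k n m Q K) (n_gt0 : (0 < n)%N).
Hypotheses (lK : (ell n <= K.+4)%N) (rK : (3 * loglog n + 13 <= K.+4)%N) (QK : (Q <= K.+4)%N).
Local Notation state := (state R).
Local Notation wp := (@wp R d sample coin phi K).
Local Notation params := (@params R d k n m Q).

Definition init_vars := [:: vx; vl; vr; vq; vm; vQ; vQm; vmd; vkd; ve; vi; vj].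

Lemma wp_doubling (x y : nat) e N (P : state -> Prop) (s : state) :
  x != y -> (up_log 2 N.+1 <= K.+4)%N -> nvar s x = 1%N -> nvar s y = 0%N ->
  (forall s', frame [:: x; y] pred0 s s' -> neval s' e = N) ->
  (forall s', frame [:: x; y] pred0 s s' -> nvar s' x = (2 ^ up_log 2 N.+1)%N ->
     nvar s' y = up_log 2 N.+1 -> P s') ->
  wp (While (NLt $x (NAdd e (nc 1))) (x ::= NAdd $x $x ;; y ::= NAdd $y (nc 1))) P s.
Proof.
move=> xy NK sx sy eE post.
pose I i s' := [/\ frame [:: x; y] pred0 s s', nvar s' x = (2 ^ i)%N & nvar s' y = i].
apply: (wp_while (I := I) (N := up_log 2 N.+1)) => //.
- move=> i s' iN [f xE yE]; split.
    by rewrite /= xE eE// addn1 ltn_lt_up_log.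
  step; split; upds.
  + by apply: frame_setn; rewrite ?inE ?eqxx ?orbT//; apply: frame_setn; rewrite ?inE ?eqxx.
  + by rewrite (negbTE xy) eqxx xE addnn -mul2n expnS.
  + by rewrite eqxx eq_sym (negbTE xy) yE addn1.
- move=> s' [f xE yE]; split; last exact: post.
  by rewrite /= xE eE// addn1 -leqNgt up_logP.
Qed.

Lemma wp_init_sizes (P : state -> Prop) (s : state) :
  nvar s vd = d -> nvar s vk = k -> nvar s vn = n ->
  (forall s', frame init_vars pred0 s s' -> params s' ->
     nvar s' vr = (2 ^ loglog n)%N -> nvar s' vl = ell n -> P s') ->
  wp init_sizes P s.
Proof.
move=> sd sk sn post; rewrite /init_sizes.
case: (Hsizes) => d0 Q0 dK kK [nK mK QmK mdK kdK].
step; apply: (@wp_doubling vx vl $vn n) => //.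
  by move=> s' f; rewrite /= (frN f).
move=> s1 f1 x1 l1; step.
have {}f1 : frame init_vars pred0 s s1.
  apply: frame_trans (_ : frame init_vars pred0 (set_nvar (set_nvar s vx 1) vl 0) _).
    by fr.
  by apply: frame_sub f1 => // x; rewrite !inE; lia.
apply: (@wp_doubling vr vq $vl (ell n)) => //.
- apply: leq_trans rK; rewrite -/(loglog n); lia.
- by move=> s' f; rewrite /= (frN f).
move=> s2 f2 r2 q2; step.
have l2 : nvar s2 vl = ell n by rewrite (frN f2)//= l1.
have {f1}f2 : frame init_vars pred0 s s2.
  apply: (frame_trans f1).
  apply: frame_trans (_ : frame init_vars pred0 (set_nvar (set_nvar s1 vr 1) vq 0) _).
    by fr.
  by apply: frame_sub f2 => // x; rewrite !inE; lia.
have r0 := loglog_gt0 n_gt0.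
pose I i s' := [/\ frame init_vars pred0 s s', nvar s' vx = (i * loglog n)%N, nvar s' vm = i,
  nvar s' vr = (2 ^ loglog n)%N & nvar s' vl = ell n /\ nvar s' vq = loglog n].
apply: (wp_while (I := I) (N := m)) => //.
- by split=> //; fr.
- move=> i s' im [f xE mE rE [lE qE]]; split.
    rewrite /= xE lE; move: im; rewrite /ndir ltnS leq_divRL//; lia.
  step; split; upds => //; first by fr.
  + by rewrite xE qE mulSn addnC.
  + by rewrite mE addn1.
move=> s3 [f3 xE mE rE [lE qE]]; split.
  rewrite /= xE lE /ndir -leqNgt mulSn; have := divn_eq (2 * ell n) (loglog n).
  have := ltn_pmod (2 * ell n) r0; lia.
step.
pose J i s' := [/\ frame init_vars pred0 s s', nvar s' ve = i, nvar s' vQ = (2 ^ i)%N,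
  nvar s' vr = (2 ^ loglog n)%N & [/\ nvar s' vl = ell n, nvar s' vq = loglog n & nvar s' vm = m]].
apply: (wp_for (I := J) (N := (3 * loglog n + 13)%N)) => //.
- by split=> //; upds; fr.
- by move=> i s' [f eE _ _ [_ qE' _]]; split=> //; rewrite /= qE'; lia.
- move=> i s' iN [f eE QE rE' [lE' qE' mE']]; step; split; upds => //; first by fr.
  + by rewrite eE addn1.
  + by rewrite QE addnn -mul2n expnS.
move=> s4 [f4 _ QE4 rE4 [lE4 _ mE4]]; step; rewrite -/Q in QE4.
pose L i s' := [/\ frame init_vars pred0 s s', nvar s' vi = i, nvar s' vQm = (Q ^ i)%N,
  nvar s' vr = (2 ^ loglog n)%N & [/\ nvar s' vl = ell n, nvar s' vQ = Q & nvar s' vm = m]].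
apply: (wp_for (I := L) (N := m)) => //.
- by split=> //; upds; fr.
- by move=> i s' [f iE _ _ [_ _ mE']]; split.
- move=> i s' im [f iE QmE rE' [lE' QE' mE']]; step.
  pose T j sx := [/\ L i sx, nvar sx vj = j & nvar sx vx = (j * Q ^ i)%N].
  apply: (wp_for (I := T) (N := Q)) => //.
  + by split=> //; split=> //; upds; fr.
  + by move=> j sx [[_ _ _ _ [_ QE2 _]] jE _]; split.
  + move=> j sx jQ [[f2' iE2 QmE2 rE2 [lE2 QE2 mE2]] jE xE2]; step; split; upds.
    * by split=> //; upds; fr.
    * by rewrite jE addn1.
    * by rewrite xE2 QmE2 mulSn addnC.
  + move=> sx [[f2' iE2 QmE2 rE2 [lE2 QE2 mE2]] jE xE2]; step; split; upds => //.
    * by fr.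
    * by rewrite iE2 addn1.
    * by rewrite xE2 expnS.
move=> s5 [f5 _ QmE5 rE5 [lE5 QE5 mE5]]; step.
pose V i s' := [/\ frame init_vars pred0 s s', nvar s' vi = i, nvar s' vmd = (i * d)%N,
  nvar s' vr = (2 ^ loglog n)%N & [/\ nvar s' vl = ell n, nvar s' vQ = Q, nvar s' vm = m &
   nvar s' vQm = (Q ^ m)%N]].
apply: (wp_for (I := V) (N := m)) => //.
- by split=> //; upds; fr.
- by move=> i s' [f iE _ _ [_ _ mE' _]]; split.
- move=> i s' im [f iE QmE rE' [lE' QE' mE' QmE']]; step; split; upds => //.
  + by fr.
  + by rewrite iE addn1.
  + by rewrite QmE (frN f)// sd mulSn addnC.
move=> s6 [f6 _ mdE6 rE6 [lE6 QE6 mE6 QmE6]]; step.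
pose Y i s' := [/\ frame init_vars pred0 s s', nvar s' vi = i, nvar s' vkd = (i * d.+1)%N,
  nvar s' vr = (2 ^ loglog n)%N & [/\ nvar s' vl = ell n, nvar s' vQ = Q, nvar s' vm = m &
   nvar s' vQm = (Q ^ m)%N /\ nvar s' vmd = (m * d)%N]].
apply: (wp_for (I := Y) (N := k)) => //.
- by split=> //; upds; fr.
- by move=> i s' [f iE _ _ [_ _ mE' _]]; split=> //; rewrite /= (frN f).
- move=> i s' im [f iE QmE rE' [lE' QE' mE' [QmE' mdE']]]; step; split; upds => //.
  + by fr.
  + by rewrite iE addn1.
  + by rewrite QmE (frN f)// sd mulSn addnC addn1.
move=> s7 [f7 _ kdE7 rE7 [lE7 QE7 mE7 [QmE7 mdE7]]].
apply: post => //; split=> //; by rewrite (frN f7).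
Qed.

Lemma wp_init_table (P : state -> Prop) (s : state) :
  params s ->
  (forall s', frame [:: vi] (fun a => (a == 20%N) || is_arr d 1 a) s s' ->
     (forall a, (a < Q)%N -> cell s' (arr d 1 a) = 'C(Q.-1, a)%:R / 2 ^+ Q.-1) -> P s') ->
  wp init_table P s.
Proof.
move=> ps post; rewrite /init_table; step.
case: (Hsizes) => d0 Q0 dK kK [nK mK QmK mdK kdK].
case: (ps) => sd sk sn sm [sQ sQm smd skd].
pose A a := (a == 20%N) || is_arr d 1 a.
pose I i s' := [/\ frame [:: vi] A s s', nvar s' vi = i & cell s' 20 = 2 ^- i].
apply: (wp_for (I := I) (N := Q.-1)) => //.
- exact: leq_trans (leq_pred _) QK.
- by split=> //; upds; [rewrite /A; fr|rewrite expr0 invr1].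
- by move=> i s' [f iE _]; split=> //; rewrite /= (frN f)// sQ subn1.
- move=> i s' iQ [f iE c20]; step; split; upds; first by rewrite /A; fr.
    by rewrite iE addn1.
  by rewrite c20 exprS invfM mulrC.
move=> s1 [f1 _ c20].
pose J i s' := [/\ frame [:: vi] A s s', nvar s' vi = i,
  cell s' 20 = 'C(Q.-1, i)%:R / 2 ^+ Q.-1 &
  forall a, (a < i)%N -> cell s' (arr d 1 a) = 'C(Q.-1, a)%:R / 2 ^+ Q.-1].
apply: (wp_for (I := J) (N := Q)) => //.
- by split=> //; upds; [fr|rewrite bin0 c20 mul1r].
- by move=> i s' [f iE _ _]; split=> //; rewrite /= (frN f)// sQ.
- move=> i s' iQ [f iE c20' cE]; step.
  have aE : neval s' (at_arr 1 $vi) = arr d 1 i.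
    by rewrite /= iE (frN f)// sd.
  rewrite aE; split; upds.
  + by rewrite /A; fr.
  + by rewrite iE addn1.
  + rewrite (frN f)// sQ iE c20' subn1 addn1.
    have h : i.+1%:R * 'C(Q.-1, i.+1)%:R = (Q.-1 - i)%:R * 'C(Q.-1, i)%:R :> R.
      by rewrite -!natrM mul_bin_left.
    have i0 : i.+1%:R != 0 :> R by rewrite pnatr_eq0.
    have t0 : 2 ^+ Q.-1 != 0 :> R by rewrite expf_neq0 ?pnatr_eq0.
    apply: (mulfI i0); rewrite [RHS]mulrA h mulrCA divff// mulr1; field.
    by rewrite t0.
  + move=> a; rewrite ltnS leq_eqVlt => /predU1P[->|ai].
      by rewrite eqxx c20'.
    by case: ifP => [/eqP e|_]; [move: e ai; rewrite /arr; lia|exact: cE].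
by move=> s' [f _ _ cE]; apply: post.
Qed.

Section Final.
Variables (N0 N1 N2 ce ct : nat) (eps delta : R).

Lemma wp_estimator (P : state -> Prop) :
  (forall W s', (forall a, (a < Q)%N -> W a = 'C(Q.-1, a)%:R / 2 ^+ Q.-1) ->
     result_spec N0 N1 N2 ce ct sample coin phi k m n Q (2 ^ loglog n) (ell n) eps delta
       W (fun a => if (a < k * d.+1)%N then cell s' a else 0) -> P s') ->
  wp (estimator N0 N1 N2 ce ct) P (init_state d k n eps delta).
Proof.
move=> post; rewrite /estimator; apply: wp_seq; apply: wp_init_sizes => //.
move=> s1 f1 p1 r1 l1; apply: wp_seq; apply: wp_init_table => // s2 f2 W2; step.
apply: (@wp_main_loop N0 N1 N2 ce ct _ _ _ _ _ _ _ _ _ _ (2 ^ loglog n) (ell n) eps delta Hsizes) => //.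
- by apply: (frame_params f2 _ p1).
- by upds; rewrite (frN f2).
- by upds; rewrite (frN f2).
- by upds; rewrite (frC f2)// (frC f1).
- by upds; rewrite (frC f2)// (frC f1).
- by upds; rewrite (frK f2) (frK f1).
move=> s3 p3 res; apply: (@wp_copy_out _ _ _ _ _ _ _ _ _ _ Hsizes) => // s4 c4.
apply: (post (fun a => cell s2 (arr d 1 a))) => //.
case: res => [[t [u [pick [tn tr os]]]]|h]; [left|by right].
exists t, u, pick; split=> // p pk; have [h1 h2] := os p pk; split.
  by rewrite ifT ?c4//; move: pk; nia.
by move=> j jd; rewrite ifT ?c4 ?h2//; move: pk jd; nia.
Qed.

End Final.
End Init.

(** * The binomial kernel *)

Local Open Scope complex_scope.

Notation cmod := Normc.normc.

Section ComplexModulus.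
Variable R : realType.
Implicit Types (x y : R) (z : R[i]).

Definition cis x : R[i] := cos x +i* sin x.

Lemma cmod_ge0 z : 0 <= cmod z.
Proof. by case: z => a b; rewrite /= sqrtr_ge0. Qed.

Lemma cmod_sqr z : cmod z ^+ 2 = complex.Re z ^+ 2 + complex.Im z ^+ 2.
Proof. by case: z => a b; rewrite /= sqr_sqrtr// addr_ge0// sqr_ge0. Qed.

Lemma ler_cmodD z z' : cmod (z + z') <= cmod z + cmod z'.
Proof. exact: le_normcD. Qed.

Lemma cmodN z : cmod (- z) = cmod z.
Proof. exact: normcN. Qed.

Lemma cmodB z z' : cmod (z - z') = cmod (z' - z).
Proof. by rewrite -cmodN opprB. Qed.

Lemma ler_cmod_sum I (r : seq I) (P : pred I) (F : I -> R[i]) :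
  cmod (\sum_(i <- r | P i) F i) <= \sum_(i <- r | P i) cmod (F i).
Proof.
elim/big_rec2: _ => [|i a b _ h]; first by rewrite Normc.normc0.
by rewrite (le_trans (ler_cmodD _ _))// lerD2l.
Qed.

Lemma cmod_prod I (r : seq I) (P : pred I) (F : I -> R[i]) :
  cmod (\prod_(i <- r | P i) F i) = \prod_(i <- r | P i) cmod (F i).
Proof.
elim/big_rec2: _ => [|i a b _ <-]; first by rewrite Normc.normc1.
by rewrite Normc.normcM.
Qed.

Lemma cmodR x : cmod x%:C = `|x|.
Proof. by rewrite /= expr0n /= addr0 sqrtr_sqr. Qed.

Lemma ler_Re_cmod z : `|complex.Re z| <= cmod z.
Proof.
by rewrite -sqrtr_sqr; case: z => a b /=; rewrite ler_wsqrtr// lerDl sqr_ge0.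
Qed.

Lemma ler_Im_cmod z : `|complex.Im z| <= cmod z.
Proof.
by rewrite -sqrtr_sqr; case: z => a b /=; rewrite ler_wsqrtr// lerDr sqr_ge0.
Qed.

Lemma ler_cmod_ReIm z : cmod z <= `|complex.Re z| + `|complex.Im z|.
Proof.
rewrite -(@ler_pXn2r _ 2) ?nnegrE ?cmod_ge0 ?addr_ge0// cmod_sqr.
rewrite sqrrD !real_normK ?num_real//.
by rewrite lerD2r lerDl mulrn_wge0// mulr_ge0.
Qed.

Lemma cisD x y : cis (x + y) = cis x * cis y.
Proof. by apply/eqP; rewrite eq_complex /= cosD sinD addrC eqxx /=; apply/eqP; ring. Qed.

Lemma cis0 : cis 0 = 1. Proof. by rewrite /cis cos0 sin0. Qed.

Lemma cisMn n x : cis (n%:R * x) = cis x ^+ n.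
Proof.
elim: n => [|n IH]; first by rewrite mul0r cis0.
by rewrite exprS -IH -cisD; congr cis; rewrite -natr1; ring.
Qed.

Lemma cis_sum I (r : seq I) (P : pred I) (F : I -> R) :
  cis (\sum_(i <- r | P i) F i) = \prod_(i <- r | P i) cis (F i).
Proof. by elim/big_rec2: _ => [|i a b _ <-]; rewrite ?cis0// cisD. Qed.

Lemma cmod_cis x : cmod (cis x) = 1.
Proof. by rewrite /= cos2Dsin2 sqrtr1. Qed.

(** The modulus is [|cos (y / 2)|]; the sine form is kept because closeness and distance of centers
    are both expressed by it. *)
Lemma cmod_1Dcis y : cmod ((1 + cis y) / 2) ^+ 2 = 1 - sin2h y.
Proof.
rewrite Normc.normcM exprMn Normc.normcV.
have -> : cmod (2 : R[i]) = 2.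
  by rewrite -[2 : R[i]]/(2%:R : R[i]) -(rmorph_nat (real_complex R)) cmodR normr_nat.
rewrite cmod_sqr /= add0r /sin2h.
have -> : y = (y / 2) *+ 2 by rewrite -mulr_natr; field.
rewrite cos_mulr2n sin_mulr2n.
have -> : ((y / 2) *+ 2) / 2 = y / 2 by rewrite -mulr_natr; field.
have := cos2Dsin2 (y / 2); set c := cos _; set s := sin _ => h.
have {}h : c ^+ 2 = 1 - s ^+ 2 by rewrite -h; ring.
transitivity (((c ^+ 2) ^+ 2 + c ^+ 2 * s ^+ 2)); first by field.
by rewrite h; ring.
Qed.

Lemma sin2h_ge0 y : 0 <= sin2h y. Proof. by rewrite /sin2h -expr2 sqr_ge0. Qed.

Lemma sin2h_le1 y : sin2h y <= 1.
Proof. by rewrite /sin2h -expr2 -subr_ge0 -cos2sin2 sqr_ge0. Qed.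

Lemma sin_norm_le y : `|sin y| <= `|y|.
Proof.
wlog y0 : y / 0 <= y.
  move=> h; have [/h//|y0] := leP 0 y.
  by rewrite -normrN -sinN -(normrN y); apply: h; rewrite oppr_ge0 ltW.
rewrite (ger0_norm y0).
have [y1|y1] := leP 1 y; first by rewrite (le_trans (sin_max _)).
have s0 : 0 <= sin y.
  by rewrite sin_ge0_pi// y0 (le_trans (ltW y1))// (le_trans _ (pi_ge2 R))// ler1n.
rewrite ger0_norm//.
pose f x := x - sin x.
have df x : is_derive x 1 f (1 - cos x) by rewrite /f; apply: is_deriveB.
have dfx x : derivable f x 1 by have [] := df x.
have dE x : derive1 f x = 1 - cos x by rewrite derive1E; have [] := df x.
suff : f 0 <= f y by rewrite /f sin0 subr0 subr_ge0.
apply: (@ger0_derive1_le_cc _ f 0 y) => //=.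
- by move=> x _; rewrite dE subr_ge0 cos_le1.
- by apply: derivable_within_continuous => x _.
- by rewrite in_itv /= lexx y0.
- by rewrite in_itv /= lexx y0.
Qed.

End ComplexModulus.

Section Digits.
Variable (A : comPzRingType).

Lemma big_ord_mul (F : nat -> A) (N q : nat) :
  \sum_(x < (q * N)%N) F x = \sum_(b < q) \sum_(r < N) F (b * N + r)%N.
Proof.
elim: q => [|q IH]; first by rewrite !big_ord0.
rewrite big_ord_recr /= -IH -(big_mkord xpredT F) mulSnr.
rewrite (big_cat_nat _ (n := (q * N)%N))//= ?leq_addr// big_mkord; congr (_ + _).
by rewrite -{1}[(q * N)%N]add0n big_addn addKn big_mkord; apply: eq_bigr => i _; rewrite addnC.
Qed.

Lemma digit_mulD (Q m b r i : nat) : (0 < Q)%N -> (i < m)%N ->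
  digit Q (b * Q ^ m + r) i = digit Q r i.
Proof.
move=> Q0 im; rewrite /digit.
have -> : (Q ^ m = Q ^ (m - i).-1 * Q * Q ^ i)%N.
  by rewrite -expnSr -expnD; congr expn; lia.
by rewrite !mulnA divnMDl ?expn_gt0 ?Q0// modnMDl.
Qed.

(** Distributivity, by induction on the number of digits: the most significant digit is split off,
    and the lower digits do not see it. *)
Lemma sum_digits (Q m : nat) (f : nat -> nat -> A) : (0 < Q)%N ->
  \sum_(x < (Q ^ m)%N) \prod_(i < m) f i (digit Q x i) =
  \prod_(i < m) \sum_(a < Q) f i a.
Proof.
move=> Q0; elim: m => [|m IH].
  by rewrite expn0 big_ord_recl !big_ord0 addr0.
rewrite expnS (big_ord_mul (fun x => \prod_(i < m.+1) f i (digit Q x i))).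
rewrite big_ord_recr /= -IH mulr_sumr; apply: eq_bigr => b _.
rewrite mulr_suml; apply: eq_bigr => r _; rewrite big_ord_recr /=; congr (_ * _).
  by apply: eq_bigr => i _; congr f; rewrite digit_mulD.
rewrite /digit divnMDl ?expn_gt0 ?Q0// divn_small// addn0 modn_small//.
Qed.

End Digits.

Definition binweight (R : realType) (Q a : nat) : R := 'C(Q.-1, a)%:R / 2 ^+ Q.-1.

(** The characteristic function of the number of heads in [Q - 1] fair tosses, by the binomial
    theorem. *)
Lemma sum_binweight_cis (R : realType) (Q : nat) (y : R) : (0 < Q)%N ->
  \sum_(a < Q) (binweight R Q a)%:C * cis (a%:R * y) = ((1 + cis y) / 2) ^+ Q.-1.
Proof.
case: Q => // N _; rewrite /binweight succnK expr_div_n [(1 + cis y) ^+ N]exprDn mulr_suml.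
apply: eq_bigr => i _; rewrite cisMn expr1n mul1r rmorphM fmorphV rmorphXn !rmorph_nat.
by rewrite -[X in _ = X / _]mulr_natl mulrAC.
Qed.

Section Kernel.
Variables (R : realType) (d : nat) (sample : nat -> nat -> R).
Variables (phi : d.-tuple R -> R[i]) (k m n Q : nat).
Variables (W u : nat -> R) (w : 'I_k -> R) (mu : 'I_k -> d.-tuple R) (eta : R).
Hypothesis Q_gt0 : (0 < Q)%N.
Hypothesis W_binweight : forall a, (a < Q)%N -> W a = binweight R Q a.
Hypothesis n_gt0 : (0 < n)%N.
Hypothesis w_gt0 : forall j, 0 < w j.
Hypothesis sum_w : \sum_(j < k) w j = 1.
Local Notation Gre := (Gre sample phi m n Q W u).
Local Notation Gim := (Gim sample phi m n Q W u).
Local Notation freq := (freq d m Q u).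

Definition kern (y : nat -> R) : R[i] := \prod_(i < m) ((1 + cis (y i)) / 2) ^+ Q.-1.

Definition dirdot (x : d.-tuple R) (i : nat) : R :=
  \sum_(j < d) u (i * d + j)%N * tnth x j.

Definition ecf (t : d.-tuple R) : R[i] :=
  (\sum_(l < n) cis (\sum_(j < d) tnth t j * sample l j)) / n%:R.

Definition mix_cf (t : d.-tuple R) : R[i] :=
  \sum_(j < k) (w j)%:C * cis (inner t (mu j)).

Definition G (c : nat -> R) (s : R) (j0 : nat) : R[i] := Gre c s j0 +i* Gim c s j0.

Lemma digit_lt x i : (digit Q x i < Q)%N. Proof. exact: ltn_pmod. Qed.

Lemma G_sum c s j0 : G c s j0 = \sum_(x < (Q ^ m)%N)
  (weight_of m Q W x)%:C * (cis (- shift_of m Q c x) * (ecf (freq s j0 x) / phi (freq s j0 x))).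
Proof.
have E x : (weight_of m Q W x)%:C *
    (cis (- shift_of m Q c x) * (ecf (freq s j0 x) / phi (freq s j0 x))) =
    Gre_term sample phi m n Q W u c s j0 x +i* Gim_term sample phi m n Q W u c s j0 x.
  rewrite /Gre_term /Gim_term /ecf; set t := freq s j0 x; set z := phi t.
  have -> : cis (- shift_of m Q c x) *
      ((\sum_(l < n) cis (\sum_(j < d) tnth t j * sample l j)) / n%:R / z) =
      (\sum_(l < n) cis (phase d sample m Q u c s j0 x l)) / z / n%:R.
    rewrite mulrA mulrA mulr_sumr mulrAC; congr (_ / _ / _); apply: eq_bigr => l _.
    rewrite /phase cisD; congr (_ * cis _); apply: eq_bigr => j _.
    by rewrite tnth_mktuple.
  have -> : \sum_(l < n) cis (phase d sample m Q u c s j0 x l) =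
    (\sum_(l < n) cos (phase d sample m Q u c s j0 x l)) +i*
    (\sum_(l < n) sin (phase d sample m Q u c s j0 x l)).
    by apply/eqP; rewrite eq_complex !raddf_sum /= !eqxx.
  move: (\sum_(l < n) cos _) (\sum_(l < n) sin _) => a b.
  have -> : n%:R^-1 = (n%:R^-1)%:C :> R[i] by rewrite fmorphV rmorph_nat.
  case: z => p q; apply/eqP; rewrite eq_complex /= -!expr2.
  by apply/andP; split; apply/eqP; ring.
rewrite (eq_bigr _ (fun (x : 'I_(Q ^ m)) _ => E x)).
by apply/eqP; rewrite eq_complex !raddf_sum /= !eqxx.
Qed.

Lemma weight_of_ge0 x : 0 <= weight_of m Q W x.
Proof.
apply: prodr_ge0 => i _; rewrite W_binweight ?digit_lt// /binweight.
by rewrite divr_ge0// exprn_ge0.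
Qed.

Lemma sum_weight_of : \sum_(x < (Q ^ m)%N) weight_of m Q W x = 1.
Proof.
rewrite (sum_digits _ (fun _ a => W a) Q_gt0) big1// => _ _.
have [N QN] : exists N, Q = N.+1 by case: (Q) Q_gt0 => // N _; exists N.
rewrite (eq_bigr (fun a : 'I_Q => binweight R Q a)); last first.
  by move=> a _; rewrite W_binweight.
rewrite /binweight -mulr_suml QN succnK -natr_sum -natrX.
have -> : (\sum_(i < N.+1) 'C(N, i))%N = (2 ^ N)%N.
  rewrite -[2%N]/(1 + 1)%N expnDn; apply: eq_bigr => i _.
  by rewrite !exp1n !muln1.
by rewrite divff// pnatr_eq0 expn_eq0.
Qed.

Lemma inner_freq s (j0 : 'I_d) x (y : d.-tuple R) :
  inner (freq s j0 x) y = s * tnth y j0 + \sum_(i < m) (digit Q x i)%:R * dirdot y i.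
Proof.
rewrite /inner.
under eq_bigr do rewrite tnth_mktuple /freq_coord mulrDl mulr_suml.
rewrite big_split /= (bigD1 j0)//= eqxx big1 ?addr0; last first.
  by move=> j /negbTE jn; rewrite -val_eqE in jn; rewrite jn mul0r.
congr (_ + _); rewrite exchange_big; apply: eq_bigr => i _ /=.
by rewrite /dirdot mulr_sumr; apply: eq_bigr => j _; rewrite mulrA.
Qed.

(** The exponent is additive in the digits of [x], so the sum over digit vectors factors into one
    binomial sum per direction; the offset [s] along [j0] comes out as a pure phase. *)
Lemma kern_sum c (y : d.-tuple R) s (j0 : 'I_d) :
  \sum_(x < (Q ^ m)%N) (weight_of m Q W x)%:C *
     (cis (- shift_of m Q c x) * cis (inner (freq s j0 x) y)) =
  cis (s * tnth y j0) * kern (fun i => dirdot y i - c i).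
Proof.
have E x : (weight_of m Q W x)%:C *
     (cis (- shift_of m Q c x) * cis (inner (freq s j0 x) y)) =
   cis (s * tnth y j0) * \prod_(i < m) ((W (digit Q x i))%:C *
      cis ((digit Q x i)%:R * (dirdot y i - c i))).
  rewrite inner_freq -cisD addrCA cisD mulrCA; congr (_ * _).
  rewrite big_split /= -rmorph_prod -cis_sum; congr (_ * cis _).
  rewrite /shift_of -sumrN -big_split /=; apply: eq_bigr => i _; ring.
rewrite (eq_bigr _ (fun (x : 'I_(Q ^ m)) _ => E x)) -mulr_sumr; congr (_ * _).
rewrite (sum_digits _ (fun i a => (W a)%:C * cis (a%:R * (dirdot y i - c i))) Q_gt0).
apply: eq_bigr => i _; rewrite -(sum_binweight_cis _ Q_gt0); apply: eq_bigr => a _.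
by rewrite W_binweight.
Qed.

(** The weights are probabilities and the twists have modulus 1. Hence the averaged noise is at most
    the largest noise at a single frequency, without a factor [Q ^ m]. *)
Lemma cmod_G_approx c s (j0 : 'I_d) :
  (forall x, (x < Q ^ m)%N ->
    cmod (ecf (freq s j0 x) / phi (freq s j0 x) - mix_cf (freq s j0 x)) <= eta) ->
  cmod (G c s j0 - \sum_(j < k) (w j)%:C *
    (cis (s * tnth (mu j) j0) * kern (fun i => dirdot (mu j) i - c i))) <= eta.
Proof.
move=> noise.
have -> : \sum_(j < k) (w j)%:C *
    (cis (s * tnth (mu j) j0) * kern (fun i => dirdot (mu j) i - c i)) =
  \sum_(x < (Q ^ m)%N) (weight_of m Q W x)%:C *
      (cis (- shift_of m Q c x) * mix_cf (freq s j0 x)).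
  under eq_bigr do rewrite -kern_sum mulr_sumr.
  rewrite exchange_big; apply: eq_bigr => x _ /=.
  rewrite /mix_cf 2!mulr_sumr; apply: eq_bigr => j _; ring.
rewrite G_sum -sumrB (le_trans (ler_cmod_sum _ _ _))//.
rewrite -[leRHS]mul1r -sum_weight_of mulr_suml ler_sum// => x _.
rewrite -2!mulrBr 2!Normc.normcM cmod_cis mul1r cmodR ger0_norm ?weight_of_ge0//.
by rewrite ler_wpM2l ?weight_of_ge0// noise.
Qed.

Lemma cmod_kern_sqr (y : nat -> R) : cmod (kern y) ^+ 2 = \prod_(i < m) (1 - sin2h (y i)) ^+ Q.-1.
Proof.
rewrite /kern cmod_prod -prodrXl; apply: eq_bigr => i _.
have cX (z : R[i]) N : cmod (z ^+ N) = cmod z ^+ N.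
  by elim: N => [|N IH]; rewrite ?expr0 ?Normc.normc1// !exprS Normc.normcM IH.
by rewrite cX exprAC cmod_1Dcis.
Qed.

Lemma cmod_kern_le1 (y : nat -> R) : cmod (kern y) <= 1.
Proof.
rewrite -(@ler_pXn2r _ 2) ?nnegrE ?cmod_ge0// cmod_kern_sqr expr1n.
apply: prodr_ile1 => i _; have := sin2h_ge0 (y i); have := sin2h_le1 (y i) => h1 h0.
by rewrite exprn_ge0 ?exprn_ile1//; lra.
Qed.

(** One distant direction suffices: the factors of the others are at most 1, and
    [1 - r <= expR (- r)]. *)
Lemma cmod_kern_far (y : nat -> R) (i : 'I_m) (r : R) : 0 <= r -> r <= sin2h (y i) ->
  cmod (kern y) ^+ 2 <= expR (- (Q.-1%:R * r)).
Proof.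
move=> r0 ry; rewrite cmod_kern_sqr (bigD1 i)//=.
have h (i' : 'I_m) : 0 <= (1 - sin2h (y i')) ^+ Q.-1 <= 1.
  have := sin2h_ge0 (y i'); have := sin2h_le1 (y i') => h1 h0.
  by rewrite exprn_ge0 ?exprn_ile1//; lra.
have /andP[i0 i1] := h i.
apply: (@le_trans _ _ ((1 - sin2h (y i)) ^+ Q.-1)).
  rewrite ler_piMr// prodr_ile1// => j _; exact: h.
rewrite -[- (_ * r)]mulrN expRM_natl lerXn2r ?nnegrE ?expR_ge0//.
  by have := sin2h_le1 (y i); lra.
by rewrite (le_trans _ (expR_ge1Dx _))//; lra.
Qed.

(** Bernoulli's inequality in each direction, then the same inequality for a product of distinct
    factors between 0 and 1. *)
Lemma cmod_kern_near (y : nat -> R) :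
  1 - Q%:R * \sum_(i < m) sin2h (y i) <= cmod (kern y) ^+ 2.
Proof.
rewrite cmod_kern_sqr.
have bern (s : R) N : 0 <= s -> s <= 1 -> 1 - N%:R * s <= (1 - s) ^+ N.
  move=> s0 s1; elim: N => [|N IH]; first by rewrite expr0 mul0r subr0.
  have s2 : 0 <= N%:R * s by rewrite mulr_ge0.
  have : (1 - s) * (1 - N%:R * s) <= (1 - s) ^+ N.+1.
    by rewrite exprS ler_wpM2l//; lra.
  apply: le_trans; rewrite -natr1; nra.
have h (i : 'I_m) : 1 - Q%:R * sin2h (y i) <= (1 - sin2h (y i)) ^+ Q.-1.
  apply: le_trans (bern _ _ (sin2h_ge0 _) (sin2h_le1 _)).
  by rewrite lerD2l lerN2 ler_wpM2r ?sin2h_ge0// ler_nat leq_pred.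
elim: m h => [|M IH] h; first by rewrite !big_ord0 mulr0 subr0.
rewrite !big_ord_recr /=.
have {}IH := IH (fun i => h (widen_ord (leqnSn M) i)).
have hM := h ord_max; rewrite /= in hM.
set a := \sum_(i < M) _ in IH *; set b := \prod_(i < M) _ in IH *.
have b1 : b <= 1.
  apply: prodr_ile1 => i _; have := sin2h_ge0 (y i); have := sin2h_le1 (y i) => h1 h0.
  by rewrite exprn_ge0 ?exprn_ile1//; lra.
have b0 : 0 <= b.
  apply: prodr_ge0 => i _; have := sin2h_le1 (y i) => h1.
  by rewrite exprn_ge0//; lra.
move: hM; set p := _ ^+ Q.-1 => hM.
have p0 : 0 <= p by rewrite exprn_ge0// subr_ge0 sin2h_le1.
have q0 : 0 <= Q%:R * sin2h (y M) by rewrite mulr_ge0// sin2h_ge0.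
have p1 : p <= 1.
  by rewrite exprn_ile1//; have := sin2h_le1 (y M); have := sin2h_ge0 (y M); lra.
move: hM IH; rewrite mulrDr; set x := _ * sin2h _ in q0 *; set z := _ * a => hM IH.
nra.
Qed.

End Kernel.

(** * Distance on the circle and extraction of a phase *)

Section Trigonometry.
Variable R : realType.
Implicit Types x y : R.

(** Half the chord between the angles 0 and [x]: it gives a pseudometric modulo [2 * pi] whose
    square the program can evaluate without reducing angles. *)
Definition sdist x : R := `|sin (x / 2)|.

Lemma sdist_ge0 x : 0 <= sdist x. Proof. exact: normr_ge0. Qed.

Lemma sin2hE x : sin2h x = sdist x ^+ 2.
Proof. by rewrite /sin2h /sdist real_normK ?num_real// expr2. Qed.

Lemma sdistN x : sdist (- x) = sdist x.
Proof. by rewrite /sdist mulNr sinN normrN. Qed.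

Lemma sdistB x y : sdist (x - y) = sdist (y - x).
Proof. by rewrite -sdistN opprB. Qed.

Lemma sdist_add x y : sdist (x + y) <= sdist x + sdist y.
Proof.
rewrite /sdist mulrDl sinD (le_trans (ler_normD _ _))// !normrM lerD//.
  by rewrite ler_piMr// cos_max.
by rewrite ler_piMl// cos_max.
Qed.

Lemma sdist_tri y x z : sdist (x - z) <= sdist (x - y) + sdist (y - z).
Proof. by rewrite -[x - z](subrKA y) sdist_add. Qed.

Lemma sdist_le x : sdist x <= `|x| / 2.
Proof. by rewrite (le_trans (sin_norm_le _))// normrM normfV normr_nat. Qed.

Lemma sdist_period x (z : int) : sdist (x + z%:~R * (pi *+ 2)) = sdist x.
Proof.
have nat_case (N : nat) y : sdist (y + N%:R * (pi *+ 2)) = sdist y.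
  rewrite /sdist; have -> : (y + N%:R * (pi *+ 2)) / 2 = y / 2 + pi *+ N.
    by rewrite -[pi *+ 2]mulr_natr -[pi *+ N]mulr_natr; field.
  rewrite (alternatingn (@sinDpi R)) normrM normrX normrN1 expr1n mul1r //.
case: z => N; first exact: nat_case.
rewrite NegzE -[in RHS](subrK (N.+1%:R * (pi *+ 2)) x) nat_case.
by rewrite mulrNz mulNr.
Qed.

Lemma atan_lip x y : `|atan x - atan y| <= `|x - y|.
Proof.
wlog xy : x y / y <= x.
  move=> h; have [/h//|/ltW xy] := leP y x.
  by rewrite distrC (distrC x); exact: h.
have axy : atan y <= atan x by rewrite le_atan.
rewrite !ger0_norm ?subr_ge0//.
pose f (z : R) := z - atan z.
have df (z : R) : is_derive z 1 f (1 - (1 + z ^+ 2)^-1) by rewrite /f; apply: is_deriveB.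
have dfx (z : R) : derivable f z 1 by have [] := df z.
have dE (z : R) : derive1 f z = 1 - (1 + z ^+ 2)^-1 by rewrite derive1E; have [] := df z.
suff : f y <= f x by rewrite /f; lra.
apply: (@ger0_derive1_le_cc _ f y x) => //=.
- move=> z _; rewrite dE subr_ge0 invf_le1; have := sqr_ge0 z; lra.
- by apply: derivable_within_continuous => z _.
- by rewrite in_itv /= lexx xy.
- by rewrite in_itv /= lexx xy.
Qed.

Lemma cos_ge_quad x : 1 - x ^+ 2 / 2 <= cos x.
Proof.
have -> : x = (x / 2) *+ 2 by rewrite -mulr_natr; field.
rewrite cos_mulr2n cos2sin2.
have : sin (x / 2) ^+ 2 <= (x / 2) ^+ 2.
  rewrite -[sin _ ^+ 2]real_normK ?num_real// -[(x / 2) ^+ 2]real_normK ?num_real//.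
  by rewrite ler_pXn2r ?nnegrE// sin_norm_le.
lra.
Qed.

(** The numerator of [b / a - tan psi] is the cross product of [(a, b)] with the unit vector of
    angle [psi], so only the two errors survive in it. The denominator is at least
    [(13/16) * (7/8) * r], as [|psi| <= 1/2] gives [cos psi >= 7/8], and [atan] is 1-Lipschitz. *)
Lemma atan_approx (a b psi r e : R) : 0 < r -> 0 <= e <= 1 / 16 -> `|psi| <= 1 / 2 ->
  `|a - r * cos psi| <= e * r -> `|b - r * sin psi| <= e * r ->
  `|atan (b / a) - psi| <= 4 * e.
Proof.
move=> r0 /andP[e0 e1] p1 ha hb.
have c0 : 7 / 8 <= cos psi.
  have : psi ^+ 2 <= 1 / 4.
    by rewrite -[psi ^+ 2]real_normK ?num_real//; have := normr_ge0 psi; nra.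
  by have := cos_ge_quad psi; lra.
have s1 : `|sin psi| <= 1 / 2 by apply: le_trans (sin_norm_le _) p1.
have a0 : 13 / 16 * r <= a by move: ha; rewrite ler_norml => /andP[h _]; nra.
have agt : 0 < a by nra.
have -> : psi = atan (tan psi).
  rewrite tanK// in_itv /=; have := pihalf_ge1 R.
  by move: p1; rewrite ler_norml => /andP[]; lra.
apply: le_trans (atan_lip _ _) _.
have cn : cos psi != 0 by apply/eqP; lra.
have -> : b / a - tan psi =
   ((b - r * sin psi) * cos psi - (a - r * cos psi) * sin psi) / (a * cos psi).
  by rewrite /tan; field; rewrite cn gt_eqF.
have ac : 0 < a * cos psi by rewrite mulr_gt0//; lra.
rewrite normrM normfV (gtr0_norm ac) ler_pdivrMr//.
apply: le_trans (ler_normB _ _) _; rewrite !normrM.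
have c1 : `|cos psi| <= 1 := cos_max psi.
have h1 : `|b - r * sin psi| * `|cos psi| <= e * r.
  by rewrite -[leRHS]mulr1; apply: ler_pM.
have h2 : `|a - r * cos psi| * `|sin psi| <= e * r * (1 / 2) by apply: ler_pM.
have h3 : 13 / 16 * r * (7 / 8) <= a * cos psi by apply: ler_pM => //; nra.
have er : 0 <= e * r by rewrite mulr_ge0// ltW.
have : 4 * e * (13 / 16 * r * (7 / 8)) <= 4 * e * (a * cos psi).
  by rewrite ler_wpM2l//; lra.
nra.
Qed.

End Trigonometry.

(** * Deterministic accuracy *)

Section Estimate.
Variables (R : realType) (d : nat) (sample : nat -> nat -> R).
Variables (phi : d.-tuple R -> R[i]) (k m n Q : nat).
Variables (W u : nat -> R) (w : 'I_k -> R) (mu : 'I_k -> d.-tuple R).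
Variables (eta tau th rho M eps' : R).
Hypotheses (Q_gt0 : (0 < Q)%N) (n_gt0 : (0 < n)%N) (d_gt0 : (0 < d)%N).
Hypothesis W_binweight : forall a, (a < Q)%N -> W a = binweight R Q a.
Hypothesis w_gt0 : forall j, 0 < w j.
Hypothesis sum_w : \sum_(j < k) w j = 1.
Local Notation freq := (freq d m Q u).
Local Notation G := (G sample phi m n Q W u).
Local Notation ecf := (ecf sample n).
Local Notation mix_cf := (mix_cf w mu).
Local Notation kern := (@kern R m Q).
Local Notation mean_of := (mean_of sample phi m n Q W u).
Local Notation weight_est := (weight_est sample phi m n Q W u).
Local Notation recenter := (recenter sample phi m n Q W u).
Local Notation loc j := (dirdot u (mu j)).

Definition used_scale (s : R) : Prop := s = 0 \/ exists2 l, (l <= n)%N & s = 2 ^+ l / 2 ^+ n.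

Hypothesis noise : forall s (j0 : 'I_d) x, used_scale s -> (x < Q ^ m)%N ->
  cmod (ecf (freq s j0 x) / phi (freq s j0 x) - mix_cf (freq s j0 x)) <= eta.
Hypotheses (eta_ge0 : 0 <= eta) (tau_ge0 : 0 <= tau) (rho_ge0 : 0 <= rho).
Hypothesis tail : expR (- (Q.-1%:R * rho ^+ 2)) <= tau ^+ 2.

Lemma kern_far (y : nat -> R) (i : 'I_m) : rho <= sdist (y i) -> cmod (kern y) <= tau.
Proof.
move=> h; rewrite -(@ler_pXn2r _ 2) ?nnegrE ?cmod_ge0//.
apply: le_trans tail; apply: (@cmod_kern_far _ _ _ _ i); first exact: sqr_ge0.
by rewrite sin2hE ler_pXn2r ?nnegrE ?sdist_ge0.
Qed.

Definition near_loc (j : 'I_k) (c : nat -> R) : Prop :=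
  forall i : 'I_m, sdist (loc j i - c i) <= rho.
(** The point [c] is not asked to be near the location of [j]; all others must be far from it. The
    kernel of [j] at [c] then stays an unknown complex factor, common to all scales, which cancels
    in the phase. *)
Definition isolated (j : 'I_k) (c : nat -> R) : Prop :=
  forall j', j' != j -> exists i : 'I_m, rho <= sdist (loc j' i - c i).

Lemma far_sum_le (P : pred 'I_k) (c : nat -> R) s (j0 : 'I_d) :
  (forall j, P j -> exists i : 'I_m, rho <= sdist (loc j i - c i)) ->
  cmod (\sum_(j < k | P j) (w j)%:C *
    (cis (s * tnth (mu j) j0) * kern (fun i => loc j i - c i))) <= tau.
Proof.
move=> far; apply: le_trans (ler_cmod_sum _ _ _) _.
apply: (@le_trans _ _ (\sum_(j < k | P j) w j * tau)).
  apply: ler_sum => j Pj; rewrite 2!Normc.normcM cmod_cis mul1r cmodR gtr0_norm//.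
  have [i h] := far j Pj; apply: ler_wpM2l; first exact: ltW.
  exact: (@kern_far (fun i => loc j i - c i) i h).
rewrite -mulr_suml -[leRHS]mul1r ler_wpM2r// -sum_w [leRHS](bigID P)/=.
by rewrite lerDl sumr_ge0// => j _; rewrite ltW.
Qed.

Lemma G_isolated j (c : nat -> R) s (j0 : 'I_d) : used_scale s -> isolated j c ->
  cmod (G c s j0 - (w j)%:C *
    (cis (s * tnth (mu j) j0) * kern (fun i => loc j i - c i))) <= eta + tau.
Proof.
move=> us iso.
have h1 := cmod_G_approx Q_gt0 W_binweight c (fun x xQ => noise j0 us xQ).
rewrite (bigD1 j)//= in h1.
have h2 := @far_sum_le (predC1 j) c s j0 iso.
set A := (w j)%:C * _ in h1 *; set S := \sum_(i < k | _) _ in h1.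
have -> : G c s j0 - A = G c s j0 - (A + S) + S by ring.
by apply: le_trans (ler_cmodD _ _) _; apply: lerD.
Qed.

Lemma cmod_G c : cmod (G c 0 0) ^+ 2 =
  Gre sample phi m n Q W u c 0 0 * Gre sample phi m n Q W u c 0 0 +
  Gim sample phi m n Q W u c 0 0 * Gim sample phi m n Q W u c 0 0.
Proof. by rewrite cmod_sqr /= !expr2. Qed.

Lemma accepted_cmod c : 0 <= th ->
  accepted sample phi m n Q W u (th * th) c = (th <= cmod (G c 0 0)).
Proof.
move=> th0; rewrite /accepted -leNgt -cmod_G -expr2.
by rewrite ler_pXn2r ?nnegrE ?cmod_ge0.
Qed.

Lemma used0 : used_scale 0. Proof. by left. Qed.

Let j00 : 'I_d := Ordinal d_gt0.

(** If every location were at distance [rho] or more in some direction, the kernel would be at most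
    [tau] for all components, and [|G_0|] at most [eta + tau], below the threshold. *)
Lemma accepted_near c : eta + tau < th ->
  accepted sample phi m n Q W u (th * th) c -> exists j, near_loc j c.
Proof.
move=> eth; rewrite accepted_cmod; last first.
  by apply/ltW; apply: le_lt_trans eth; apply: addr_ge0.
move=> acc; apply: contrapT => /forallNP nonear.
have far j : exists i : 'I_m, rho <= sdist (loc j i - c i).
  have /existsNP[i /negP] := nonear j; rewrite -ltNge => h.
  by exists i; exact: ltW.
have h1 := cmod_G_approx Q_gt0 W_binweight c (fun x xQ => noise j00 used0 xQ).
have h2 := @far_sum_le predT c 0 j00 (fun j _ => far j).
have := ler_cmodD (G c 0 j00 - \sum_(j < k) (w j)%:C *
    (cis (0 * tnth (mu j) j00) * kern (fun i => loc j i - c i)))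
   (\sum_(j < k) (w j)%:C *
    (cis (0 * tnth (mu j) j00) * kern (fun i => loc j i - c i))).
rewrite subrK => h3.
have : cmod (G c 0 0) <= eta + tau by apply: le_trans h3 (lerD h1 h2).
by move=> h4; have := le_lt_trans (le_trans acc h4) eth; rewrite ltxx.
Qed.

Hypothesis th_bound : 6 * (eta + tau) <= th * eps'.
Hypotheses (eps'_gt0 : 0 < eps') (eps'_le : eps' <= 1 / 16) (th_gt0 : 0 < th).

Lemma err_le_th : eta + tau <= th / 96.
Proof.
have : th * eps' <= th * (1 / 16) by rewrite ler_wpM2l// ltW.
move: th_bound; lra.
Qed.

(** With the same unknown [A] in both approximations, [g * conj g0] is close to
    [|A| ^ 2 * cis (s * x)]. Its error consists of three terms of size at most [(eta + tau) * |A|];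
    since [|A| >= th / 2] and [6 * (eta + tau) <= th * eps'], the relative error is at most
    [eps']. *)
Lemma refine_step_acc (A : R[i]) (g0 g : R[i]) (s x v : R) :
  0 < s -> th <= cmod g0 -> cmod (g0 - A) <= eta + tau ->
  cmod (g - cis (s * x) * A) <= eta + tau -> `|s * (x - v)| <= 1 / 2 ->
  `|x - refine_step (complex.Re g0) (complex.Im g0) (complex.Re g) (complex.Im g) s v|
    <= 4 * eps' / s.
Proof.
move=> s0 hg0 h0 h1 hv.
have eE := err_le_th.
have A2 : th / 2 <= cmod A.
  have := ler_cmodD (g0 - A) A; rewrite subrK => h.
  have := le_trans hg0 (le_trans h (lerD h0 (lexx _))).
  by move: eE th_gt0; lra.
have a0 : 0 < cmod A by apply: lt_le_trans A2; rewrite divr_gt0.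
rewrite /refine_step; set a := _ * cos _ + _ * sin _; set b := _ * cos _ - _ * sin _.
have hz : cmod ((a +i* b) - (cmod A ^+ 2)%:C * cis (s * (x - v))) <= eps' * cmod A ^+ 2.
  have -> : a +i* b = g * g0^*%C * cis (- (s * v)).
    rewrite /a /b; case: (g) => p q; case: (g0) => p0 q0.
    apply/eqP; rewrite eq_complex /= cosN sinN.
    by apply/andP; split; apply/eqP; ring.
  have -> : (cmod A ^+ 2)%:C * cis (s * (x - v)) =
     (cis (s * x) * A) * A^*%C * cis (- (s * v)).
    rewrite mulrBr cisD mulrA; congr (_ * _).
    rewrite -mulrA mulrC; congr (_ * _).
    rewrite cmod_sqr; case: (A) => p q; apply/eqP; rewrite eq_complex /=.
    by apply/andP; split; apply/eqP; ring.
  rewrite -mulrBl Normc.normcM cmod_cis mulr1.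
  set B := cis (s * x) * A in h1 *.
  have cB : cmod B = cmod A by rewrite /B Normc.normcM cmod_cis mul1r.
  have cJ (z : R[i]) : cmod z^*%C = cmod z by case: z => p q /=; rewrite sqrrN.
  have -> : g * g0^*%C - B * A^*%C = (g - B) * (g0 - A)^*%C + (g - B) * A^*%C
     + B * (g0 - A)^*%C.
    by rewrite rmorphB; ring.
  have E0 : 0 <= eta + tau by rewrite addr_ge0.
  have t1 : cmod ((g - B) * (g0 - A)^*%C) <= (eta + tau) * cmod A.
    rewrite Normc.normcM cJ; apply: ler_pM; rewrite ?cmod_ge0//.
    by apply: le_trans h0 _; move: eE A2 th_gt0; lra.
  have t2 : cmod ((g - B) * A^*%C) <= (eta + tau) * cmod A.
    by rewrite Normc.normcM cJ ler_wpM2r ?cmod_ge0.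
  have t3 : cmod (B * (g0 - A)^*%C) <= (eta + tau) * cmod A.
    by rewrite Normc.normcM cJ cB mulrC ler_wpM2r ?cmod_ge0.
  apply: le_trans (ler_cmodD _ _) _.
  apply: le_trans (lerD (ler_cmodD _ _) (lexx _)) _.
  apply: le_trans (lerD (lerD t1 t2) t3) _.
  have : 3 * (eta + tau) <= eps' * cmod A.
    have : (th / 2) * eps' <= cmod A * eps' by rewrite ler_wpM2r// ltW.
    by move: th_bound; lra.
  move=> h; rewrite expr2 mulrA.
  have := ler_wpM2r (ltW a0) h; lra.
have hR := le_trans (ler_Re_cmod _) hz.
have hI := le_trans (ler_Im_cmod _) hz.
have E1 : complex.Re (a +i* b - (cmod A ^+ 2)%:C * cis (s * (x - v))) =
   a - cmod A ^+ 2 * cos (s * (x - v)) by rewrite /= mul0r subr0.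
have E2 : complex.Im (a +i* b - (cmod A ^+ 2)%:C * cis (s * (x - v))) =
   b - cmod A ^+ 2 * sin (s * (x - v)) by rewrite /= mul0r addr0.
rewrite E1 in hR; rewrite E2 in hI.
have := @atan_approx _ a b (s * (x - v)) (cmod A ^+ 2) eps' _ _ hv hR hI.
rewrite exprn_gt0// eps'_le ltW//= => /(_ isT isT) h.
rewrite -(ler_pM2l s0) -{1}(gtr0_norm s0) -normrM [leRHS]mulrC divfK ?gt_eqF//.
rewrite distrC in h; apply: le_trans h; rewrite opprD addrA mulrBr.
by rewrite [s * (_ / s)]mulrC divfK ?gt_eqF.
Qed.

(** Induction over the scales. At [s = 2 ^ - n] the starting value 0 is admissible because the
    coordinate is at most [2 ^ (n - 1)]. An error [4 * eps' / s] left by one scale becomes a phase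
    [8 * eps' <= 1/2] at the doubled scale, and the last scale is 1. *)
Lemma mean_of_acc j c (j0 : 'I_d) : isolated j c -> th <= cmod (G c 0 0) ->
  `|tnth (mu j) j0| <= 2 ^+ n.-1 -> `|tnth (mu j) j0 - mean_of c j0| <= 4 * eps'.
Proof.
move=> iso acc small; set x := tnth (mu j) j0 in small *.
pose A := (w j)%:C * kern (fun i => loc j i - c i).
have g0 : cmod (G c 0 0 - A) <= eta + tau.
  by have := G_isolated j00 used0 iso; rewrite mul0r cis0 mul1r.
have gs l : (l <= n)%N -> cmod (G c (2 ^+ l / 2 ^+ n) j0 - cis (2 ^+ l / 2 ^+ n * x) * A) <= eta + tau.
  move=> ln; have us : used_scale (2 ^+ l / 2 ^+ n) by right; exists l.
  by have := G_isolated j0 us iso; rewrite mulrCA.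
have s0 l : 0 < 2 ^+ l / 2 ^+ n :> R by rewrite divr_gt0 ?exprn_gt0.
have main l : (l <= n)%N ->
  `|2 ^+ l / 2 ^+ n * (x - refine sample phi m n Q W u c j0 l)| <= 1 / 2 /\
  `|x - refine sample phi m n Q W u c j0 l.+1| <= 4 * eps' / (2 ^+ l / 2 ^+ n).
  elim: l => [_|l IH ln].
    have h0 : `|2 ^+ 0 / 2 ^+ n * (x - refine sample phi m n Q W u c j0 0)| <= 1 / 2.
      rewrite subr0 expr0 mul1r [_ * x]mulrC normrM normfV normrX normr_nat.
      rewrite ler_pdivrMr ?exprn_gt0//.
      by apply: le_trans small _; rewrite -{2}(prednK n_gt0) exprS; lra.
    by split=> //; apply: (@refine_step_acc A (G c 0 0) (G c (2 ^+ 0 / 2 ^+ n) j0)) => //; exact: gs.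
  have [_ h] := IH (ltnW ln).
  have h1 : `|2 ^+ l.+1 / 2 ^+ n * (x - refine sample phi m n Q W u c j0 l.+1)| <= 1 / 2.
    rewrite normrM gtr0_norm//.
    apply: (@le_trans _ _ (2 ^+ l.+1 / 2 ^+ n * (4 * eps' / (2 ^+ l / 2 ^+ n)))).
      by rewrite ler_wpM2l// ltW.
    have -> : 2 ^+ l.+1 / 2 ^+ n * (4 * eps' / (2 ^+ l / 2 ^+ n)) = 8 * eps' :> R.
      by rewrite exprS; field; rewrite !expf_neq0.
    by move: eps'_le; lra.
  by split=> //; apply: (@refine_step_acc A (G c 0 0) (G c (2 ^+ l.+1 / 2 ^+ n) j0)) => //; exact: gs.
have [_ ] := main n (leqnn n).
by rewrite divff ?expf_neq0// divr1.
Qed.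

Hypothesis u_le : forall x, (x < m * d)%N -> `|u x| <= 2 * M.
Hypothesis M_ge0 : 0 <= M.

Lemma recenter_acc j c : isolated j c -> th <= cmod (G c 0 0) ->
  (forall j0, `|tnth (mu j) j0| <= 2 ^+ n.-1) ->
  forall i : 'I_m, `|loc j i - recenter c i| <= d%:R * (8 * M * eps').
Proof.
move=> iso acc small i; rewrite /dirdot /recenter -sumrB.
apply: le_trans (ler_norm_sum _ _ _) _.
rewrite -[X in _ <= X%:R * _]card_ord -sum1_card natr_sum mulr_suml.
apply: ler_sum => j0 _; rewrite mul1r -mulrBr normrM.
have im : (i * d + j0 < m * d)%N by have := ltn_ord i; have := ltn_ord j0; nia.
apply: le_trans (ler_pM _ _ (u_le im) (mean_of_acc iso acc (small j0))) _ => //.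
by rewrite le_eqVlt; apply/orP; left; apply/eqP; ring.
Qed.

(** After recentering, the kernel of [j] falls short of 1 only by the square of the location error,
    and this loss enters multiplied by [w j <= 1]. *)
Lemma weight_est_acc j c : isolated j c -> th <= cmod (G c 0 0) ->
  (forall j0, `|tnth (mu j) j0| <= 2 ^+ n.-1) -> isolated j (recenter c) ->
  `|w j - weight_est c| <= eta + tau + Q%:R * (m%:R * (d%:R * (4 * M * eps')) ^+ 2).
Proof.
move=> iso acc small iso'.
have -> : weight_est c = cmod (G (recenter c) 0 0).
  by rewrite /weight_est /mass -cmod_G sqrtr_sqr ger0_norm// cmod_ge0.
have h := G_isolated j00 used0 iso'.
rewrite mul0r cis0 mul1r in h; set K := kern _ in h.
have w1 : w j <= 1.
  by rewrite -sum_w (bigD1 j)//= lerDl sumr_ge0// => i _; rewrite ltW.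
have K1 : cmod K <= 1 by exact: cmod_kern_le1.
have K2 : 1 - Q%:R * (m%:R * (d%:R * (4 * M * eps')) ^+ 2) <= cmod K.
  apply: (@le_trans _ _ (cmod K ^+ 2)); last first.
    by rewrite expr2 ler_piMl ?cmod_ge0.
  apply: le_trans (cmod_kern_near _ _ _); rewrite lerD2l lerN2 ler_wpM2l//.
  rewrite -[X in _ <= X%:R * _]card_ord -sum1_card natr_sum mulr_suml.
  apply: ler_sum => i _; rewrite mul1r sin2hE ler_pXn2r ?nnegrE ?sdist_ge0//; last first.
    by rewrite !mulr_ge0// ltW.
  apply: le_trans (sdist_le _) _.
  by have := recenter_acc iso acc small i; lra.
have cwK : cmod ((w j)%:C * K) = w j * cmod K by rewrite Normc.normcM cmodR gtr0_norm.
have u1 := ler_cmodD (G (recenter c) 0 0 - (w j)%:C * K) ((w j)%:C * K).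
have u2 := ler_cmodD ((w j)%:C * K - G (recenter c) 0 0) (G (recenter c) 0 0).
rewrite subrK cwK in u1; rewrite subrK cwK cmodB in u2.
have {}u1 := le_trans u1 (lerD h (lexx _)).
have {}u2 := le_trans u2 (lerD h (lexx _)).
rewrite ler_norml; have wj := w_gt0 j; have k0 := cmod_ge0 K.
set X := Q%:R * _ in K2 *; set g := cmod (G _ _ _) in u1 u2 *.
have wK : w j * cmod K <= w j by rewrite ler_piMr// ltW.
have X0 : 0 <= X.
  by rewrite /X; apply: mulr_ge0 => //; apply: mulr_ge0 => //; exact: sqr_ge0.
have wK2 : w j - X <= w j * cmod K.
  have : w j * (1 - X) <= w j * cmod K by rewrite ler_wpM2l// ltW.
  have : w j * X <= X by rewrite ler_piMl.
  lra.
apply/andP; split; lra.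
Qed.

Variable (rr : nat).
Hypothesis rr_gt0 : (0 < rr)%N.
Hypothesis rhoE : rho = 1 / (64 * rr%:R).
Hypothesis eta_tau_th : eta + tau < th.

Lemma apartP (c p : nat -> R) :
  apart m rr c p <-> exists i : 'I_m, 4 * rho < sdist (c i - p i).
Proof.
have sE i : (sep_bound R rr < sin2h (c i - p i)) = (4 * rho < sdist (c i - p i)).
  rewrite sin2hE -(@ltr_pXn2r _ 2 _ (4 * rho)) ?nnegrE ?sdist_ge0//; last first.
    by rewrite mulr_ge0.
  congr (_ < _); rewrite /sep_bound rhoE; field.
  by rewrite pnatr_eq0 -lt0n.
rewrite /apart; split.
  elim/big_ind: _ => // [x y hx hy /orP[/hx|/hy]//|i _].
  by rewrite sE => h; exists i.
move=> [i h]; rewrite (bigD1 i)//= sE h.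
by rewrite orTb.
Qed.

Section Picks.
Variables (cnt : nat) (pick : nat -> nat).
Hypothesis picks : picks_spec sample phi k m n Q rr W u (th * th) (Q ^ m) cnt pick.
Local Notation cand p := (@candidate R Q (pick p)).

(** Two picks near the same location would be within [2 * rho] of each other in every direction,
    whereas picks differ by more than [4 * rho] in some direction. *)
Lemma picks_loc : exists f : 'I_cnt -> 'I_k,
  injective f /\ forall p : 'I_cnt, near_loc (f p) (cand p).
Proof.
have [ck acc sep _] := picks.
have /choice[f fP] (p : 'I_cnt) : exists j, near_loc j (cand p).
  by apply: accepted_near => //; have [] := acc p (ltn_ord p).
exists f; split=> // p q fpq; apply: contrapT => /eqP pq.
wlog qp : p q fpq pq / (p < q)%N.
  move=> h; move: (pq); rewrite -val_eqE neq_ltn => /orP[|qp]; first exact: h.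
  by apply: (h q p) => //; rewrite eq_sym.
have /apartP[i h] : apart m rr (cand q) (cand p) by apply: sep; rewrite qp ltn_ord.
have h1 := fP p i; have h2 := fP q i; rewrite -fpq in h2.
have := sdist_tri (loc (f p) i) (cand q i) (cand p i).
rewrite [sdist (cand q i - loc _ _)]sdistB.
by move: rho_ge0; lra.
Qed.

Lemma cand_far (f : 'I_cnt -> 'I_k) (p q : 'I_cnt) :
  (forall p : 'I_cnt, near_loc (f p) (cand p)) -> p != q ->
  exists i : 'I_m, 3 * rho < sdist (loc (f q) i - cand p i).
Proof.
move=> fP pq; have [_ _ sep _] := picks.
have [i h] : exists i : 'I_m, 4 * rho < sdist (cand q i - cand p i).
  move: (pq); rewrite -val_eqE neq_ltn => /orP[] h.
    by apply/apartP; apply: sep; rewrite h ltn_ord.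
  have /apartP[i hi] : apart m rr (cand p) (cand q) by apply: sep; rewrite h ltn_ord.
  by exists i; rewrite sdistB.
exists i; have := sdist_tri (loc (f q) i) (cand q i) (cand p i).
rewrite [sdist (cand q i - loc _ _)]sdistB; have := fP q i; lra.
Qed.

End Picks.

Lemma norm2_le (x : d.-tuple R) (b : R) : 0 <= b ->
  (forall i, `|tnth x i| <= b) -> norm2 x <= d%:R * b.
Proof.
move=> b0 xb; rewrite /norm2 -[leRHS]ger0_norm ?mulr_ge0// -sqrtr_sqr.
rewrite ler_wsqrtr//; apply: (@le_trans _ _ (d%:R * b ^+ 2)).
  rewrite -[X in _ <= X%:R * _]card_ord -sum1_card natr_sum mulr_suml.
  apply: ler_sum => i _; rewrite mul1r -expr2 -[tnth x i ^+ 2]real_normK ?num_real//.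
  by rewrite ler_pXn2r ?nnegrE.
rewrite exprMn ler_wpM2r ?sqr_ge0// expr2 ler_peMl// ler1n//.
Qed.

(** With [k] picks the injection into the components is a permutation, and this alone isolates every
    pick: any other component lies within [rho] of its own pick, which is [4 * rho] away. No
    separation of the locations is assumed. *)
Lemma accurate_of_picks (pick : nat -> nat) (out : nat -> R) (eps : R) :
  picks_spec sample phi k m n Q rr W u (th * th) (Q ^ m) k pick ->
  outs_spec sample phi m n Q W u k pick out ->
  (forall j j0, `|tnth (mu j) j0| <= 2 ^+ n.-1) ->
  d%:R * (4 * eps') <= eps ->
  d%:R * (8 * M * eps') <= 2 * rho ->
  eta + tau + Q%:R * (m%:R * (d%:R * (4 * M * eps')) ^+ 2) <= eps ->
  accurate eps w mu (fun j => out (j * d.+1)%N)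
    (fun j => [tuple out (j * d.+1 + 1 + i)%N | i < d]).
Proof.
move=> picks outs small e1 e2 e3.
have [_ acc _ _] := picks.
have [f [finj fP]] := picks_loc picks.
pose g := perm finj; exists (g^-1)%g.
have fg j : f ((g^-1)%g j) = j by rewrite -[f _]permE permKV.
have isoj j : isolated j (candidate R Q (pick ((g^-1)%g j))).
  move=> j' jj'; have pq : (g^-1)%g j != (g^-1)%g j'.
    by apply: contraNneq jj' => e; rewrite -(fg j') -e fg.
  have [i h] := cand_far picks fP pq; exists i; rewrite fg in h.
  by move: rho_ge0; lra.
have thj j : th <= cmod (G (candidate R Q (pick ((g^-1)%g j))) 0 0).
  have [_] := acc _ (ltn_ord ((g^-1)%g j)).
  by rewrite accepted_cmod//; exact: ltW.
split=> j.
  apply: le_trans e1; apply: norm2_le; first by rewrite mulr_ge0// ltW.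
  move=> i; rewrite !tnth_mktuple.
  have [_ ->//] := outs _ (ltn_ord ((g^-1)%g j)).
  by apply: mean_of_acc.
have [-> _] := outs _ (ltn_ord ((g^-1)%g j)).
apply: le_trans e3; apply: weight_est_acc => //.
move=> j' jj'; have pq : (g^-1)%g j != (g^-1)%g j'.
  by apply: contraNneq jj' => e; rewrite -(fg j') -e fg.
(* The recentered point is within [rho] of the location of [j], as [sdist] halves the bound
   [2 * rho], hence within [2 * rho] of the candidate. A location more than [3 * rho] from the
   candidate thus keeps distance [rho] from the recentered point. *)
have [i h] := cand_far picks fP pq; exists i; rewrite fg in h.
set c := candidate R Q _ in h *.
have hn := fP ((g^-1)%g j) i; rewrite fg -/c in hn.
have hr := recenter_acc (isoj j) (thj j) (small j) i; rewrite -/c in hr.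
have := sdist_tri (recenter c i) (loc j' i) (c i).
have := sdist_tri (loc j i) (recenter c i) (c i).
have := sdist_le (loc j i - recenter c i).
rewrite [sdist (recenter c i - loc j i)]sdistB.
lra.
Qed.

(** At late trials the scale, and with it the threshold and the noise, may be large. But the
    noiseless sum has modulus at most 1, so an accepted candidate by itself certifies that the
    threshold is moderate. *)
Lemma th_le_accepted c : accepted sample phi m n Q W u (th * th) c -> th <= 1 + eta.
Proof.
rewrite accepted_cmod ?(ltW th_gt0)// => acc.
have h1 := cmod_G_approx Q_gt0 W_binweight c (fun x xQ => noise j00 used0 xQ).
set S := \sum_(j < k) _ in h1.
have S1 : cmod S <= 1.
  rewrite -sum_w; apply: le_trans (ler_cmod_sum _ _ _) _; apply: ler_sum => j _.
  rewrite 2!Normc.normcM cmod_cis mul1r cmodR gtr0_norm// ler_piMr ?(ltW (w_gt0 j))//.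
  exact: cmod_kern_le1.
have := ler_cmodD S (G c 0 0 - S); rewrite addrC subrK => h2.
by apply: le_trans acc (le_trans h2 (lerD S1 h1)).
Qed.

Lemma digits_exist (a : nat -> nat) : (forall i, (a i < Q)%N) ->
  exists2 x, (x < Q ^ m)%N & forall i, (i < m)%N -> digit Q x i = a i.
Proof.
move=> aQ; elim: m => [|M' [x xQ xd]]; first by exists 0%N.
exists (a M' * Q ^ M' + x)%N.
  rewrite expnS; have : (a M' * Q ^ M' + Q ^ M' <= Q * Q ^ M')%N.
    by rewrite -mulSnr leq_mul2r aQ orbT.
  by move: xQ; lia.
move=> i; rewrite ltnS leq_eqVlt => /predU1P[->|iM]; last by rewrite digit_mulD// xd.
by rewrite /digit divnMDl ?expn_gt0 ?Q_gt0// divn_small// addn0 modn_small.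
Qed.

(** Reduce [x] into [[0, 2 * pi)], which lies inside [[0, 8)], and round down to a multiple of
    [8 / Q]; passing to [sdist] halves the rounding error. *)
Lemma grid_point (x : R) : exists2 a, (a < Q)%N & sdist (x - 8 * a%:R / Q%:R) <= 4 / Q%:R.
Proof.
have pi0 : 0 < pi *+ 2 :> R by rewrite mulrn_wgt0// pi_gt0.
have pi8 : pi *+ 2 < 8 :> R by have := pihalf_lt2 R; lra.
pose z := Num.floor (x / (pi *+ 2)); pose y := x - z%:~R * (pi *+ 2).
have y0 : 0 <= y by rewrite subr_ge0 -ler_pdivlMr// Num.Theory.floor_le.
have y1 : y < pi *+ 2.
  have := Num.Theory.floorD1_gt (x / (pi *+ 2)); rewrite -/z ltr_pdivrMr// intrD.
  by rewrite /y mulrDl mul1r; lra.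
have Q0 : 0 < Q%:R :> R by rewrite ltr0n.
have yQ0 : 0 <= y * Q%:R / 8 by rewrite divr_ge0// mulr_ge0// ltW.
pose a := Num.truncn (y * Q%:R / 8); exists a.
  rewrite /a Num.Theory.truncn_lt_nat//; nra.
have := Num.Theory.truncn_itv yQ0; rewrite -/a -[a.+1%:R]natr1 => /andP[a1 a2].
have -> : x - 8 * a%:R / Q%:R = y - 8 * a%:R / Q%:R + z%:~R * (pi *+ 2).
  by rewrite /y; ring.
rewrite sdist_period; apply: le_trans (sdist_le _) _.
have -> : y - 8 * a%:R / Q%:R = (y * Q%:R / 8 - a%:R) * (8 / Q%:R).
  by field; rewrite gt_eqF.
rewrite normrM ger0_norm ?subr_ge0// [`|8 / _|]ger0_norm ?divr_ge0//.
have -> : 4 / Q%:R = 1 * (8 / Q%:R) / 2 :> R by field; rewrite gt_eqF.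
rewrite ler_wpM2r// ler_wpM2r ?divr_ge0//; lra.
Qed.

(** With fewer than [k] picks, some component [j] has none. A grid point next to its location is
    accepted, so by maximality it lies within [4 * rho] of a pick in every direction. Adding [rho]
    for the grid and [rho] for the pick, the location of the component of that pick is within
    [6 * rho] of that of [j], against the gap. *)
Lemma picks_complete cnt (pick : nat -> nat) :
  picks_spec sample phi k m n Q rr W u (th * th) (Q ^ m) cnt pick ->
  (forall j j', j != j' -> exists i : 'I_m, 6 * rho < sdist (loc j i - loc j' i)) ->
  4 / Q%:R <= rho -> (64 * m <= 3 * Q)%N ->
  (forall j, 2 * (th + (eta + tau)) <= w j) -> (k <= cnt)%N.
Proof.
move=> picks gap Qrho mQ wj; rewrite leqNgt; apply/negP => cntk.
have [_ acc sep comp] := picks.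
have [f [finj fP]] := picks_loc picks.
have [j jf] : exists j, forall p, f p != j.
  apply: contrapT => /forallNP h.
  have surj j : exists p, f p = j.
    by have /existsNP[p /negP/negPn/eqP <-] := h j; exists p.
  have : (#|'I_k| <= #|'I_cnt|)%N.
    have /choice[g gP] := surj.
    by apply: (@leq_card _ _ g) => a b e; rewrite -(gP a) e gP.
  by rewrite !card_ord leqNgt cntk.
have Q0 : 0 < Q%:R :> R by rewrite ltr0n.
have /choice[a aP] i : exists a, (a < Q)%N /\ sdist (loc j i - 8 * a%:R / Q%:R) <= 4 / Q%:R.
  by have [a h1 h2] := grid_point (loc j i); exists a.
have [ci ciQ cd] := digits_exist (fun i => (aP i).1).
have cP (i : 'I_m) : sdist (loc j i - candidate R Q ci i) <= 4 / Q%:R.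
  by rewrite /candidate cd//; exact: (aP i).2.
have iso : isolated j (candidate R Q ci).
  move=> j' jj'; have [i h] := gap _ _ jj'; exists i.
  have := sdist_tri (candidate R Q ci i) (loc j' i) (loc j i).
  rewrite [sdist (candidate R Q ci i - _)]sdistB.
  by have := cP i; move: rho_ge0; lra.
have acc' : accepted sample phi m n Q W u (th * th) (candidate R Q ci).
  rewrite accepted_cmod; last exact: ltW.
  have h := G_isolated j00 used0 iso.
  rewrite mul0r cis0 mul1r in h; set K := kern _ in h.
  (* The squared kernel loses at most [Q * m * (4 / Q) ^ 2 = 16 * m / Q], which is at most 3/4. *)
  have K2 : 1 / 2 <= cmod K.
    rewrite -(@ler_pXn2r _ 2) ?nnegrE ?cmod_ge0//.
    apply: le_trans (cmod_kern_near _ _ _).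
    have : \sum_(i < m) sin2h (loc j i - candidate R Q ci i) <= m%:R * (4 / Q%:R) ^+ 2.
      rewrite -[X in _ <= X%:R * _]card_ord -sum1_card natr_sum mulr_suml.
      apply: ler_sum => i _; rewrite mul1r sin2hE ler_pXn2r ?nnegrE ?sdist_ge0 ?divr_ge0//.
    move=> /(ler_wpM2l (ltW Q0)) h2.
    have : Q%:R * (m%:R * (4 / Q%:R) ^+ 2) <= 3 / 4 :> R.
      have -> : Q%:R * (m%:R * (4 / Q%:R) ^+ 2) = 16 * m%:R / Q%:R :> R.
        by field; rewrite gt_eqF.
      rewrite ler_pdivrMr//; move: mQ; rewrite -(ler_nat R) !natrM; lra.
    move=> h3; rewrite expr_div_n expr1n; lra.
  have cwK : cmod ((w j)%:C * K) = w j * cmod K by rewrite Normc.normcM cmodR gtr0_norm.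
  have := ler_cmodD ((w j)%:C * K - G (candidate R Q ci) 0 0) (G (candidate R Q ci) 0 0).
  rewrite subrK cwK cmodB => h1.
  have h2 : w j * (1 / 2) <= w j * cmod K by rewrite ler_wpM2l// ltW.
  have := wj j; move: h h1 h2; lra.
have [p pc ns] := comp cntk ci ciQ acc'.
pose p' := Ordinal pc.
have [i h] := gap _ _ (jf p').
apply: (negP ns); apply/apartP; exists i.
have h1 := fP p' i; have h2 := cP i.
have := sdist_tri (candidate R Q (pick p') i) (loc (f p') i) (loc j i).
have := sdist_tri (candidate R Q ci i) (candidate R Q (pick p') i) (loc j i).
rewrite [sdist (candidate R Q ci i - loc _ _)]sdistB.
rewrite [sdist (candidate R Q (pick p') i - candidate _ _ _ _)]sdistB /=.
by move: rho_ge0; lra.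
Qed.

End Estimate.

Local Close Scope complex_scope.

(** * Concentration jointly with the coins *)

Section Chernoff.
Variable R : realType.

(* [expR (- x) >= 1 - x] and [(1 - x) * (1 + x + 2 * x ^ 2) >= 1]. *)
Lemma expR_le_quad (x : R) : x <= 1 / 2 -> expR x <= 1 + x + 2 * x ^+ 2.
Proof.
move=> x1; have h := expR_ge1Dx (- x); have x0 : 0 < 1 - x by lra.
have e0 := expR_gt0 x; rewrite -(ler_pM2l x0).
have : (1 - x) * expR x <= 1.
  by rewrite -[leRHS](expRxMexpNx_1 x) [leRHS]mulrC ler_pM2r.
have : 1 <= (1 - x) * (1 + x + 2 * x ^+ 2).
  have -> : (1 - x) * (1 + x + 2 * x ^+ 2) = 1 + x ^+ 2 * (1 - 2 * x) by ring.
  by rewrite lerDl mulr_ge0 ?sqr_ge0//; lra.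
lra.
Qed.

(** Exponential moments with parameter [lam = eta / 16]: as [|lam * z| <= 2 * lam <= 1/2] and [z] is
    centered, one factor is at most [1 + 2 * (2 * lam) ^ 2 = 1 + eta ^ 2 / 32]. The exponent is then
    [n * eta ^ 2 / 32 - n * eta ^ 2 / 16]. *)
Lemma chernoff_finite (I : finType) (n : nat) (p z : I -> R) (eta : R) :
  (forall a, 0 <= p a) -> \sum_a p a = 1 -> \sum_a p a * z a = 0 ->
  (forall a, `|z a| <= 2) -> 0 <= eta <= 4 ->
  \sum_(s : {ffun 'I_n -> I} | n%:R * eta <= \sum_i z (s i)) \prod_i p (s i) <=
  expR (- (n%:R * (eta ^+ 2 / 32))).
Proof.
move=> p0 p1 pz z2 /andP[e0 e4]; pose lam := eta / 16.
apply: (@le_trans _ _ (\sum_(s : {ffun 'I_n -> I})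
    expR (- (lam * (n%:R * eta))) * \prod_i (p (s i) * expR (lam * z (s i))))).
  rewrite [leRHS](bigID (fun s : {ffun 'I_n -> I} => n%:R * eta <= \sum_i z (s i)))/=.
  rewrite -[leLHS]addr0 lerD//; last first.
    apply: sumr_ge0 => s _; rewrite mulr_ge0 ?expR_ge0// prodr_ge0// => i _.
    by rewrite mulr_ge0 ?expR_ge0.
  apply: ler_sum => s sP; rewrite big_split /= mulrCA -[leLHS]mulr1.
  rewrite ler_wpM2l ?prodr_ge0// -expR_sum -expRD -[leLHS]expR0 ler_expR.
  rewrite -mulr_sumr addrC subr_ge0 ler_wpM2l//; rewrite /lam; lra.
rewrite -mulr_sumr.
have -> : \sum_(s : {ffun 'I_n -> I}) \prod_i (p (s i) * expR (lam * z (s i))) =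
    (\sum_a p a * expR (lam * z a)) ^+ n.
  rewrite -(bigA_distr_bigA (fun _ a => p a * expR (lam * z a))).
  by rewrite prodr_const card_ord.
have h : \sum_a p a * expR (lam * z a) <= expR (eta ^+ 2 / 32).
  apply: (@le_trans _ _ (\sum_a p a * (1 + lam * z a + 2 * (lam * 2) ^+ 2))).
    apply: ler_sum => a _; rewrite ler_wpM2l//.
    have za : `|lam * z a| <= lam * 2 by rewrite normrM ger0_norm ?ler_wpM2l// /lam; lra.
    apply: le_trans (expR_le_quad _) _.
      by apply: le_trans (ler_norm _) (le_trans za _); rewrite /lam; lra.
    rewrite lerD2l ler_wpM2l// -[leLHS]real_normK ?num_real//.
    by rewrite ler_pXn2r ?nnegrE// /lam; lra.
  have -> : \sum_a p a * (1 + lam * z a + 2 * (lam * 2) ^+ 2) =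
     \sum_a p a + lam * (\sum_a p a * z a) + 2 * (lam * 2) ^+ 2 * \sum_a p a.
    rewrite !mulr_sumr -!big_split /=; apply: eq_bigr => a _; ring.
  rewrite p1 pz mulr0 addr0 mulr1; apply: le_trans (expR_ge1Dx _).
  by rewrite lerD2l /lam; nra.
have h0 : 0 <= \sum_a p a * expR (lam * z a).
  by apply: sumr_ge0 => a _; rewrite mulr_ge0 ?expR_ge0.
apply: (@le_trans _ _ (expR (- (lam * (n%:R * eta))) * expR (eta ^+ 2 / 32) ^+ n)).
  by rewrite ler_wpM2l ?expR_ge0// lerXn2r// nnegrE expR_ge0.
rewrite -expRM_natl -expRD ler_expR /lam le_eqVlt; apply/orP; left; apply/eqP; by field.
Qed.

End Chernoff.

Section FiniteUnions.
Variables (R : realType) (disp : measure_display) (Omega : measurableType disp).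
Variable P : probability Omega R.
Local Notation pr A := (fine (P A)).

Lemma fine_prK A : measurable A -> (pr A)%:E = P A.
Proof. by move=> mA; rewrite fineK// fin_num_measure. Qed.

Lemma pr_ge0 A : 0 <= pr A. Proof. by rewrite fine_ge0. Qed.

Lemma pr_le A B : measurable A -> measurable B -> A `<=` B -> pr A <= pr B.
Proof. by move=> mA mB AB; rewrite -lee_fin !fine_prK// le_measure ?inE. Qed.

Lemma pr_setC A : measurable A -> pr (~` A) = 1 - pr A.
Proof.
move=> mA; apply: EFin_inj; rewrite fine_prK; last exact: measurableC.
by rewrite probability_setC// -[in LHS](fine_prK mA).
Qed.

Definition some_of (I : finType) (C : pred I) (E : I -> set Omega) : set Omega :=
  [set x | exists2 i, C i & E i x].

Lemma some_of_bigsetU (I : finType) (C : pred I) (E : I -> set Omega) :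
  some_of C E = \big[setU/set0]_(i | C i) E i.
Proof.
apply/seteqP; split=> x.
  by move=> [i Ci Ei]; rewrite (bigD1 i)//=; left.
by elim/big_ind: _ => // [A B hA hB [/hA|/hB]//|i Ci Ei]; exists i.
Qed.

Lemma measurable_some_of (I : finType) (C : pred I) (E : I -> set Omega) :
  (forall i, measurable (E i)) -> measurable (some_of C E).
Proof. by move=> mE; rewrite some_of_bigsetU; apply: bigsetU_measurable. Qed.

Lemma pr_some_of_le (I : finType) (C : pred I) (E : I -> set Omega) :
  (forall i, measurable (E i)) -> pr (some_of C E) <= \sum_(i | C i) pr (E i).
Proof.
move=> mE; rewrite some_of_bigsetU.
suff [] : measurable (\big[setU/set0]_(i | C i) E i) /\
  pr (\big[setU/set0]_(i | C i) E i) <= \sum_(i | C i) pr (E i) by [].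
elim/big_rec2: _ => [|i A B Ci [mA h]]; first by rewrite measure0.
split; first exact: measurableU.
rewrite -lee_fin fine_prK; last exact: measurableU.
apply: le_trans (measureU2 P (mE i) mA) _.
by rewrite -[X in (X + _ <= _)%E](fine_prK (mE i)) -[X in (_ + X <= _)%E](fine_prK mA) -EFinD lee_fin lerD2l.
Qed.

End FiniteUnions.

(** * Approximation of a bounded function by its levels *)

Section Discretization.
Variables (R : realType) (disp : measure_display) (T : measurableType disp).
Variable D : probability T R.
Local Notation pr A := (fine (D A)).

Lemma integrable_bounded (f : T -> R) (b : R) : measurable_fun setT f ->
  (forall x, `|f x| <= b) -> D.-integrable setT (EFin \o f).
Proof.
move=> mf fb; apply: measurable_bounded_integrable => //.
  by rewrite (le_lt_trans (probability_le1 D _))// ltry.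
exists b; split; first exact: num_real.
by move=> y yb x _; apply: le_trans (fb x) (ltW yb).
Qed.

Lemma Rintegral_cst1 (c : R) : Rintegral D setT (fun=> c) = c.
Proof.
rewrite Rintegral_cst// -[RHS]mulr1; congr (_ * _).
exact: (congr1 fine (probability_setT D)).
Qed.

Lemma Rintegral_indic_sum (I : finType) (c : I -> R) (A : I -> set T) :
  (forall i, measurable (A i)) ->
  Rintegral D setT (fun x => \sum_i c i * \1_(A i) x) = \sum_i c i * pr (A i).
Proof.
move=> mA.
have mI i : measurable_fun setT (\1_(A i) : T -> R) by exact: measurable_realfun.measurable_indic.
have bI i x : `|(\1_(A i) x : R)| <= 1.
  by rewrite indicE; case: (_ \in _); rewrite ?normr1 ?normr0.
have iI i : D.-integrable setT (EFin \o (\1_(A i) : T -> R)).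
  exact: (integrable_bounded (mI i) (bI i)).
have icI i : D.-integrable setT (EFin \o (fun x => c i * \1_(A i) x)).
  apply: (@integrable_bounded _ `|c i|); first by apply: measurable_funM.
  by move=> x; rewrite normrM ler_piMr.
elim: (index_enum I) => [|i r IH].
  rewrite big_nil; under eq_Rintegral do rewrite big_nil.
  by rewrite Rintegral_cst1.
rewrite big_cons; under eq_Rintegral do rewrite big_cons.
rewrite RintegralD//; last first.
  apply: (@integrable_bounded _ (\sum_(j <- r) `|c j|)).
    by apply: measurable_sum => j; apply: measurable_funM.
  move=> x; apply: le_trans (ler_norm_sum _ _ _) _; apply: ler_sum => j _.
  by rewrite normrM ler_piMr.
rewrite IH RintegralZl//; congr (_ * _ + _).
by rewrite /Rintegral integral_indic// setIT.
Qed.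

Variables (K : nat) (h : T -> R).
Hypotheses (K_gt0 : (0 < K)%N) (mh : measurable_fun setT h).
Hypothesis h_le1 : forall x, `|h x| <= 1.

(** The interval [[-1, 1]] is cut into levels of width [2 / K]. The indices run up to [K] included,
    the last level being needed for the value 1. *)
Definition level_set (a : nat) : set T :=
  [set x | a%:R <= (h x + 1) * K%:R / 2 < a.+1%:R].
Definition level_val (a : nat) : R := 2 * a%:R / K%:R - 1.

Lemma measurable_level_set a : measurable (level_set a).
Proof.
have mf : measurable_fun setT (fun x => (h x + 1) * K%:R / 2).
  by apply: measurable_funM => //; apply: measurable_funM => //; apply: measurable_funD.
rewrite -[level_set a]setTI.
have -> : level_set a = (fun x => (h x + 1) * K%:R / 2) @^-1` `[a%:R, a.+1%:R[.
  by apply/seteqP; split=> x; rewrite /level_set /= in_itv.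
exact: mf.
Qed.

Lemma level_set_ex x : exists a : 'I_K.+1, level_set a x.
Proof.
have K0 : 0 < K%:R :> R by rewrite ltr0n.
have := h_le1 x; rewrite ler_norml => /andP[h1 h2].
have y0 : 0 <= (h x + 1) * K%:R / 2 by rewrite divr_ge0// mulr_ge0// ?(ltW K0)//; lra.
have := Num.Theory.truncn_itv y0; set a := Num.truncn _ => ha.
have aK : (a < K.+1)%N.
  rewrite Num.Theory.truncn_lt_nat// -[K.+1%:R]natr1.
  have : (h x + 1) * K%:R <= 2 * K%:R by rewrite ler_wpM2r// ?(ltW K0)//; lra.
  by lra.
by exists (Ordinal aK).
Qed.

Lemma level_val_le x (a : nat) : level_set a x ->
  level_val a <= h x <= level_val a + 2 / K%:R.
Proof.
have K0 : 0 < K%:R :> R by rewrite ltr0n.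
rewrite /level_set /level_val /= -[a.+1%:R]natr1 => /andP[h1 h2].
have -> : h x = (h x + 1) * K%:R / 2 * (2 / K%:R) - 1 by field; rewrite gt_eqF.
have -> : 2 * a%:R / K%:R - 1 + 2 / K%:R = (a%:R + 1) * (2 / K%:R) - 1 :> R.
  by field; rewrite gt_eqF.
have -> : 2 * a%:R / K%:R - 1 = a%:R * (2 / K%:R) - 1 :> R by field; rewrite gt_eqF.
by rewrite !lerD2r !ler_pM2r ?divr_gt0// h1 ltW.
Qed.

Lemma level_set_uniq x (a b : nat) : level_set a x -> level_set b x -> a = b.
Proof.
rewrite /level_set /= => /andP[a1 a2] /andP[b1 b2].
have := le_lt_trans a1 b2; have := le_lt_trans b1 a2; rewrite !ltr_nat; lia.
Qed.

Lemma sum_level_indic x (c : 'I_K.+1 -> R) (a : 'I_K.+1) : level_set a x ->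
  \sum_b c b * \1_(level_set b) x = c a.
Proof.
move=> ax; rewrite (bigD1 a)//= big1 ?addr0; last first.
  move=> b ba; rewrite indicE memNset ?mulr0// => bx.
  by move/eqP: ba; apply; apply/val_inj; exact: level_set_uniq bx ax.
by rewrite indicE mem_set// mulr1.
Qed.

Lemma sum_pr_level_set : \sum_(a < K.+1) pr (level_set a) = 1.
Proof.
have := @Rintegral_indic_sum 'I_K.+1 (fun=> 1) level_set (fun a => measurable_level_set a).
rewrite (_ : (fun x => _) = fun=> 1); last first.
  apply: funext => x; have [a ax] := level_set_ex x.
  exact: (@sum_level_indic x (fun=> 1) a ax).
rewrite Rintegral_cst1 => ->; apply: eq_bigr => a _; by rewrite mul1r.
Qed.

Lemma Rintegral_level m :
  m = \sum_(a < K.+1) level_val a * pr (level_set a) ->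
  m <= Rintegral D setT h <= m + 2 / K%:R.
Proof.
move=> mdef; have K0 : 0 < K%:R :> R by rewrite ltr0n.
pose s x : R := \sum_(a < K.+1) level_val a * \1_(level_set a) x.
have sE x : exists2 a : 'I_K.+1, level_set a x & s x = level_val a.
  have [a ax] := level_set_ex x; exists a => //.
  exact: (@sum_level_indic x (fun a => level_val a) a ax).
have mE : Rintegral D setT s = m.
  rewrite mdef.
  exact: (@Rintegral_indic_sum 'I_K.+1 (fun a => level_val a) (fun a => level_set a)
    (fun a => measurable_level_set a)).
have ms : measurable_fun setT s.
  apply: measurable_sum => a; apply: measurable_funM => //; apply: measurable_realfun.measurable_indic.
  exact: measurable_level_set.
have sb x : `|s x| <= 1 + 2 / K%:R.
  have [a ax ->] := sE x; have /andP[h1 h2] := level_val_le ax.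
  have := h_le1 x; rewrite !ler_norml => /andP[h3 h4].
  have : 0 < 2 / K%:R :> R by rewrite divr_gt0.
  by move=> h5; apply/andP; split; lra.
have is' : D.-integrable setT (EFin \o s) := integrable_bounded ms sb.
have ih : D.-integrable setT (EFin \o h) := integrable_bounded mh h_le1.
rewrite -mE; apply/andP; split.
  apply: le_Rintegral => // x _.
  have [a ax e] := sE x; have /andP[h1 h2] := level_val_le ax.
  by rewrite -e in h1; exact: h1.
have ic : D.-integrable setT (EFin \o (fun=> 2 / K%:R : R)).
  by apply: (@integrable_bounded _ `|2 / K%:R|).
have -> : Rintegral D setT s + 2 / K%:R = Rintegral D setT (fun x => s x + 2 / K%:R).
  by rewrite RintegralD// Rintegral_cst1.
apply: le_Rintegral => //.
  apply: (@integrable_bounded _ (1 + 2 / K%:R + 2 / K%:R)).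
    exact: measurable_funD.
  move=> x; apply: le_trans (ler_normD _ _) _; apply: lerD => //.
  by rewrite ger0_norm// divr_ge0.
move=> x _; have [a ax e] := sE x; have /andP[h1 h2] := level_val_le ax.
by rewrite -e in h2; exact: h2.
Qed.

End Discretization.

(** * Deviation of empirical means on a fixed coin pattern *)

Section Concentration.
Variables (R : realType) (d k n N : nat) (D : probability (d.-tuple R) R).
Variables (w : 'I_k -> R) (mu : 'I_k -> d.-tuple R).
Variables (disp : measure_display) (Omega : measurableType disp).
Variable P : probability Omega R.
Variables (X : 'I_n -> {RV P >-> d.-tuple R}) (U : nat -> {RV P >-> R}).
Hypothesis w_ge0 : forall j, 0 <= w j.
Hypothesis sum_w : \sum_(j < k) w j = 1.
Hypothesis XU : iid_samples_and_coins (mixture D w mu) X U.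
Local Notation pr A := (fine (P A)).

Definition half (c : bool) : set R := [set x | (x < 1 / 2) = c].

Lemma measurable_half c : measurable (half c).
Proof.
have mlt : measurable [set x : R | x < 1 / 2].
  have -> : [set x : R | x < 1 / 2] = `]-oo, (1 / 2)[%classic.
    by apply/seteqP; split=> x; rewrite /= in_itv.
  exact: measurable_itv.
case: c; rewrite /half.
  by rewrite (_ : [set _ | _] = [set x : R | x < 1 / 2])//; apply/seteqP; split.
rewrite (_ : [set _ | _] = ~` [set x : R | x < 1 / 2]); first exact: measurableC.
by apply/seteqP; split=> x /=; case: (_ < _).
Qed.

Lemma uniform_half c : uniform_prob (@ltr01 R) (half c) = (1 / 2 : R)%:E.
Proof.
have half_true : uniform_prob (@ltr01 R) (half true) = (1 / 2 : R)%:E.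
  rewrite /uniform_prob integral_uniform_pdf.
  have -> : half true `&` `[0, 1]%classic = `[0, 1 / 2[%classic :> set R.
    apply/seteqP; split=> x; rewrite /half /= !in_itv /=.
      by move=> [-> /andP[-> _]].
    move=> /andP[x0 x1]; split; first exact: x1.
    by rewrite x0 /=; lra.
  rewrite (eq_integral (fun=> 1%:E)); last first.
    move=> x; rewrite inE /= in_itv /= /uniform_pdf => /andP[x0 x1].
    by rewrite x0 /= ifT ?subr0 ?invr1//; lra.
  rewrite integral_cst//= lebesgue_measure_itv /= lte_fin.
  by rewrite divr_gt0// mul1e oppr0 addr0.
case: c => //; have -> : half false = ~` half true.
  by apply/seteqP; split=> x; rewrite /half /=; case: (_ < _).
rewrite probability_setC; last exact: measurable_half.
transitivity ((1 : R)%:E - (1 / 2)%:E)%E; first by congr (_ - _)%E.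
by rewrite -EFinB; congr EFin; lra.
Qed.

Definition coin_event (b : 'I_N -> bool) : set Omega :=
  [set x | forall l : 'I_N, half (b l) (U l x)].

Lemma measurable_preX (i : 'I_n) A : measurable A -> measurable (X i @^-1` A).
Proof. by move=> mA; rewrite -[_ @^-1` _]setTI; apply: measurable_funP. Qed.

Lemma measurable_preU l A : measurable A -> measurable (U l @^-1` A).
Proof. by move=> mA; rewrite -[_ @^-1` _]setTI; apply: measurable_funP. Qed.

(** Mutual independence is stated for finite families of events, so product events are what can be
    evaluated directly. Prescribing the first [N] coins costs the factor [2 ^ - N]. *)
Lemma pr_joint (A : 'I_n -> set (d.-tuple R)) (b : 'I_N -> bool) :
  (forall i, measurable (A i)) ->
  measurable ([set x | forall i, A i (X i x)] `&` coin_event b) /\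
  pr ([set x | forall i, A i (X i x)] `&` coin_event b) =
  (\prod_i pr (X i @^-1` A i)) * 2 ^- N.
Proof.
move=> mA; have [XM UM ind] := XU.
pose J : seq ('I_n + nat) := [seq inl i | i <- enum 'I_n] ++ [seq inr l | l <- iota 0 N].
pose b' l := if insub l is Some l' then b l' else true.
pose E (z : 'I_n + nat) := match z with inl i => X i @^-1` A i | inr l => U l @^-1` half (b' l) end.
have bE (l : 'I_N) : b' l = b l by rewrite /b' valK.
have JE : \bigcap_(z in [set` J]) E z = [set x | forall i, A i (X i x)] `&` coin_event b.
  apply/seteqP; split=> x.
    move=> h; split=> [i|l].
      by apply: (h (inl i)); rewrite /= mem_cat map_f ?mem_enum.
    rewrite -bE; apply: (h (inr (l : nat))).
    by rewrite /= mem_cat; apply/orP; right; apply: map_f; rewrite mem_iota add0n /=.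
  move=> [hA hb] z; rewrite /= mem_cat => /orP[] /mapP[y yJ ->]; first exact: hA.
  move: yJ; rewrite mem_iota add0n => /= yN.
  by have := hb (Ordinal yN); rewrite -bE.
have mE z : measurable (E z).
  case: z => [i|l]; [exact: measurable_preX|apply: measurable_preU; exact: measurable_half].
split; first by rewrite -JE; apply: fin_bigcap_measurable => [|z _]; [exact: finite_seq|exact: mE].
rewrite -JE ind; first last.
- move=> [i|l] _ /=; first by exists (A i).
  by exists (half (b' l)) => //; exact: measurable_half.
- rewrite cat_uniq; apply/and3P; split.
  + by rewrite map_inj_uniq ?enum_uniq// => i j [].
  + by apply/hasPn => z /mapP[l _ ->]; apply/negP => /mapP[].
  + by rewrite map_inj_uniq ?iota_uniq// => i j [].
rewrite big_cat big_map big_enum /= big_map; congr (_ * _).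
under eq_bigr => l _.
  rewrite (_ : fine _ = 2^-1); last first.
    have := UM l (half (b' l)) (measurable_half _).
    by rewrite /distribution /pushforward uniform_half => ->; rewrite /= div1r.
  over.
by rewrite big_const_seq count_predT size_iota iter_mulr_1 exprVn.
Qed.

Lemma measurable_shift (v : d.-tuple R) :
  measurable_fun setT (fun x : d.-tuple R => vadd x v).
Proof.
apply/measurable_fun_tnthP => i.
have -> : (@tnth d R)^~ i \o (fun x => vadd x v) = fun x => tnth x i + tnth v i.
  by apply: funext => x /=; rewrite tnth_mktuple.
by apply: measurable_funD => //; exact: measurable_tnth.
Qed.

Lemma pr_sample i A : measurable A ->
  pr (X i @^-1` A) = \sum_j w j * fine (D ((fun x => vadd x (mu j)) @^-1` A)).
Proof.
move=> mA; have [XM _ _] := XU.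
have := XM i A mA; rewrite /distribution /pushforward => ->.
rewrite /mixture (_ : (\sum_(j < k) _)%E =
  (\sum_j w j * fine (D ((fun x => vadd x (mu j)) @^-1` A)))%:E)//.
rewrite -sumEFin; apply: eq_bigr => j _; rewrite /translate /pushforward EFinM.
congr (_ * _)%E; rewrite fine_prK//.
by rewrite -[_ @^-1` _]setTI; exact: measurable_shift.
Qed.

Variable h : d.-tuple R -> R.
Hypotheses (mh : measurable_fun setT h) (h_le1 : forall x, `|h x| <= 1).

Definition mix_mean : R :=
  \sum_j w j * Rintegral D setT (fun x => h (vadd x (mu j))).

Definition dev_event (eta : R) : set Omega :=
  [set x | eta < `|(\sum_i h (X i x)) / n%:R - mix_mean|].

Lemma measurable_dev_event eta : measurable (dev_event eta).
Proof.
have ms : measurable_fun setT (fun x => `|(\sum_i h (X i x)) / n%:R - mix_mean|).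
  apply: measurableT_comp => //; apply: measurable_funB => //.
  apply: measurable_funM => //; apply: measurable_sum => i.
  by apply: measurableT_comp.
rewrite -[dev_event eta]setTI.
have -> : dev_event eta =
    (fun x => `|(\sum_i h (X i x)) / n%:R - mix_mean|) @^-1` `]eta, +oo[%classic.
  by apply/seteqP; split=> x; rewrite /dev_event /= in_itv /= andbT.
by apply: ms.
Qed.

(* The frequencies depend on the coins, so the deviation is bounded jointly with
   each coin pattern.  Replacing [h] by a simple function turns the event into a
   finite union of product events, to which [pr_joint] applies. *)
Lemma pr_dev_le (b : 'I_N -> bool) (eta : R) : (0 < n)%N -> 0 < eta <= 1 ->
  pr (dev_event eta `&` coin_event b) <=
  2 * expR (- (n%:R * (eta ^+ 2 / 128))) * 2 ^- N.
Proof.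
move=> n0 /andP[e0 e1].
(* Levels of width at most [eta / 2] leave a deviation of [eta / 2] for the discretized sum; this
   turns the exponent [eta ^ 2 / 32] into [eta ^ 2 / 128]. *)
pose K := (Num.truncn (4 / eta)).+1.
have K0 : 0 < K%:R :> R by rewrite ltr0n.
have Ke : 2 / K%:R <= eta / 2.
  rewrite ler_pdivrMr//; have h0 : 0 <= 4 / eta by rewrite divr_ge0// ltW.
  have /andP[_ h2] := Num.Theory.truncn_itv h0.
  by move: h2; rewrite -/K ltr_pdivrMr// => h2; lra.
pose hj j x := h (vadd x (mu j)).
have mhj j : measurable_fun setT (hj j) by apply: measurableT_comp => //; exact: measurable_shift.
have hj1 j x : `|hj j x| <= 1 by exact: h_le1.
pose p (a : 'I_K.+1) := \sum_j w j * fine (D (level_set K (hj j) a)).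
have p0 a : 0 <= p a by apply: sumr_ge0 => j _; rewrite mulr_ge0// pr_ge0.
have p1 : \sum_a p a = 1.
  rewrite exchange_big -[RHS]sum_w; apply: eq_bigr => j _ /=.
  by rewrite -mulr_sumr sum_pr_level_set// mulr1.
pose mt := \sum_a p a * level_val R K a.
have mtE : mt = \sum_j w j * \sum_(a < K.+1) level_val R K a * fine (D (level_set K (hj j) a)).
  rewrite /mt /p; under eq_bigr do rewrite mulr_suml.
  rewrite exchange_big; apply: eq_bigr => j _ /=; rewrite mulr_sumr.
  by apply: eq_bigr => a _; ring.
have /andP[mt1 mt2] : mt <= mix_mean <= mt + 2 / K%:R.
  apply/andP; split.
    rewrite mtE; apply: ler_sum => j _; rewrite ler_wpM2l//.
    by have /andP[] := @Rintegral_level _ _ _ D K (hj j) isT (mhj j) (hj1 j) _ erefl.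
  have -> : mt + 2 / K%:R = \sum_j w j * (\sum_(a < K.+1) level_val R K a *
       fine (D (level_set K (hj j) a)) + 2 / K%:R).
    rewrite mtE; under [RHS]eq_bigr do rewrite mulrDr.
    by rewrite big_split /= -[in RHS]mulr_suml sum_w mul1r.
  apply: ler_sum => j _; rewrite ler_wpM2l//.
  by have /andP[] := @Rintegral_level _ _ _ D K (hj j) isT (mhj j) (hj1 j) _ erefl.
have pS i (a : 'I_K.+1) : pr (X i @^-1` level_set K h a) = p a.
  rewrite pr_sample; last exact: measurable_level_set.
  by [].
pose cellE (s : {ffun 'I_n -> 'I_K.+1}) :=
  [set x | forall i, level_set K h (s i) (X i x)] `&` coin_event b.
have mcell s : measurable (cellE s).
  by have [] := @pr_joint (fun i => level_set K h (s i)) b (fun i => measurable_level_set K mh _).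
have pcell s : pr (cellE s) = \prod_i p (s i) * 2 ^- N.
  have [_ ->] := @pr_joint (fun i => level_set K h (s i)) b (fun i => measurable_level_set K mh _).
  by congr (_ * _); apply: eq_bigr => i _; rewrite pS.
pose z (a : 'I_K.+1) := level_val R K a - mt.
have lv1 (a : 'I_K.+1) : -1 <= level_val R K a <= 1.
  rewrite /level_val; have aK : a%:R <= K%:R :> R by rewrite ler_nat -ltnS.
  have g0 : 0 <= 2 * a%:R / K%:R :> R by rewrite divr_ge0// mulr_ge0.
  have g2 : 2 * a%:R / K%:R <= 2 :> R by rewrite ler_pdivrMr// ler_wpM2l.
  by apply/andP; split; lra.
have mtb : -1 <= mt <= 1.
  apply/andP; split.
    apply: (@le_trans _ _ (\sum_a p a * (-1))); first by rewrite -mulr_suml p1 mul1r.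
    by apply: ler_sum => a _; rewrite ler_wpM2l//; have /andP[] := lv1 a.
  apply: (@le_trans _ _ (\sum_a p a * 1)); last by rewrite -mulr_suml p1 mul1r.
  by apply: ler_sum => a _; rewrite ler_wpM2l//; have /andP[] := lv1 a.
have z2 a : `|z a| <= 2.
  by rewrite ler_norml /z; have /andP[? ?] := lv1 a; move: mtb => /andP[? ?]; apply/andP; split; lra.
have pz : \sum_a p a * z a = 0.
  under eq_bigr do rewrite mulrBr.
  by rewrite sumrB -mulr_suml p1 mul1r subrr.
have eta4 : 0 <= eta / 2 <= 4 by apply/andP; split; lra.
pose up (s : {ffun 'I_n -> 'I_K.+1}) := n%:R * (eta / 2) <= \sum_i z (s i).
pose dn (s : {ffun 'I_n -> 'I_K.+1}) := n%:R * (eta / 2) <= \sum_i - z (s i).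
have bound (C : pred {ffun 'I_n -> 'I_K.+1}) :
   \sum_(s | C s) \prod_i p (s i) <= expR (- (n%:R * ((eta / 2) ^+ 2 / 32))) ->
   pr (some_of C cellE) <= expR (- (n%:R * (eta ^+ 2 / 128))) * 2 ^- N.
  move=> hC; apply: le_trans (pr_some_of_le P C mcell) _.
  under eq_bigr do rewrite pcell.
  rewrite -mulr_suml ler_wpM2r ?invr_ge0 ?exprn_ge0//.
  by apply: le_trans hC _; rewrite ler_expR le_eqVlt; apply/orP; left; apply/eqP; field.
have hup : pr (some_of up cellE) <= expR (- (n%:R * (eta ^+ 2 / 128))) * 2 ^- N.
  by apply: bound; apply: chernoff_finite.
have hdn : pr (some_of dn cellE) <= expR (- (n%:R * (eta ^+ 2 / 128))) * 2 ^- N.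
  apply: bound; apply: (@chernoff_finite _ _ n p (fun a => - z a)) => //.
    by under eq_bigr do rewrite mulrN; rewrite sumrN pz oppr0.
  by move=> a; rewrite normrN.
have mC := measurable_some_of xpredT mcell.
have mco : measurable (coin_event b).
  rewrite (_ : coin_event b = some_of xpredT cellE)//.
  apply/seteqP; split=> x; last by move=> [s _ []].
  move=> cb; have /choice[s sP] i := level_set_ex (isT : (0 < K)%N) h_le1 (X i x).
  by exists [ffun i => s i] => //; split=> // i; rewrite ffunE.
have mU : measurable (some_of up cellE `|` some_of dn cellE).
  by apply: measurableU; exact: measurable_some_of.
apply: (@le_trans _ _ (pr (some_of up cellE `|` some_of dn cellE))).
  apply: pr_le => //.
    by apply: measurableI => //; exact: measurable_dev_event.
  move=> x [dev cb].
  have /choice[s sP] i := level_set_ex (isT : (0 < K)%N) h_le1 (X i x).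
  have cx : cellE [ffun i => s i] x by split=> // i; rewrite ffunE.
  have nR : 0 < n%:R :> R by rewrite ltr0n.
  have sumE : \sum_i z ([ffun i => s i] i) = \sum_i level_val R K (s i) - n%:R * mt.
    rewrite /z sumrB; congr (_ - _); first by apply: eq_bigr => i _; rewrite ffunE.
    by rewrite sumr_const card_ord mulr_natl.
  have s1 : \sum_i level_val R K (s i) <= \sum_i h (X i x).
    by apply: ler_sum => i _; have /andP[] := level_val_le (isT : (0 < K)%N) (sP i).
  have s2 : \sum_i h (X i x) <= \sum_i level_val R K (s i) + n%:R * (2 / K%:R).
    have -> : n%:R * (2 / K%:R) = \sum_(i < n) (2 / K%:R) :> R.
      by rewrite sumr_const card_ord mulr_natl.
    rewrite -big_split; apply: ler_sum => i _ /=.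
    by have /andP[] := level_val_le (isT : (0 < K)%N) (sP i).
  have nK : n%:R * (2 / K%:R) <= n%:R * (eta / 2) by rewrite ler_pM2l.
  move: dev; rewrite /dev_event /= ltr_normr => /orP[] dev.
    left; exists [ffun i => s i] => //; rewrite /up sumE.
    move: dev; rewrite ltrBrDr ltr_pdivlMr// => dev.
    have : mt * n%:R <= mix_mean * n%:R by rewrite ler_pM2r.
    lra.
  right; exists [ffun i => s i] => //; rewrite /dn sumrN sumE.
  move: dev; rewrite opprB ltrBrDr -ltrBrDl ltr_pdivrMr// => dev.
  have : mix_mean * n%:R <= (mt + 2 / K%:R) * n%:R by rewrite ler_pM2r.
  lra.
rewrite -lee_fin fine_prK//; apply: le_trans (measureU2 P _ _) _; try exact: measurable_some_of.
rewrite -[X in (X + _ <= _)%E]fine_prK; last exact: measurable_some_of.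
rewrite -[X in (_ + X <= _)%E]fine_prK; last exact: measurable_some_of.
by rewrite -EFinD lee_fin; lra.
Qed.

End Concentration.

(** * Random directions separate the means *)

(** Overwriting the bits in [S] of members of [E] in all ways never yields the same pattern twice:
    the bits outside [S] recover the member by rigidity, those inside recover the overwriting. *)
Lemma card_rigid (I : finType) (S : {set I}) (E : {set {ffun I -> bool}}) :
  (forall b b', b \in E -> b' \in E -> (forall i, i \notin S -> b i = b' i) -> b = b') ->
  (#|E| * 2 ^ #|S| <= 2 ^ #|I|)%N.
Proof.
move=> rigid.
pose f (x : {ffun I -> bool} * {set I}) : {ffun I -> bool} :=
  [ffun i => if i \in S then i \in x.2 else x.1 i].
have -> : (2 ^ #|I| = #|{ffun I -> bool}|)%N by rewrite card_ffun card_bool.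
rewrite -card_powerset -cardsX -(@card_in_imset _ _ f); first exact: max_card.
move=> [b A] [b' A']; rewrite !inE /= => /andP[bE AS] /andP[b'E A'S] /ffunP e.
have -> : b = b'.
  by apply: rigid => // i iS; have := e i; rewrite !ffunE (negbTE iS).
congr pair; apply/setP => i; have := e i; rewrite !ffunE.
case: ifPn => [//|iS _].
by rewrite (contraNF (fintype.subsetP AS i) iS) (contraNF (fintype.subsetP A'S i) iS).
Qed.

Lemma binary_lt (r : nat) (e : nat -> bool) : (\sum_(q < r) e q * 2 ^ q < 2 ^ r)%N.
Proof.
elim: r => [|r IH]; first by rewrite big_ord0.
rewrite big_ord_recr /= expnS; have : (e r * 2 ^ r <= 2 ^ r)%N by case: (e r); lia.
by move: IH; set a := (e r * _)%N; set z := bigop _ _ _; set t := (2 ^ r)%N; lia.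
Qed.

Lemma binary_inj (r : nat) (e e' : nat -> bool) :
  (\sum_(q < r) e q * 2 ^ q = \sum_(q < r) e' q * 2 ^ q)%N ->
  forall q, (q < r)%N -> e q = e' q.
Proof.
elim: r => // r IH; rewrite !big_ord_recr /= => h q.
have l1 := binary_lt r e; have l2 := binary_lt r e'.
have er : e r = e' r.
  move: h l1 l2; set z := bigop _ _ _; set z' := bigop _ _ _; set t := (2 ^ r)%N.
  by case: (e r); case: (e' r) => //=; rewrite ?mul1n ?mul0n; lia.
rewrite ltnS leq_eqVlt => /predU1P[->//|qr]; apply: IH => //.
by move: h; rewrite er => /addIn.
Qed.

Section Bits.
Variable R : realType.

Lemma sin_ge_half (x : R) : 0 <= x <= 1 -> x / 2 <= sin x.
Proof.
move=> /andP[x0 x1].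
pose f (z : R) := sin z - z / 2.
have df (z : R) : is_derive z 1 f (cos z - 1 / 2).
  have -> : f = (fun z : R => sin z - 2^-1 *: z) by apply: funext => z'; rewrite /f mulrC.
  have -> : cos z - 1 / 2 = cos z - 2^-1 *: (1 : R) by rewrite div1r /GRing.scale /= mulr1.
  by apply: is_deriveB.
have dfx (z : R) : derivable f z 1 by have [] := df z.
have dE (z : R) : derive1 f z = cos z - 1 / 2 by rewrite derive1E; have [] := df z.
suff : f 0 <= f x by rewrite /f sin0 mul0r subr0 subr_ge0.
apply: (@ger0_derive1_le_cc _ f 0 x) => //=.
- move=> z; rewrite in_itv /= => /andP[z0 zx]; rewrite dE.
  have z2 : z ^+ 2 <= 1 by rewrite expr2; nra.
  by have := cos_ge_quad z; lra.
- by apply: derivable_within_continuous => z _.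
- by rewrite in_itv /= lexx x0.
- by rewrite in_itv /= lexx x0.
Qed.

Lemma sdist_ge (y : R) : `|y| <= 2 -> `|y| / 4 <= sdist y.
Proof.
move=> y2; have -> : sdist y = sdist `|y|.
  by case: (ger0P y) => // _; rewrite sdistN.
have h : 0 <= `|y| / 2 <= 1 by rewrite divr_ge0//=; lra.
have := sin_ge_half h; rewrite /sdist => h1.
by apply: le_trans (ler_norm _); lra.
Qed.

Lemma dyadic_scale (K : nat) (y : R) : 1 / 2 < y -> y <= 2 ^+ K ->
  exists2 b, (b <= K)%N & 1 / 2 < y / 2 ^+ b <= 1.
Proof.
elim: K y => [|K IH] y y1 yK.
  by exists 0%N => //; rewrite expr0 divr1 y1.
have [y_le1|y_gt1] := leP y 1; first by exists 0%N => //; rewrite expr0 divr1 y1.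
have [||b bK h] := IH (y / 2); first by lra.
  by rewrite ler_pdivrMr// mulrC -exprS.
by exists b.+1 => //; rewrite exprS invfM mulrA.
Qed.

(** [gen_dir] as a function of the bits alone: a true bit stands for a coin below 1/2 and
    contributes 0. *)
Definition bit_dir (n : nat) (beta : nat -> bool) (M : R) (start x : nat) : R :=
  \sum_(b < n) if beta (start + (x * n + b))%N then 0 else M / 2 ^+ b.

(** Only the window of [r] positions from [b0] on survives the subtraction, and it is read as an
    [r]-bit integer. The reversal [r - q.+1] makes position [b0] the most significant one; the
    negation enters because a true bit contributes 0. *)
Lemma bit_dir_diff n (beta beta' : nat -> bool) M start x (b0 r : nat) :
  (b0 + r <= n)%N ->
  (forall b, (b < n)%N -> ~~ ((b0 <= b) && (b < b0 + r))%N ->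
     beta (start + (x * n + b))%N = beta' (start + (x * n + b))%N) ->
  let e (g : nat -> bool) q := ~~ g (start + (x * n + (b0 + (r - q.+1))))%N in
  bit_dir n beta M start x - bit_dir n beta' M start x =
  M / 2 ^+ b0 * 2 / 2 ^+ r * ((\sum_(q < r) e beta q * 2 ^ q)%N%:R -
                         (\sum_(q < r) e beta' q * 2 ^ q)%N%:R).
Proof.
move=> brn agree e; rewrite /bit_dir -sumrB.
pose f b : R := (if beta (start + (x * n + b))%N then 0 else M / 2 ^+ b) -
   (if beta' (start + (x * n + b))%N then 0 else M / 2 ^+ b).
rewrite -(big_mkord xpredT f) (big_cat_nat _ (n := b0))//=; last by lia.
rewrite [X in X + _]big_nat_cond big1 ?add0r; last first.
  by move=> b /andP[/andP[_ bb0] _]; rewrite /f agree ?subrr//; lia.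
rewrite (big_cat_nat _ (n := (b0 + r)%N))//=; last by lia.
have -> : \sum_(b0 + r <= b < n) f b = 0.
  rewrite big_nat_cond big1// => b /andP[/andP[bb0 bn] _].
  by rewrite /f agree ?subrr//; lia.
rewrite addr0.
rewrite -{1}[b0]add0n big_addn addKn big_mkord (reindex_inj rev_ord_inj) /=.
rewrite !natr_sum -sumrB mulr_sumr; apply: eq_bigr => q _.
rewrite /f /e [(_ + b0)%N]addnC.
have -> : (b0 + (r - q.+1) = r - q.+1 + b0)%N by rewrite addnC.
have p2 : 2 ^+ (r - q.+1 + b0) = 2 ^+ b0 * 2 ^+ r / 2 / 2 ^+ q :> R.
  have -> : 2 ^+ r = 2 ^+ (r - q.+1) * (2 * 2 ^+ q) :> R.
    by rewrite -exprS -exprD subnK.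
  by rewrite exprD; field; rewrite expf_neq0.
have h2 j : (2 ^+ j != 0 :> R) by rewrite expf_neq0.
rewrite [(r - q.+1 + b0)%N]addnC in p2 *.
rewrite !natrM !natrX p2.
by case: (beta _); case: (beta' _) => /=; field; rewrite !h2.
Qed.

End Bits.

Section BadPatterns.
Variables (R : realType) (d k m n r L t0 : nat) (mu : 'I_k -> d.-tuple R).
Variables (Ms : nat -> R) (rho b_mu gamma : R).
Local Notation block := (m * d * n)%N.
Local Notation N := (n * block)%N.
Hypotheses (tLn : (t0 + L <= n)%N) (rn : (r <= n)%N) (d_gt0 : (0 < d)%N).
Hypothesis gamma_gt0 : 0 < gamma.
Hypothesis mu_le : forall j c, `|tnth (mu j) c| <= b_mu.
Hypothesis gap : forall j j', j != j' ->
  exists c : 'I_d, gamma / d%:R <= `|tnth (mu j) c - tnth (mu j') c|.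
Hypothesis M_ge : forall t, (t < L)%N -> d%:R / gamma <= Ms (t0 + t)%N.
Hypothesis M_le : forall t, (t < L)%N -> Ms (t0 + t)%N * (2 * b_mu) <= 2 ^+ (n - r).
Hypothesis rhoE : rho = 1 / (64 * 2 ^+ r).

Definition coin_bits (b : {ffun 'I_N -> bool}) (l : nat) : bool :=
  if insub l is Some l' then b l' else true.

Definition pattern_dir (b : {ffun 'I_N -> bool}) (t : nat) : nat -> R :=
  bit_dir n (coin_bits b) (Ms (t0 + t)%N) ((t0 + t) * block).

Definition loc_diff (b : {ffun 'I_N -> bool}) (t : nat) (p : 'I_k * 'I_k) (i : nat) : R :=
  dirdot (pattern_dir b t) (mu p.1) i - dirdot (pattern_dir b t) (mu p.2) i.

Definition merged (b : {ffun 'I_N -> bool}) (t : nat) (p : 'I_k * 'I_k) : bool :=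
  (p.1 != p.2) && [forall i : 'I_m, sdist (loc_diff b t p i) <= 6 * rho].

(** Separation supplies a coordinate with gap at least [gamma / d]; a scale of at least [d / gamma]
    lifts it to at least 1, and halving brings it between 1/2 and 1. The upper bound on the scale
    keeps [r] bits available from that position on. *)
Lemma dyadic_coord (t : nat) (p : 'I_k * 'I_k) : (t < L)%N -> p.1 != p.2 ->
  exists (cb : 'I_d * nat), (cb.2 + r <= n)%N /\
    1 / 2 < Ms (t0 + t)%N * `|tnth (mu p.1) cb.1 - tnth (mu p.2) cb.1| / 2 ^+ cb.2 <= 1.
Proof.
move=> tL pp; have [c hc] := gap pp.
set x := `|_| in hc; have d0 : 0 < d%:R :> R by rewrite ltr0n.
have dg : 0 < d%:R / gamma by rewrite divr_gt0.
have M0 : 0 < Ms (t0 + t)%N by apply: lt_le_trans dg (M_ge tL).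
have [||b bK h] := @dyadic_scale R (n - r) (Ms (t0 + t)%N * x).
- have : d%:R / gamma * (gamma / d%:R) <= Ms (t0 + t)%N * x.
    by apply: ler_pM (M_ge tL) hc; rewrite ?divr_ge0// ltW.
  have -> : d%:R / gamma * (gamma / d%:R) = 1 by field; rewrite !gt_eqF.
  by lra.
- apply: le_trans (M_le tL); rewrite ler_wpM2l ?(ltW M0)//.
  by apply: le_trans (ler_normB _ _) _; have := mu_le p.1 c; have := mu_le p.2 c; lra.
by exists (c, b); split=> //=; move: bK rn; lia.
Qed.

Lemma coin_index_inj (t i c q t' i' c' q' : nat) :
  (i < m)%N -> (c < d)%N -> (q < n)%N -> (i' < m)%N -> (c' < d)%N -> (q' < n)%N ->
  (t * block + ((i * d + c) * n + q) = t' * block + ((i' * d + c') * n + q'))%N ->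
  [/\ t = t', i = i', c = c' & q = q'].
Proof.
move=> im cd qn im' cd' qn' e.
have lt (a c0 q0 : nat) : (a < m)%N -> (c0 < d)%N -> (q0 < n)%N ->
    ((a * d + c0) * n + q0 < block)%N.
  move=> h1 h2 h3; have h4 : (a * d + c0 < m * d)%N by nia.
  by nia.
have B0 : (0 < block)%N by apply: leq_ltn_trans (lt i c q im cd qn).
have e1 : t = t'.
  have := congr1 (fun z => z %/ block)%N e.
  by rewrite !divnMDl// !divn_small ?lt// !addn0.
move: e; rewrite e1 => /addnI e.
have n0 : (0 < n)%N by apply: leq_ltn_trans qn.
have e2 : (i * d + c = i' * d + c')%N.
  have := congr1 (fun z => z %/ n)%N e.
  by rewrite !divnMDl// !divn_small// !addn0.
have e3 : q = q' by move: e; rewrite e2 => /addnI.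
have e4 : i = i'.
  have := congr1 (fun z => z %/ d)%N e2.
  by rewrite !divnMDl// !divn_small// !addn0.
by split=> //; move: e2; rewrite e4 => /addnI.
Qed.

Section Choice.
Variables (pi : 'I_L -> 'I_k * 'I_k) (cb : 'I_L -> 'I_d * nat).
Hypothesis cbP : forall t, ((cb t).2 + r <= n)%N /\
  1 / 2 < Ms (t0 + t)%N * `|tnth (mu (pi t).1) (cb t).1 - tnth (mu (pi t).2) (cb t).1|
     / 2 ^+ (cb t).2 <= 1.

Definition free_index (x : 'I_L * 'I_m * 'I_r) : nat :=
  let: (t, i, q) := x in
  ((t0 + t) * block + ((i * d + (cb t).1) * n + ((cb t).2 + (r - q.+1))))%N.

Lemma index_lt t i c q : (t < n)%N -> (i < m)%N -> (c < d)%N -> (q < n)%N ->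
  (t * block + ((i * d + c) * n + q) < N)%N.
Proof.
move=> h0 h1 h2 h3; have h4 : (i * d + c < m * d)%N by nia.
have h5 : ((i * d + c) * n + q < block)%N by nia.
have : (t * block + block <= n * block)%N by rewrite -mulSnr leq_mul2r h0 orbT.
by move: h5; set z := (_ * n + q)%N; lia.
Qed.

Lemma free_index_lt x : (free_index x < N)%N.
Proof.
case: x => [[t i] q] /=; have [h _] := cbP t; have := ltn_ord q; have := ltn_ord t.
move: h tLn => h1 h2 h3 h4.
by apply: index_lt; rewrite ?ltn_ord//; lia.
Qed.

Definition free_set : {set 'I_N} := [set Ordinal (free_index_lt x) | x in xpredT].

Lemma card_free_set : #|free_set| = (L * m * r)%N.
Proof.
rewrite card_imset; last first.
  move=> [[t i] q] [[t' i'] q'] /(congr1 val) /=.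
  have [h _] := cbP t; have [h' _] := cbP t'.
  have := ltn_ord q; have := ltn_ord q' => q1 q2.
  move=> /coin_index_inj [||||||/addnI tt ii cc qq]; rewrite ?ltn_ord//; try by lia.
  have {}tt : t = t' by apply/val_inj.
  rewrite tt; congr (_, _, _); first exact/val_inj.
  by apply/val_inj => /=; move: qq; rewrite tt; lia.
by rewrite cardE -[RHS]/(L * m * r)%N -cardE !card_prod !card_ord.
Qed.

Lemma coin_bitsE b (l : 'I_N) : coin_bits b l = b l.
Proof. by rewrite /coin_bits valK. Qed.

(* At the binary position [(cb t).2] the coordinate [(cb t).1] of [M * (mu_j - mu_j')]
   has size about 1.  Fixing all other bits, two values of the next [r] bits move
   [<u_i, mu_j - mu_j'>] by between [64 * rho] and 2, so they cannot both merge. *)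
Lemma merged_rigid (b b' : {ffun 'I_N -> bool}) :
  (forall t : 'I_L, merged b t (pi t)) -> (forall t : 'I_L, merged b' t (pi t)) ->
  (forall l, l \notin free_set -> b l = b' l) -> b = b'.
Proof.
move=> mb mb' agree; apply/ffunP => l.
have [/imsetP[[[t i] q] _ ->]|/agree//] := boolP (l \in free_set).
have [brn /andP[s1 s2]] := cbP t.
have tn : (t0 + t < n)%N by have := ltn_ord t; lia.
set c := (cb t).1 in s1 s2 *; set b0 := (cb t).2 in brn s1 s2 *.
set M := Ms _ in s1 s2 *; pose x := tnth (mu (pi t).1) c - tnth (mu (pi t).2) c.
pose st := ((t0 + t) * block)%N.
have off c' bt : (c' < d)%N -> (bt < n)%N -> (c' != c) || ~~ ((b0 <= bt) && (bt < b0 + r))%N ->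
   coin_bits b (st + ((i * d + c') * n + bt))%N = coin_bits b' (st + ((i * d + c') * n + bt))%N.
  move=> c'd btn h.
  have lN := index_lt tn (ltn_ord i) c'd btn.
  rewrite -[(st + _)%N]/(nat_of_ord (Ordinal lN)) !coin_bitsE; apply: agree.
  apply/negP => /imsetP[[[t' i'] q'] _ /(congr1 val) /=].
  have [h' _] := cbP t'; have q'r := ltn_ord q'; rewrite /st.
  move=> /coin_index_inj [||||||/addnI tt ii cc qq]; rewrite ?ltn_ord//; try by lia.
  have {}tt : t = t' by apply/val_inj.
  move: h; rewrite cc qq -tt -/c -/b0 eqxx /=; move: brn q'r; lia.
pose e (g : {ffun 'I_N -> bool}) q :=
  ~~ coin_bits g (st + ((i * d + c) * n + (b0 + (r - q.+1))))%N.
pose Z g := (\sum_(q < r) e g q * 2 ^ q)%N.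
have dE : loc_diff b t (pi t) i - loc_diff b' t (pi t) i =
   x * (M / 2 ^+ b0 * 2 / 2 ^+ r * ((Z b)%:R - (Z b')%:R)).
  have -> : loc_diff b t (pi t) i - loc_diff b' t (pi t) i =
     \sum_(c' < d) (pattern_dir b t (i * d + c')%N - pattern_dir b' t (i * d + c')%N) *
        (tnth (mu (pi t).1) c' - tnth (mu (pi t).2) c').
    rewrite /loc_diff /dirdot -!sumrB; apply: eq_bigr => c' _; ring.
  rewrite (bigD1 c)//= big1 ?addr0; last first.
    move=> c' c'c; rewrite /pattern_dir /bit_dir.
    rewrite (eq_bigr (fun b1 : 'I_n => if coin_bits b' (st + ((i * d + c') * n + b1))%N
        then 0 else M / 2 ^+ b1)) ?subrr ?mul0r// => b1 _.
    by rewrite (@off c' b1)// c'c.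
  rewrite mulrC; congr (_ * _); apply: (@bit_dir_diff R n (coin_bits b) (coin_bits b')) => //.
  by move=> b1 b1n hb1; apply: off => //; rewrite hb1 orbT.
have ZZ : Z b = Z b'.
  apply/eqP; apply: contraT => ZN.
  have r2 : 0 < 2 ^+ r :> R by rewrite exprn_gt0.
  have lZ : (1 : R) <= `|(Z b)%:R - (Z b')%:R| <= (2 : R) ^+ r.
    have zb := @binary_lt r (e b); have zb' := @binary_lt r (e b').
    rewrite -/(Z b) in zb; rewrite -/(Z b') in zb'.
    have zb1 : (Z b)%:R <= 2 ^+ r :> R by rewrite -natrX ler_nat ltnW.
    have zb1' : (Z b')%:R <= 2 ^+ r :> R by rewrite -natrX ler_nat ltnW.
    have z0 : 0 <= (Z b)%:R :> R by []; have z0' : 0 <= (Z b')%:R :> R by [].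
    apply/andP; split.
      move: ZN; rewrite neq_ltn => /orP[] h; have : (Z b)%:R + 1 <= (Z b')%:R :> R \/ (Z b')%:R + 1 <= (Z b)%:R :> R.
      - by left; rewrite natr1 ler_nat.
      - by case=> h1; rewrite ler_normr; apply/orP; [right|left]; lra.
      - by right; rewrite natr1 ler_nat.
      - by case=> h1; rewrite ler_normr; apply/orP; [right|left]; lra.
    by rewrite ler_norml; apply/andP; split; lra.
  have nE : `|loc_diff b t (pi t) i - loc_diff b' t (pi t) i| =
      (M * `|x| / 2 ^+ b0) * (2 / 2 ^+ r) * `|(Z b)%:R - (Z b')%:R|.
    rewrite dE !normrM !normfV !normrX normr_nat.
    have M0 : 0 <= M.
      apply: le_trans (M_ge (ltn_ord t)); by rewrite divr_ge0// ltW.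
    by rewrite (ger0_norm M0); ring.
  move: lZ s1 s2; rewrite -/x; set zz := `|(Z b)%:R - _| in nE *.
  set y := M * `|x| / 2 ^+ b0 in nE * => /andP[z1 z2] s1 s2.
  have ir : 0 < 2 / 2 ^+ r :> R by rewrite divr_gt0.
  have l1 : 1 / 2 * (2 / 2 ^+ r) * 1 <= y * (2 / 2 ^+ r) * zz.
    by apply: ler_pM => //; rewrite ler_pM2r// ltW.
  have l2 : y * (2 / 2 ^+ r) * zz <= 1 * (2 / 2 ^+ r) * 2 ^+ r.
    have y0 : 0 <= y by lra.
    have yr : y * (2 / 2 ^+ r) <= 1 * (2 / 2 ^+ r) by rewrite ler_pM2r.
    have q1 : 0 <= y * (2 / 2 ^+ r) := mulr_ge0 y0 (ltW ir).
    exact: (ler_pM q1 (normr_ge0 _) yr z2).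
  have l3 : 1 * (2 / 2 ^+ r) * 2 ^+ r = 2 :> R by rewrite mul1r divfK// gt_eqF.
  have l4 : 1 / 2 * (2 / 2 ^+ r) * 1 = 64 * rho by rewrite rhoE; field; rewrite gt_eqF.
  have y2 : `|loc_diff b t (pi t) i - loc_diff b' t (pi t) i| <= 2 by rewrite nE; apply: le_trans l2 _; rewrite l3.
  have := sdist_ge y2; rewrite nE.
  have := sdist_add (loc_diff b t (pi t) i) (- loc_diff b' t (pi t) i).
  rewrite sdistN.
  have /andP[_ /forallP /(_ i) h1] := mb t.
  have /andP[_ /forallP /(_ i) h2] := mb' t.
  have rho0 : 0 < rho by rewrite rhoE divr_gt0// mulr_gt0.
  by lra.
have := binary_inj ZZ (ltn_ord q); rewrite /e => /negb_inj.
by rewrite -[(st + _)%N]/(nat_of_ord (Ordinal (free_index_lt (t, i, q)))) !coin_bitsE.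
Qed.

End Choice.

Definition bad_patterns : {set {ffun 'I_N -> bool}} :=
  [set b | [forall t : 'I_L, [exists p : 'I_k * 'I_k, merged b t p]]]%SET.

(** For each choice of one merged pair per trial, the [L * m * r] free bits are determined by the
    remaining ones; they are distinct since trials and directions read disjoint coins. There are
    [(k * k) ^ L] such choices. *)
Lemma card_bad_patterns : (#|bad_patterns| * 2 ^ (L * m * r) <= (k * k) ^ L * 2 ^ N)%N.
Proof.
pose E (pi : {ffun 'I_L -> 'I_k * 'I_k}) : {set {ffun 'I_N -> bool}} :=
  [set b | [forall t : 'I_L, merged b t (pi t)]]%SET.
have sub : (#|bad_patterns| <= \sum_pi #|E pi|)%N.
  pose V := \big[@finset.setU _/finset.set0]_pi E pi.
  have h1 : (#|bad_patterns| <= #|V|)%N.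
    apply: fintype.subset_leq_card; apply/fintype.subsetP => b; rewrite inE => /forallP h.
    have /choice[f fP] (t : 'I_L) : exists p, merged b t p by have /existsP := h t.
    apply/finset.bigcupP; exists [ffun t => f t] => //; rewrite inE.
    by apply/forallP => t; rewrite ffunE.
  have h2 : (#|V| <= \sum_pi #|E pi|)%N.
    rewrite /V; elim/big_rec2: _ => [|pi A B _ h]; first by rewrite cards0.
    apply: leq_trans (leq_card_setU _ _) _; by rewrite leq_add2l.
  exact: leq_trans h1 h2.
have each pi : (#|E pi| * 2 ^ (L * m * r) <= 2 ^ N)%N.
  have [pp|] := boolP [forall t, (pi t).1 != (pi t).2]; last first.
    rewrite negb_forall => /existsP[t pt].
    have -> : E pi = finset.set0.
      apply/setP => b; rewrite !inE; apply/negP => /forallP /(_ t).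
      by rewrite /merged (negbTE pt).
    by rewrite cards0 mul0n.
  have /choice[cb cbP] (t : 'I_L) := @dyadic_coord t (pi t) (ltn_ord t) (forallP pp t).
  have h0 := @card_rigid _ (free_set cbP) (E pi).
  rewrite card_free_set card_ord in h0; apply: h0 => b b'.
  rewrite !inE => /forallP h /forallP h' agree.
  exact: (merged_rigid h h' agree).
apply: leq_trans (leq_mul sub (leqnn _)) _; rewrite big_distrl /=.
apply: leq_trans (leq_sum _ (fun pi _ => each pi)) _.
by rewrite sum_nat_const card_ffun card_prod !card_ord.
Qed.

End BadPatterns.

(** * Parameters *)

Section Growth.
Variable R : realType.

Lemma ln2_ge : 1 / 2 <= ln 2 :> R.
Proof.
rewrite -ler_expR lnK ?posrE//; apply: le_trans (expR_le_quad _) _ => //; lra.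
Qed.

Lemma expR1_le4 : expR 1 <= 4 :> R.
Proof.
have -> : (1 : R) = 2%:R * (1 / 2) by field.
rewrite expRM_natl; have h : expR (1 / 2) <= 2 :> R.
  by apply: le_trans (expR_le_quad _) _ => //; lra.
by have := expR_ge0 (1 / 2 : R); rewrite expr2; nra.
Qed.

Lemma expn_ell_le n : (0 < n)%N -> (2 ^ ell n <= 2 * n)%N.
Proof.
move=> n0; have := @up_log_gtn 2 n.+1 isT; rewrite -/(ell n) => h.
have l0 := ell_gt0 n0; rewrite -(prednK l0) expnS leq_mul2l /=.
by move: h; rewrite !ltnS => -> //.
Qed.

Lemma expn_loglog_le n : (0 < n)%N -> (2 ^ loglog n <= 2 * ell n)%N.
Proof. by move=> n0; apply: (@expn_ell_le (ell n)); exact: ell_gt0. Qed.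

(** A single term of the exponential series at [ell n * ln 2], together with
    [2 ^ ell n <= 2 * n]. *)
Lemma ell_pow_le (N n : nat) : (0 < n)%N ->
  (ell n)%:R ^+ N <= N`!%:R * 2 ^+ N * 2 * n%:R :> R.
Proof.
move=> n0; case: N => [|N].
  rewrite expr0 fact0 expr0 !mul1r; have : (1 : R) <= n%:R by rewrite ler1n.
  lra.
have l2 := ln2_ge; have l0 : 0 <= (ell n)%:R * ln 2 :> R by rewrite mulr_ge0//; lra.
have h := @expR_ge1Dxn R _ N l0.
have e2 : expR ((ell n)%:R * ln 2) <= 2 * n%:R :> R.
  by rewrite expRM_natl lnK ?posrE// -natrX -natrM ler_nat expn_ell_le.
have f0 : 0 < N.+1`!%:R :> R by rewrite ltr0n fact_gt0.
have h1 : ((ell n)%:R * ln 2) ^+ N.+1 / N.+1`!%:R <= 2 * n%:R :> R.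
  by apply: le_trans e2; apply: le_trans h; rewrite lerDr.
rewrite ler_pdivrMr// in h1.
have h2 : ((ell n)%:R / 2) ^+ N.+1 <= ((ell n)%:R * ln 2) ^+ N.+1 :> R.
  rewrite lerXn2r ?nnegrE ?divr_ge0//.
  by have : 0 <= (ell n)%:R :> R by []; nra.
have h3 := le_trans h2 h1.
rewrite expr_div_n ler_pdivrMr ?exprn_gt0// in h3.
by apply: le_trans h3 _; rewrite le_eqVlt; apply/orP; left; apply/eqP; ring.
Qed.

(** The hypothesis involves the logarithm of [F], the analysis that of [n]. If the conclusion
    failed, squaring it and using that [ell n ^ (2 * p0)] is [O(n)] would make [n] at most quadratic
    in [F]. Then [ell n] is [O(ln (2 + F))], and the hypothesis gives the conclusion after all. *)
Lemma soft_growth (C1 : R) (p0 : nat) : 0 < C1 -> exists C : R, 0 < C /\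
  forall (F : R) (n : nat), 0 < F -> (0 < n)%N -> soft C p0 F <= n%:R ->
    C1 * F * (ell n)%:R ^+ p0 <= n%:R.
Proof.
move=> C10; pose cN : R := (2 * p0)`!%:R * 2 ^+ (2 * p0) * 2.
pose A := C1 ^+ 2 * cN + 1.
have cN0 : 0 <= cN by rewrite /cN !mulr_ge0// exprn_ge0.
have A1 : 1 <= A by rewrite /A lerDr mulr_ge0// sqr_ge0.
have lA : 0 <= ln A by rewrite ln_ge0.
pose c := 6 + 4 * ln A; have c0 : 0 < c by rewrite /c; lra.
exists (C1 * c ^+ p0); split; first by rewrite mulr_gt0// exprn_gt0.
move=> F n F0 n0 hn; rewrite leNgt; apply/negP => hlt.
have l2 := ln2_ge.
pose y := ln (2 + F).
have y2 : ln 2 <= y by rewrite ler_ln ?posrE//; lra.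
have n0' : 0 < n%:R :> R by rewrite ltr0n.
have lp := ell_pow_le (2 * p0) n0; rewrite -/cN in lp.
have e0 : 0 <= (ell n)%:R ^+ p0 :> R by rewrite exprn_ge0.
have nA : n%:R < A * (2 + F) ^+ 2.
  have : n%:R ^+ 2 < C1 ^+ 2 * F ^+ 2 * (cN * n%:R).
    apply: (@lt_le_trans _ _ ((C1 * F * (ell n)%:R ^+ p0) ^+ 2)).
      by rewrite ltrXn2r// nnegrE// !mulr_ge0// ltW.
    by rewrite 2!exprMn -exprM muln2 -mul2n ler_wpM2l//; apply: mulr_ge0; exact: sqr_ge0.
  rewrite [n%:R ^+ 2]expr2 [cN * _]mulrC mulrCA ltr_pM2l// => h.
  apply: lt_le_trans h _.
  have F2 : F ^+ 2 <= (2 + F) ^+ 2 by rewrite lerXn2r ?nnegrE//; lra.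
  have h1 : C1 ^+ 2 * cN <= A by rewrite /A; lra.
  have := ler_pM _ _ h1 F2; rewrite mulr_ge0 ?sqr_ge0// => /(_ isT isT).
  by apply: le_trans; rewrite le_eqVlt; apply/orP; left; apply/eqP; ring.
have yl : (ell n)%:R <= c * y.
  have h : expR (((ell n).-1)%:R * ln 2) <= n%:R :> R.
    rewrite expRM_natl lnK ?posrE// -natrX ler_nat.
    by have := expn_ell_le n0; rewrite -{1}(prednK (ell_gt0 n0)) expnS leq_mul2l.
  have h2 : ((ell n).-1)%:R * ln 2 < ln A + 2 * y.
    rewrite -ltr_expR; apply: le_lt_trans h (lt_le_trans nA _).
    rewrite expRD lnK ?posrE; last by lra.
    rewrite expRM_natl lnK ?posrE//; lra.
  have h3 : (ell n)%:R = (ell n).-1%:R + 1 :> R by rewrite natr1 prednK// ell_gt0.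
  have h4 : 0 <= (ell n).-1%:R :> R by [].
  rewrite h3 /c; nra.
have : C1 * F * (ell n)%:R ^+ p0 <= soft (C1 * c ^+ p0) p0 F.
  rewrite /soft -/y.
  have : (ell n)%:R ^+ p0 <= (c * y) ^+ p0 by rewrite lerXn2r// nnegrE// mulr_ge0//; lra.
  rewrite exprMn; have CF : 0 <= C1 * F by rewrite mulr_ge0// ltW.
  move=> h; apply: (le_trans (ler_wpM2l CF h)).
  by rewrite le_eqVlt; apply/orP; left; apply/eqP; ring.
by move=> h; have := lt_le_trans hlt (le_trans h hn); rewrite ltxx.
Qed.

End Growth.

Lemma cube_le_exp2 n : (16 <= n)%N -> (4 * (n * n * n) <= 2 ^ n)%N.
Proof.
move=> n16; rewrite -(subnK n16); move: (n - 16)%N => j.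
elim: j => [//|j IH]; rewrite addSn expnS; nia.
Qed.

(** * Sizes of the base and of the number of directions *)

Section Sizes.
Variable n : nat.
Hypothesis n_gt0 : (0 < n)%N.
Local Notation l := (ell n).
Local Notation r := (loglog n).
Local Notation m := (ndir n).
Local Notation Q := (nbase n).

Lemma loglog_le : (r <= l)%N.
Proof. by apply: up_log_min => //; apply: ltn_expl. Qed.

Lemma ndir_ge : (2 * l <= r * m)%N.
Proof.
have r0 := loglog_gt0 n_gt0; rewrite /ndir [X in (_ <= X)%N]mulnC.
by apply: ltnW; rewrite -ltn_divLR.
Qed.

Lemma ndir_le : (r * m <= 2 * l + r)%N.
Proof. by rewrite /ndir mulnS addnC leq_add2r mulnC leq_trunc_div. Qed.

Lemma ndir_le_ell : (m <= (2 * l).+1)%N.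
Proof. by rewrite ltnS leq_div. Qed.

Lemma ndir_lt_loglog : (m < 2 * 2 ^ r)%N.
Proof. by have := ndir_le_ell; have := ltn_loglog n; lia. Qed.

Lemma nbaseE : Q = (2 ^ r * 2 ^ r * 2 ^ r * 2 ^ 13)%N.
Proof. by rewrite /nbase -!expnD; congr (2 ^ _)%N; lia. Qed.

Lemma nbase_ge : (2 ^ 13 * 2 ^ r <= Q)%N.
Proof.
rewrite nbaseE mulnC leq_mul2r -mulnA -[X in (X <= _)%N]muln1 leq_mul2l muln_gt0.
by rewrite expn_gt0 orbT.
Qed.

Lemma nbase_gt0 : (0 < Q)%N. Proof. by rewrite /nbase expn_gt0. Qed.

Lemma nbase_le : (Q <= 2 ^ 16 * l ^ 3)%N.
Proof.
have h := expn_loglog_le n_gt0.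
have -> : (2 ^ 16 * l ^ 3 = (2 * l) ^ 3 * 2 ^ 13)%N.
  by rewrite expnMn mulnAC -expnD.
by rewrite /nbase expnD mulnC [X in (_ <= X)%N]mulnC leq_mul2l mulnC expnM leq_exp2r// h orbT.
Qed.

Lemma ndir_nbase : (64 * m <= 3 * Q)%N.
Proof. have := nbase_ge; have := ndir_lt_loglog; move: (2 ^ r)%N Q m => a b c; lia. Qed.

Lemma ndir_le_nbase : (m <= Q)%N.
Proof. have := nbase_ge; have := ndir_lt_loglog; move: (2 ^ r)%N Q m => a b c; lia. Qed.

(** [3 * r + 13 <= 16 * r] and [r * m <= 2 * l + r <= 3 * l], whence [48 = 16 * 3]. This is why grid
    and sum have polynomial size. *)
Lemma expn_nbase_le : (Q ^ m <= 2 ^ (48 * l))%N.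
Proof.
rewrite /nbase -expnM leq_exp2l//.
have := ndir_le; have := loglog_le; have := loglog_gt0 n_gt0 => r0 rl rm.
have : ((3 * r + 13) * m <= 16 * (r * m))%N by rewrite mulnA leq_mul2r; apply/orP; right; lia.
lia.
Qed.

Lemma tail_nbase (R : realType) :
  expR (- (Q.-1%:R * (1 / (64 * (2 ^ r)%:R)) ^+ 2)) <= n%:R^-1 ^+ 2 :> R.
Proof.
have n0 : 0 < n%:R :> R by rewrite ltr0n.
rewrite -[leRHS]lnK ?posrE ?exprn_gt0 ?invr_gt0// ler_expR.
rewrite lnXn ?invr_gt0// lnV ?posrE// mulNrn lerN2.
have nl : ln n%:R <= l%:R :> R.
  rewrite -ler_expR lnK ?posrE//; apply: (@le_trans _ _ (2 ^+ l)).
    by rewrite -natrX ler_nat ltnW// ltn_ell.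
  have -> : (2 : R) ^+ l = expR (l%:R * ln 2) by rewrite expRM_natl lnK// posrE.
  rewrite ler_expR ler_piMr//.
  by rewrite -ler_expR lnK ?posrE//; have := @expR_ge1Dx R 1; lra.
set y : R := (2 ^ r)%:R; have y1 : 1 <= y by rewrite ler1n expn_gt0.
have ly : l%:R + 1 <= y by rewrite natr1 ler_nat ltn_loglog.
have QE : Q.-1%:R = y * y * y * 2 ^+ 13 - 1 :> R.
  by rewrite -subn1 natrB ?nbase_gt0// nbaseE !natrM.
rewrite QE.
have -> : (y * y * y * 2 ^+ 13 - 1) * (1 / (64 * y)) ^+ 2 = 2 * y - 1 / (2 ^+ 12 * (y * y)).
  by field; rewrite gt_eqF//; lra.
have : 1 / (2 ^+ 12 * (y * y)) <= 1 by rewrite ler_pdivrMr; nra.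
rewrite mulr2n; lra.
Qed.

End Sizes.

(** * Consequences of the sample bound *)

Section Rates.
Variables (R : realType) (d k n N0 N1 N2 ce ct : nat).
Variables (gamma wmin B eps delta C1 : R).
Local Notation l := (ell n).
Local Notation r := (loglog n).
Local Notation m := (ndir n).
Local Notation Q := (nbase n).
Local Notation Lam := (ln (2 / delta)).
Local Notation g := (d%:R + gamma^-1).
Local Notation inv_decay M := (inv_decay N0 N1 N2 d Q M).
Local Notation eta0 := (eta0 ce n l delta).
Local Notation theta M := (theta N0 N1 N2 ce ct d n Q l eps delta M).
Local Notation trial_M := (trial_M delta).

(* [inv_decay M * (Q * M * d) <= const_K * g ^ (exp_g / 2) * l ^ ((exp_l - 1) / 2)]
   for [M <= 7 * g ^ 2]; squaring gives the sample bound. *)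
Definition exp_g : nat := (2 * N1 + 6 * N2 + 6)%N.
Definition exp_l : nat := (12 * N2 + 7)%N.
Definition const_K : R := N0%:R * (28 * 2 ^+ 32) ^+ N2 * (7 * 2 ^+ 16).

Hypotheses (d_gt0 : (0 < d)%N) (k_gt0 : (0 < k)%N) (N0_gt0 : (0 < N0)%N).
Hypotheses (gamma_gt0 : 0 < gamma) (wmin_gt0 : 0 < wmin) (k_wmin : k%:R * wmin <= 1).
Hypotheses (eps_gt0 : 0 < eps) (eps_lt1 : eps < 1).
Hypotheses (delta_gt0 : 0 < delta) (delta_lt1 : delta < 1).
Hypothesis B_ge : 1 / (2 * g ^+ 2) <= B.
Hypotheses (ceE : ce = (128 * 60)%N) (ctE : ct = 1152%N).
Hypothesis C1E : C1 = 64 * (ct%:R ^+ 2 * ce%:R * const_K ^+ 2).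
Hypothesis n_gt0 : (0 < n)%N.
Hypothesis rate_le : C1 * sample_rate d (exp_g + 4) gamma wmin B eps delta * l%:R ^+ exp_l <= n%:R.

Lemma exp_g_ge : (2 <= exp_g)%N. Proof. by rewrite /exp_g addnS ltnS addn_gt0 orbT. Qed.

Lemma g_ge1 : 1 <= g.
Proof.
have : 1 <= d%:R :> R by rewrite ler1n.
have : 0 < gamma^-1 by rewrite invr_gt0.
lra.
Qed.

Lemma d_le_g : d%:R <= g. Proof. by rewrite lerDl invr_ge0 ltW. Qed.

Lemma Lam_ge : ln 2 <= Lam.
Proof. by rewrite ler_ln ?posrE ?divr_gt0// ler_pdivlMr//; move: delta_lt1; lra. Qed.

Lemma Lam_half : 1 / 2 <= Lam.
Proof. exact: le_trans (ln2_ge R) Lam_ge. Qed.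

Lemma const_K_ge : 1 <= const_K.
Proof.
rewrite /const_K; have h0 : 1 <= N0%:R :> R by rewrite ler1n.
have p (N : nat) : 1 <= 2 ^+ N :> R by rewrite exprn_ege1 ?ler1n.
have h1 : 1 <= (28 * 2 ^+ 32) ^+ N2 :> R by rewrite exprn_ege1//; have := p 32%N; lra.
have h2 : 1 <= 7 * 2 ^+ 16 :> R by have := p 16%N; lra.
by apply: mulr_ege1 => //; exact: mulr_ege1.
Qed.

Lemma C1_ge_ce : 64 * ce%:R <= C1.
Proof.
rewrite C1E; have h := const_K_ge.
have h1 : 1 <= const_K ^+ 2 by rewrite exprn_ege1.
have h2 : 1 <= ct%:R ^+ 2 :> R by rewrite exprn_ege1// ctE ler1n.
rewrite ler_wpM2l// -mulrA mulrCA; apply: ler_peMr => //.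
by rewrite mulr_ege1.
Qed.

Lemma ceR : ce%:R = 128 * 60 :> R. Proof. by rewrite ceE natrM. Qed.

Lemma C1_ge : 1024 <= C1.
Proof. by have := C1_ge_ce; rewrite ceR; lra. Qed.

Lemma wmin_le1 : wmin <= 1.
Proof.
have h : 1 <= k%:R :> R by rewrite ler1n.
by apply: le_trans k_wmin; rewrite ler_peMl// ltW.
Qed.

(** The factor [B ^ 2] of the rate is absorbed by [B >= 1 / (2 * g ^ 2)], at the price of [g ^ 4]
    and of the constant 4. This is the origin of the 4 in the degree [exp_g + 4]. *)
Lemma master : C1 * (g ^+ exp_g * Lam * l%:R ^+ exp_l) <= 4 * (wmin ^+ 2 * eps ^+ 2) * n%:R.
Proof.
have C0 := C1_ge; have g1 := g_ge1; have L1 := Lam_half.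
have we : 0 < wmin ^+ 2 * eps ^+ 2 by rewrite mulr_gt0// exprn_gt0.
have g20 : 0 < g ^+ 2 by rewrite exprn_gt0//; lra.
have Bg : 1 / 4 <= B ^+ 2 * g ^+ 4.
  have -> : B ^+ 2 * g ^+ 4 = (B * g ^+ 2) ^+ 2 by ring.
  have h : 1 / 2 <= B * g ^+ 2.
    rewrite -ler_pdivrMr//; apply: le_trans B_ge.
    move: g20; set G := g ^+ 2 => G0; rewrite le_eqVlt; apply/orP; left; apply/eqP; by field; rewrite gt_eqF.
  by move: h; set z := B * _ => h; rewrite expr2; nra.
have h : C1 * sample_rate d (exp_g + 4) gamma wmin B eps delta * l%:R ^+ exp_l *
    (wmin ^+ 2 * eps ^+ 2) = C1 * (g ^+ exp_g * Lam * l%:R ^+ exp_l) * (B ^+ 2 * g ^+ 4).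
  rewrite /sample_rate exprD; field; rewrite !gt_eqF//.
have := ler_wpM2r (ltW we) rate_le; rewrite h => {}h.
have X0 : 0 <= C1 * (g ^+ exp_g * Lam * l%:R ^+ exp_l).
  by rewrite !mulr_ge0 ?exprn_ge0//; lra.
have := ler_wpM2l X0 Bg; lra.
Qed.

Lemma l_ge1 : 1 <= l%:R :> R. Proof. by rewrite ler1n ell_gt0. Qed.

Lemma master_pow (j i : nat) : (j <= exp_g)%N -> (i <= exp_l)%N ->
  C1 * (g ^+ j * Lam * l%:R ^+ i) <= 4 * wmin ^+ 2 * n%:R.
Proof.
move=> jg il; have C0 := C1_ge; have g1 := g_ge1; have L1 := Lam_half; have l1 := l_ge1.
apply: (@le_trans _ _ (C1 * (g ^+ exp_g * Lam * l%:R ^+ exp_l))).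
  rewrite ler_wpM2l//; first by lra.
  apply: ler_pM; rewrite ?exprn_ge0 ?mulr_ge0 ?exprn_ge0//; try lra.
    by rewrite ler_wpM2r ?ler_weXn2l//; lra.
  by rewrite ler_weXn2l.
apply: le_trans master _; rewrite ler_wpM2r// ler_wpM2l// ler_piMr ?sqr_ge0//.
by rewrite expr_le1// ltW.
Qed.

Lemma master_n (j i : nat) : (j <= exp_g)%N -> (i <= exp_l)%N ->
  C1 * (g ^+ j * Lam * l%:R ^+ i) <= 4 * n%:R.
Proof.
move=> jg il; apply: le_trans (master_pow jg il) _.
rewrite ler_wpM2r// ler_piMr//; rewrite expr_le1 ?wmin_le1//; exact: ltW.
Qed.

Lemma n_ge_Lam_g2 : 256 * (Lam * g ^+ 2) <= n%:R.
Proof.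
have := @master_n 2 0 exp_g_ge isT; rewrite expr0 mulr1 => h.
have C0 := C1_ge; have L1 := Lam_half; have g1 := g_ge1.
have X0 : 0 <= g ^+ 2 * Lam by rewrite mulr_ge0 ?exprn_ge0//; lra.
have := ler_wpM2r X0 C0; lra.
Qed.

Lemma g2_ge_g : g <= g ^+ 2. Proof. by rewrite expr2; have := g_ge1; nra. Qed.

Lemma n_ge_g2 : 128 * g ^+ 2 <= n%:R.
Proof.
have := n_ge_Lam_g2; have := Lam_half; have : 0 <= g ^+ 2 by rewrite sqr_ge0.
nra.
Qed.

Lemma n_ge128 : (128 <= n)%N.
Proof.
rewrite -(ler_nat R); have := n_ge_g2; have := g2_ge_g; have := g_ge1; lra.
Qed.

Lemma d_le_n : (d <= n)%N.
Proof.
rewrite -(ler_nat R); have := n_ge_g2; have := g2_ge_g; have := d_le_g; have := g_ge1; lra.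
Qed.

Lemma k_le_n : (2 * k <= n)%N.
Proof.
rewrite -(ler_nat R) natrM.
have := @master_pow 0 0 isT isT; rewrite !expr0 mulr1 mul1r => h.
have k1 : 1 <= k%:R :> R by rewrite ler1n.
have h1 : C1 * Lam * k%:R ^+ 2 <= 4 * n%:R.
  have : k%:R ^+ 2 * (C1 * Lam) <= k%:R ^+ 2 * (4 * wmin ^+ 2 * n%:R).
    by rewrite ler_wpM2l// sqr_ge0.
  have e : (k%:R * wmin) ^+ 2 <= 1 by rewrite expr_le1// mulr_ge0// ltW.
  have : (k%:R * wmin) ^+ 2 * (4 * n%:R) <= 4 * n%:R by rewrite ler_piMl// mulr_ge0.
  rewrite exprMn; lra.
have C0 := C1_ge; have L1 := Lam_half.
have h2 : 8 <= C1 * Lam.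
  have : C1 * (1 / 2) <= C1 * Lam by rewrite ler_wpM2l//; lra.
  lra.
have h3 : 8 * k%:R ^+ 2 <= C1 * Lam * k%:R ^+ 2 by rewrite ler_wpM2r ?sqr_ge0.
have : k%:R <= k%:R ^+ 2 :> R by rewrite expr2 ler_peMl//; lra.
lra.
Qed.

(** The other factors of the rate amount to at least 1, so even [B ^ 2 <= n]. The coordinates of the
    means are then at most [2 ^ (n - 1)], as the phase refinement requires. *)
Lemma B_le_n : B <= n%:R.
Proof.
have C0 := C1_ge; have g1 := g_ge1; have L1 := Lam_half; have l1 := l_ge1.
have we : 0 < wmin ^+ 2 * eps ^+ 2 by rewrite mulr_gt0// exprn_gt0.
have we1 : wmin ^+ 2 * eps ^+ 2 <= 1.
  by rewrite -exprMn expr_le1 ?mulr_ge0 ?(ltW wmin_gt0) ?(ltW eps_gt0)// mulr_ile1 ?wmin_le1 ?(ltW _)//.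
have B2 : B ^+ 2 <= n%:R.
  apply: le_trans rate_le; rewrite /sample_rate.
  have h1 : B ^+ 2 <= C1 * (g ^+ (exp_g + 4) * B ^+ 2 * Lam) * l%:R ^+ exp_l.
    have -> : C1 * (g ^+ (exp_g + 4) * B ^+ 2 * Lam) * l%:R ^+ exp_l =
       (C1 * Lam) * g ^+ (exp_g + 4) * l%:R ^+ exp_l * B ^+ 2 by ring.
    rewrite ler_peMl ?sqr_ge0// mulr_ege1 ?exprn_ege1// mulr_ege1 ?exprn_ege1//.
    nra.
  apply: le_trans h1 _.
  have A0 : 0 <= g ^+ (exp_g + 4) * B ^+ 2 * Lam.
    apply: mulr_ge0; last by lra.
    by apply: mulr_ge0; [apply: exprn_ge0; lra|exact: sqr_ge0].
  rewrite ler_wpM2r ?exprn_ge0// ler_wpM2l//; first lra.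
  by rewrite ler_pdivlMr// ler_piMr.
rewrite leNgt; apply/negP => h.
have n1 : 1 <= n%:R :> R by rewrite ler1n.
have : n%:R * n%:R < B ^+ 2 by rewrite expr2 ltr_pM//; lra.
nra.
Qed.

Lemma sizeR_gt0 : 0 < n%:R :> R. Proof. by rewrite ltr0n. Qed.

Lemma eta0_sqr : eta0 ^+ 2 = ce%:R * (l%:R * Lam) / n%:R.
Proof.
rewrite /eta0 sqr_sqrtr//; have L1 := Lam_half.
by apply: divr_ge0 => //; apply: mulr_ge0 => //; apply: mulr_ge0 => //; lra.
Qed.

Lemma eta0_ge0 : 0 <= eta0. Proof. exact: sqrtr_ge0. Qed.

Lemma eta0_le1 : eta0 <= 1.
Proof.
rewrite -(@ler_pXn2r _ 2) ?nnegrE ?eta0_ge0// eta0_sqr expr1n ler_pdivrMr ?sizeR_gt0// mul1r.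
have := @master_n 0 1 isT _; rewrite expr0 expr1 mul1r => h.
have {}h : C1 * (Lam * l%:R) <= 4 * n%:R by apply: h; rewrite /exp_l addnS.
have L1 := Lam_half; have l1 := l_ge1; have := C1_ge_ce => c.
have X0 : 0 <= Lam * l%:R by apply: mulr_ge0; lra.
have := ler_wpM2r X0 c; rewrite [l%:R * _]mulrC.
have : 0 <= ce%:R * (Lam * l%:R) by apply: mulr_ge0.
lra.
Qed.

Lemma eta0_ge_inv : n%:R^-1 <= eta0.
Proof.
have n0 := sizeR_gt0.
rewrite -(@ler_pXn2r _ 2) ?nnegrE ?eta0_ge0 ?invr_ge0 ?(ltW n0)// eta0_sqr.
rewrite expr2 ler_wpM2r ?invr_ge0 ?(ltW n0)//.
apply: (@le_trans _ _ 1); first by rewrite invf_le1// ler1n.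
have L1 := Lam_half; have l1 := l_ge1; rewrite ceR.
have : 1 * Lam <= l%:R * Lam by rewrite ler_wpM2r//; lra.
lra.
Qed.

Lemma eta0_gt0 : 0 < eta0.
Proof. by apply: lt_le_trans eta0_ge_inv; rewrite invr_gt0 sizeR_gt0. Qed.

Lemma nbaseR_ge1 : 1 <= Q%:R :> R. Proof. by rewrite ler1n nbase_gt0. Qed.

Lemma inv_decay_ge1 (M : R) : 1 <= M -> 1 <= inv_decay M.
Proof.
move=> M1; have d1 : 1 <= d%:R :> R by rewrite ler1n.
have Q1 := nbaseR_ge1; rewrite /(inv_decay M).
apply: mulr_ege1; first by rewrite ler1n.
apply: mulr_ege1; first exact: exprn_ege1.
apply: exprn_ege1; apply: mulr_ege1; last exact: mulr_ege1.
by apply: mulr_ege1; [lra|exact: mulr_ege1].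
Qed.

Lemma QMd_ge1 (M : R) : 1 <= M -> 1 <= Q%:R * M * d%:R.
Proof.
move=> M1; apply: mulr_ege1; last by rewrite ler1n.
by apply: mulr_ege1 => //; exact: nbaseR_ge1.
Qed.

Lemma thetaE (M : R) : theta M = ct%:R * eta0 * inv_decay M * (Q%:R * M * d%:R) / eps.
Proof. by rewrite /(theta M) !mulrA. Qed.

Lemma theta_gt0 (M : R) : 1 <= M -> 0 < theta M.
Proof.
move=> M1; rewrite thetaE; apply: divr_gt0 => //.
have := inv_decay_ge1 M1; have := QMd_ge1 M1; have := eta0_gt0 => h1 h2 h3.
have c0 : 0 < ct%:R :> R by rewrite ltr0n ctE.
apply: mulr_gt0; last by lra.
apply: mulr_gt0; last by lra.
exact: mulr_gt0.
Qed.

Lemma Q_le_l : Q%:R <= 2 ^+ 16 * l%:R ^+ 3 :> R.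
Proof. by have := nbase_le n_gt0; rewrite -(ler_nat R) natrM !natrX. Qed.

Lemma QMd_le (M : R) : 1 <= M -> M <= 7 * g ^+ 2 ->
  Q%:R * M * d%:R <= 7 * 2 ^+ 16 * (l%:R ^+ 3 * g ^+ 3).
Proof.
move=> M1 M7; have Q1 := nbaseR_ge1; have g1 := g_ge1.
have -> : 7 * 2 ^+ 16 * (l%:R ^+ 3 * g ^+ 3) = (2 ^+ 16 * l%:R ^+ 3) * (7 * g ^+ 2) * g by ring.
apply: ler_pM d_le_g => //; first by apply: mulr_ge0; lra.
by apply: ler_pM Q_le_l M7; lra.
Qed.

Lemma inv_decay_le (M : R) : 1 <= M -> M <= 7 * g ^+ 2 ->
  inv_decay M <= N0%:R * (28 * 2 ^+ 32) ^+ N2 * (g ^+ (N1 + 3 * N2) * l%:R ^+ (6 * N2)).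
Proof.
move=> M1 M7; have Q1 := nbaseR_ge1; have g1 := g_ge1; rewrite /(inv_decay M).
have -> : N0%:R * (28 * 2 ^+ 32) ^+ N2 * (g ^+ (N1 + 3 * N2) * l%:R ^+ (6 * N2)) =
  N0%:R * (g ^+ N1 * (4 * ((2 ^+ 16 * l%:R ^+ 3) * (2 ^+ 16 * l%:R ^+ 3)) * ((7 * g ^+ 2) * g)) ^+ N2).
  have -> : 4 * ((2 ^+ 16 * l%:R ^+ 3) * (2 ^+ 16 * l%:R ^+ 3)) * ((7 * g ^+ 2) * g) =
     28 * 2 ^+ 32 * (g ^+ 3 * l%:R ^+ 6) by ring.
  rewrite [(_ * (g ^+ 3 * _)) ^+ _]exprMn [(g ^+ 3 * _) ^+ _]exprMn.
  by rewrite -[(g ^+ 3) ^+ _]exprM -[(l%:R ^+ 6) ^+ _]exprM exprD; ring.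
rewrite ler_wpM2l//; apply: ler_pM; rewrite ?exprn_ge0//.
- by apply: mulr_ge0; [apply: mulr_ge0 => //; apply: mulr_ge0; lra|apply: mulr_ge0 => //; lra].
- by rewrite lerXn2r ?nnegrE// ?d_le_g//; lra.
have h : 4 * (Q%:R * Q%:R) * (M * d%:R) <=
   4 * ((2 ^+ 16 * l%:R ^+ 3) * (2 ^+ 16 * l%:R ^+ 3)) * ((7 * g ^+ 2) * g).
  apply: ler_pM.
  - by apply: mulr_ge0 => //; apply: mulr_ge0; lra.
  - by apply: mulr_ge0 => //; lra.
  - rewrite ler_wpM2l//; apply: ler_pM Q_le_l Q_le_l; lra.
  - apply: ler_pM M7 d_le_g => //; lra.
have h0 : 0 <= 4 * (Q%:R * Q%:R) * (M * d%:R).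
  by apply: mulr_ge0; [apply: mulr_ge0 => //; apply: mulr_ge0; lra|apply: mulr_ge0 => //; lra].
by rewrite lerXn2r// nnegrE//; exact: le_trans h.
Qed.

Lemma exp_gE : exp_g = ((N1 + 3 * N2 + 3) * 2)%N.
Proof. clear; rewrite /exp_g; lia. Qed.

Lemma exp_lE : (12 * N2 + 6 = (6 * N2 + 3) * 2)%N.
Proof. clear; lia. Qed.

(** The constant [C1] is calibrated here: squaring [4 * theta] gives 16 and [master] another 4,
    hence 64, while the other factors are the constants of [theta], [eta0] and [const_K]. The bound
    on [M] turns powers of the scale into powers of [g]. *)
Lemma theta_le_wmin (M : R) : 1 <= M -> M <= 7 * g ^+ 2 -> 4 * theta M <= wmin.
Proof.
move=> M1 M7; have t0 := theta_gt0 M1.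
rewrite -(@ler_pXn2r _ 2) ?nnegrE ?(ltW wmin_gt0)//; last by apply: mulr_ge0 => //; exact: ltW.
have i1 := inv_decay_ge1 M1; have q1 := QMd_ge1 M1; have e0 := eta0_ge0.
have iq : inv_decay M * (Q%:R * M * d%:R) <=
   const_K * (g ^+ (N1 + 3 * N2 + 3) * l%:R ^+ (6 * N2 + 3)).
  have -> : const_K * (g ^+ (N1 + 3 * N2 + 3) * l%:R ^+ (6 * N2 + 3)) =
    (N0%:R * (28 * 2 ^+ 32) ^+ N2 * (g ^+ (N1 + 3 * N2) * l%:R ^+ (6 * N2))) *
    (7 * 2 ^+ 16 * (l%:R ^+ 3 * g ^+ 3)).
    by rewrite /const_K exprD [l%:R ^+ (_ + 3)]exprD; ring.
  by apply: ler_pM (inv_decay_le M1 M7) (QMd_le M1 M7); lra.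
have iq2 : (inv_decay M * (Q%:R * M * d%:R)) ^+ 2 <=
   const_K ^+ 2 * (g ^+ exp_g * l%:R ^+ (12 * N2 + 6)).
  have -> : const_K ^+ 2 * (g ^+ exp_g * l%:R ^+ (12 * N2 + 6)) =
     (const_K * (g ^+ (N1 + 3 * N2 + 3) * l%:R ^+ (6 * N2 + 3))) ^+ 2.
    rewrite exp_gE exp_lE (exprM g) (exprM l%:R).
    by move: (g ^+ _) (l%:R ^+ _) const_K => x y z; ring.
  have h0 : 0 <= inv_decay M * (Q%:R * M * d%:R) by apply: mulr_ge0; lra.
  by rewrite lerXn2r// nnegrE//; exact: le_trans iq.
have -> : (4 * theta M) ^+ 2 =
  16 * ct%:R ^+ 2 * eta0 ^+ 2 * (inv_decay M * (Q%:R * M * d%:R)) ^+ 2 / eps ^+ 2.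
  rewrite thetaE; move: (inv_decay M) (Q%:R * M * d%:R) => x y.
  by field; rewrite gt_eqF.
rewrite ler_pdivrMr ?exprn_gt0// eta0_sqr.
have n0 := sizeR_gt0; have Lh := Lam_half; have l1 := l_ge1.
have m := master; rewrite C1E /exp_l addnS [l%:R ^+ _.+1]exprS in m.
apply: (@le_trans _ _ (16 * ct%:R ^+ 2 * (ce%:R * (l%:R * Lam) / n%:R) *
   (const_K ^+ 2 * (g ^+ exp_g * l%:R ^+ (12 * N2 + 6))))).
  rewrite ler_wpM2l//; apply: mulr_ge0; first by apply: mulr_ge0 => //; exact: sqr_ge0.
  by apply: divr_ge0 => //; apply: mulr_ge0 => //; apply: mulr_ge0 => //; lra.
rewrite -(ler_pM2r n0).
have -> : 16 * ct%:R ^+ 2 * (ce%:R * (l%:R * Lam) / n%:R) *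
   (const_K ^+ 2 * (g ^+ exp_g * l%:R ^+ (12 * N2 + 6))) * n%:R =
  64 * (ct%:R ^+ 2 * ce%:R * const_K ^+ 2) * (g ^+ exp_g * Lam * (l%:R * l%:R ^+ (12 * N2 + 6))) / 4.
  move: (g ^+ exp_g) (const_K) (_ ^+ (12 * N2 + 6)) => x y z.
  by field; rewrite gt_eqF.
rewrite ler_pdivrMr//; apply: le_trans m _; rewrite le_eqVlt; apply/orP; left; apply/eqP; ring.
Qed.

Section Trial.
Variable M : R.
Hypothesis M_ge1 : 1 <= M.
Local Notation V := (Q%:R * M * d%:R).
Local Notation eps' := (eps / (64 * V)).
Local Notation eta := (2 * (eta0 * inv_decay M)).
Local Notation tau := (n%:R^-1 : R).
Local Notation th := (theta M).

Lemma tau_le : tau <= eta0 * inv_decay M.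
Proof.
apply: le_trans eta0_ge_inv _.
by rewrite ler_peMr ?eta0_ge0// inv_decay_ge1.
Qed.

Lemma th_eps : th * eps = 1152 * (eta0 * inv_decay M) * V.
Proof. by rewrite thetaE divfK ?gt_eqF// ctE !mulrA. Qed.

(** In units of [eta0 * inv_decay M], the noise counts 2 and the tail [1 / n] at most 1; six times 3
    is [18 = 1152 / 64], which explains 1152. *)
Lemma err_le_th_eps' : 6 * (eta + tau) <= th * eps'.
Proof.
have V1 := QMd_ge1 M_ge1; have -> : th * eps' = (th * eps) / (64 * V) by rewrite mulrA.
rewrite th_eps; move: tau_le V1; move: (eta0 * inv_decay M) V => x v h v1.
have -> : 1152 * x * v / (64 * v) = 18 * x by field; rewrite gt_eqF//; lra.
lra.
Qed.

Lemma eps'_gt0 : 0 < eps'.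
Proof. by have V1 := QMd_ge1 M_ge1; apply: divr_gt0 => //; lra. Qed.

Lemma eps'_le : eps' <= 1 / 16.
Proof.
by have V1 := QMd_ge1 M_ge1; rewrite ler_pdivrMr; move: eps_lt1; lra.
Qed.

Lemma err_le_th_eps : 384 * (eta + tau) <= th * eps.
Proof.
have V1 := QMd_ge1 M_ge1; rewrite th_eps; have h := tau_le.
have e0 := eta0_ge0; have i1 := inv_decay_ge1 M_ge1.
have X0 : 0 <= eta0 * inv_decay M by apply: mulr_ge0; lra.
by move: h X0; set x := eta0 * _ => h x0; have := ler_wpM2l x0 V1; lra.
Qed.

Lemma err_lt_th : eta + tau < th.
Proof.
have t0 := theta_gt0 M_ge1; have := err_le_th_eps.
have : th * eps <= th by rewrite ler_piMr// ltW.
move=> h1 h2; lra.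
Qed.

Lemma err_le_eps : th <= 1 + eta -> eta + tau <= eps / 2.
Proof.
move=> h; have t0 := theta_gt0 M_ge1; have h1 := err_le_th_eps.
have tau0 : 0 <= tau by rewrite invr_ge0.
have th2 : th <= 2.
  have : th * eps <= th by rewrite ler_piMr// ltW.
  by move: h h1 tau0; set x := eta; lra.
have : th * eps <= 2 * eps by rewrite ler_wpM2r// ltW.
move: eps_gt0; lra.
Qed.

Lemma mean_err : d%:R * (4 * eps') <= eps.
Proof.
have M1 := M_ge1; have e1 := eps_lt1; have e0 := eps_gt0.
have V1 := QMd_ge1 M_ge1; have Q1 := nbaseR_ge1; have d1 : 1 <= d%:R :> R by rewrite ler1n.
have -> : d%:R * (4 * eps') = eps * (d%:R / (16 * V)).
  by field; apply/and3P; split; rewrite gt_eqF//; lra.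
rewrite ler_piMr ?(ltW e0)// ler_pdivrMr; last by lra.
have : 1 * d%:R <= Q%:R * M * d%:R by rewrite ler_wpM2r// mulr_ege1.
lra.
Qed.

Lemma center_err : d%:R * (8 * M * eps') <= 2 * (1 / (64 * (2 ^ r)%:R)).
Proof.
have M1 := M_ge1; have e1 := eps_lt1; have e0 := eps_gt0.
have Q1 := nbaseR_ge1; have d1 : 1 <= d%:R :> R by rewrite ler1n.
have r1 : 1 <= (2 ^ r)%:R :> R by rewrite ler1n expn_gt0.
have -> : d%:R * (8 * M * eps') = eps / (8 * Q%:R).
  by field; apply/and3P; split; rewrite gt_eqF//; lra.
have h : 4 * (2 ^ r)%:R <= Q%:R :> R.
  rewrite -natrM ler_nat; apply: leq_trans (nbase_ge n_gt0).
  by rewrite leq_mul2r; apply/orP; right.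
rewrite ler_pdivrMr; last by lra.
have -> : 2 * (1 / (64 * (2 ^ r)%:R)) * (8 * Q%:R) = Q%:R / (4 * (2 ^ r)%:R) :> R.
  by field; rewrite gt_eqF//; lra.
apply: (@le_trans _ _ 1); first exact: ltW.
by rewrite ler_pdivlMr; lra.
Qed.

Lemma weight_err : th <= 1 + eta ->
  eta + tau + Q%:R * (m%:R * (d%:R * (4 * M * eps')) ^+ 2) <= eps.
Proof.
have M1 := M_ge1; have e1 := eps_lt1; have e0 := eps_gt0.
move=> h; have h1 := err_le_eps h.
have Q1 := nbaseR_ge1; have d1 : 1 <= d%:R :> R by rewrite ler1n.
have mQ : m%:R <= Q%:R :> R by rewrite ler_nat ndir_le_nbase.
have -> : Q%:R * (m%:R * (d%:R * (4 * M * eps')) ^+ 2) = (m%:R / Q%:R) * (eps * eps) / 256.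
  by field; apply/and3P; split; rewrite gt_eqF//; lra.
have m1 : m%:R / Q%:R <= 1 :> R by rewrite ler_pdivrMr; lra.
have e2 : 0 <= eps * eps by rewrite -expr2 sqr_ge0.
have e3 : eps * eps <= eps by rewrite ler_piMr// ltW.
have : (m%:R / Q%:R) * (eps * eps) <= 1 * (eps * eps) by rewrite ler_wpM2r.
move: h1 eps_gt0; set x := eta; lra.
Qed.

Lemma trial_facts :
  [/\ 0 <= eta, 6 * (eta + tau) <= th * eps', 0 < eps', eps' <= 1 / 16
    & [/\ 0 < th, eta + tau < th, d%:R * (4 * eps') <= eps,
          d%:R * (8 * M * eps') <= 2 * (1 / (64 * (2 ^ r)%:R))
        & th <= 1 + eta ->
          eta + tau + Q%:R * (m%:R * (d%:R * (4 * M * eps')) ^+ 2) <= eps]].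
Proof.
have i1 := inv_decay_ge1 M_ge1; have e0 := eta0_ge0.
split; [|exact: err_le_th_eps'|exact: eps'_gt0|exact: eps'_le|].
  by apply: mulr_ge0 => //; apply: mulr_ge0 => //; lra.
split; [exact: theta_gt0|exact: err_lt_th|exact: mean_err|exact: center_err|].
exact: weight_err.
Qed.

End Trial.

Lemma rate_facts :
  [/\ 256 * (Lam * g ^+ 2) <= n%:R, 128 * g ^+ 2 <= n%:R, (128 <= n)%N, (d <= n)%N
    & [/\ (2 * k <= n)%N, B <= n%:R, eta0 ^+ 2 = ce%:R * (l%:R * Lam) / n%:R, 0 < eta0 <= 1
        & forall M : R, 1 <= M -> M <= 7 * g ^+ 2 -> 4 * theta M <= wmin]].
Proof.
split; [exact: n_ge_Lam_g2|exact: n_ge_g2|exact: n_ge128|exact: d_le_n|].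
split; [exact: k_le_n|exact: B_le_n|exact: eta0_sqr| |exact: theta_le_wmin].
by rewrite eta0_gt0 eta0_le1.
Qed.

End Rates.

(** * Union bounds and the range of useful trials *)

Section Budgets.
Variables (R : realType) (d k n : nat) (gamma delta : R).
Local Notation l := (ell n).
Local Notation r := (loglog n).
Local Notation m := (ndir n).
Local Notation Q := (nbase n).
Local Notation Lam := (ln (2 / delta)).
Local Notation g := (d%:R + gamma^-1).
Hypotheses (n_gt0 : (0 < n)%N) (d_gt0 : (0 < d)%N) (k_gt0 : (0 < k)%N).
Hypotheses (d_le_n : (d <= n)%N) (k_le_n : (2 * k <= n)%N).

Lemma sizes_bound : sizes d k n m Q (2 ^ (48 * l)).
Proof.
have l0 := ell_gt0 n_gt0; have nl := ltn_ell n.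
have n2 : (2 ^ l * 2 ^ l * 2 ^ l <= 2 ^ (48 * l))%N.
  by rewrite -!expnD leq_exp2l//; lia.
have QE := nbase_gt0 n; have Qm := expn_nbase_le n_gt0.
have ml := ndir_le_ell n.
have ll : (l < 2 ^ l)%N by apply: ltn_expl.
have a2 : (2 <= 2 ^ l)%N by rewrite -[X in (X <= _)%N]/(2 ^ 1)%N leq_exp2l.
have aS : (2 ^ l <= 2 ^ (48 * l))%N by rewrite leq_exp2l//; lia.
have dk : (k * d.+1 <= 2 ^ l * 2 ^ l)%N by apply: leq_mul; [move: k_le_n nl; lia|move: d_le_n nl; lia].
have md : (m * d <= 2 * 2 ^ l * 2 ^ l)%N.
  by apply: leq_mul; [move: ml ll; lia|move: d_le_n nl; lia].
have e3 : (2 * 2 ^ l * 2 ^ l <= 2 ^ l * 2 ^ l * 2 ^ l)%N by rewrite !leq_mul2r a2 !orbT.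
have e2 : (2 ^ l * 2 ^ l <= 2 * 2 ^ l * 2 ^ l)%N by rewrite leq_mul2r leq_pmull ?orbT.
have m2 : (m <= m * d)%N by rewrite leq_pmulr.
move: (leq_trans md (leq_trans e3 n2)) (leq_trans dk (leq_trans e2 (leq_trans e3 n2))).
move: d_le_n k_le_n nl aS Qm m2; set S := (2 ^ (48 * l))%N; set a := (2 ^ l)%N.
by move=> h1 h2 h3 h4 h5 h6 h7 h8; split=> //; [..|split]; lia.
Qed.

Hypotheses (delta_gt0 : 0 < delta) (delta_lt1 : delta < 1).

Lemma ln2_le_Lam : ln 2 <= Lam.
Proof.
by rewrite ler_ln ?posrE ?divr_gt0// ler_pdivlMr//; move: delta_lt1; lra.
Qed.

Lemma half_le_Lam : 1 / 2 <= Lam.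
Proof. exact: le_trans (ln2_ge R) ln2_le_Lam. Qed.

Lemma expR_NLam : expR (- Lam) = delta / 2.
Proof. by rewrite expRN lnK ?posrE ?divr_gt0// invf_div. Qed.

(** The factor counts trials, scales, coordinates and digit vectors; the 4 stands for cosine or sine
    and for the two-sided tail. The count is at most [2 ^ (54 * l)], hence at most
    [expR (54 * l * Lam)] with [Lam = ln (2 / delta)]. Out of the exponent [60 * l * Lam] at least
    [Lam] remains. *)
Lemma noise_budget (eta0 : R) : eta0 ^+ 2 = (128 * 60)%N%:R * (l%:R * Lam) / n%:R ->
  (4 * (n * (n.+2 * (d * Q ^ m))))%N%:R * expR (- (n%:R * (eta0 ^+ 2 / 128))) <= delta / 2.
Proof.
move=> ->; have n0 : 0 < n%:R :> R by rewrite ltr0n.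
have nl := ltn_ell n; have l0 := ell_gt0 n_gt0.
have nat_le : (4 * (n * (n.+2 * (d * Q ^ m))) <= 2 ^ (54 * l))%N.
  have h1 : (n.+2 <= 2 * 2 ^ l)%N by lia.
  have h2 := leq_mul (leq_trans d_le_n (ltnW nl)) (expn_nbase_le n_gt0).
  have h3 := leq_mul (ltnW nl) (leq_mul h1 h2).
  apply: leq_trans (leq_mul (leqnn 4) h3) _.
  have -> : (4 * (2 ^ l * (2 * 2 ^ l * (2 ^ l * 2 ^ (48 * l)))) =
     2 ^ (2 + (l + (1 + l + (l + 48 * l)))))%N by rewrite !expnD.
  rewrite leq_exp2l//.
  by move: l0; clear; move: (ell n) => x; lia.
have L0 := half_le_Lam; have l1 : 1 <= l%:R :> R by rewrite ler1n.
apply: (@le_trans _ _ (expR ((54 * l)%N%:R * Lam) * expR (- (60 * (l%:R * Lam))))).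
  have -> : n%:R * ((128 * 60)%N%:R * (l%:R * Lam) / n%:R / 128) = 60 * (l%:R * Lam).
    by rewrite natrM; field; rewrite gt_eqF.
  rewrite ler_wpM2r ?expR_ge0//.
  apply: (@le_trans _ _ (expR ((54 * l)%N%:R * ln 2))); last first.
    by rewrite ler_expR ler_wpM2l// ln2_le_Lam.
  by rewrite expRM_natl lnK ?posrE// -natrX ler_nat.
rewrite -expRD -expR_NLam ler_expR natrM.
have : 1 * Lam <= l%:R * Lam by rewrite ler_wpM2r//; lra.
lra.
Qed.

(** As [2 * k <= 2 ^ l] and [r * m >= 2 * l], each trial contributes a factor at most 1/4, and
    [4 ^ - L] is at most [expR (- L) <= delta / 2]. *)
Lemma coin_budget (L : nat) : Lam <= L%:R ->
  ((k * k) ^ L)%N%:R / (2 ^ (L * m * r))%N%:R <= delta / 2.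
Proof.
move=> LL; have L0 : (0 < L)%N by rewrite -(ltr_nat R); have := half_le_Lam; lra.
have h : ((k * k) ^ L * 4 ^ L <= 2 ^ (L * m * r))%N.
  have -> : (L * m * r = m * r * L)%N by rewrite -mulnA mulnC.
  rewrite expnM -expnMn leq_exp2r//.
  apply: (@leq_trans (2 ^ (2 * l))); last by rewrite leq_exp2l// [X in (_ <= X)%N]mulnC ndir_ge.
  have kl : (2 * k <= 2 ^ l)%N := leq_trans k_le_n (ltnW (ltn_ell n)).
  by rewrite [(2 * l)%N]mulnC expnM -mulnn; have := leq_mul kl kl; lia.
have p4 : 0 < 4 ^+ L :> R by rewrite exprn_gt0.
have p2 : 0 < (2 ^ (L * m * r))%N%:R :> R by rewrite ltr0n expn_gt0.
apply: (@le_trans _ _ (4 ^+ L)^-1).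
  rewrite ler_pdivrMr// mulrC ler_pdivlMr//.
  by rewrite -natrX -natrM ler_nat.
rewrite -expR_NLam expRN lef_pV2 ?posrE ?expR_gt0//.
apply: (@le_trans _ _ (expR L%:R)); first by rewrite ler_expR.
rewrite -[L%:R]mulr1 expRM_natl; apply: lerXn2r; rewrite ?nnegrE ?expR_ge0//.
exact: expR1_le4.
Qed.

Hypothesis gamma_gt0 : 0 < gamma.

(** The scale grows by [1 / Lam] per trial. It has reached [d / gamma] at trial [t0], and the [L]
    trials from there on, just over [Lam] in number, raise it by no more than 1. *)
Lemma trial_range : 256 * (Lam * g ^+ 2) <= n%:R -> exists t0 L : nat,
  [/\ Lam <= L%:R, (t0 + L <= n)%N & forall t, (t < L)%N ->
    d%:R / gamma <= trial_M delta (t0 + t) <= 7 * g ^+ 2].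
Proof.
move=> hn; have L1 := half_le_Lam.
have d1 : 1 <= d%:R :> R by rewrite ler1n.
have gi : 0 < gamma^-1 by rewrite invr_gt0.
have g1 : 1 <= g by lra.
have dg : d%:R * gamma^-1 <= g ^+ 2.
  have h : 0 <= d%:R * gamma^-1 by rewrite mulr_ge0// ltW.
  by rewrite expr2; have := ltW gi; nra.
have dg0 : 0 <= d%:R * gamma^-1 by rewrite mulr_ge0// ltW.
pose t0 := (Num.truncn (Lam * (d%:R / gamma))).+1; pose L := (Num.truncn Lam).+1.
have X0 : 0 <= Lam * (d%:R / gamma) by apply: mulr_ge0 => //; lra.
have L0 : 0 <= Lam by lra.
have /andP[t1 t2] := Num.Theory.truncn_itv X0.
have /andP[l1 l2] := Num.Theory.truncn_itv L0.
rewrite -/t0 in t2; rewrite -/L in l2.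
have t0E : t0%:R <= Lam * (d%:R / gamma) + 1 by rewrite /t0 -natr1 lerD2r.
have LE : L%:R <= Lam + 1 by rewrite /L -natr1 lerD2r.
have gg : 1 <= g ^+ 2 by rewrite exprn_ege1.
have Ldg : Lam * (d%:R / gamma) <= Lam * g ^+ 2 by rewrite ler_wpM2l.
have Lg : Lam * 1 <= Lam * g ^+ 2 by rewrite ler_wpM2l.
exists t0, L; split; first exact: ltW.
  rewrite -(ler_nat R) natrD; lra.
move=> t tL; rewrite /trial_M.
have tR : t%:R <= Lam.
  by apply: le_trans l1; rewrite ler_nat -ltnS.
have Lp : 0 < Lam by lra.
apply/andP; split.
  apply: (@le_trans _ _ ((t0 + t)%N%:R / Lam)); last by rewrite lerDr.
  rewrite ler_pdivlMr// mulrC natrD; have : 0 <= t%:R :> R by []; lra.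
have : (t0 + t)%N%:R / Lam <= 4 * g ^+ 2.
  rewrite ler_pdivrMr// natrD; lra.
lra.
Qed.

(** With [g ^ 2], [B] and [2 ^ r] all [O(n)], the scaled gaps times [2 ^ r] are at most
    [4 * n ^ 3 <= 2 ^ n], which leaves room for [r] bits. *)
Lemma exp_room (B : R) : 128 * g ^+ 2 <= n%:R -> (16 <= n)%N -> 0 <= B -> B <= n%:R ->
  7 * g ^+ 2 * (2 * B) <= 2 ^+ (n - r) /\ (r <= n)%N.
Proof.
move=> hg n16 B0 Bn.
have rn : (r <= n)%N.
  apply: leq_trans (loglog_le n) _.
  by apply: up_log_min => //; apply: ltn_expl.
split=> //.
have r0 : 0 < 2 ^+ r :> R by rewrite exprn_gt0.
rewrite -(ler_pM2r r0) -exprD subnK//.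
have c := cube_le_exp2 n16; rewrite -(ler_nat R) !natrM natrX in c.
apply: le_trans c.
have r2 : 2 ^+ r <= 2 * n%:R :> R.
  rewrite -natrX -natrM ler_nat; apply: leq_trans (expn_loglog_le n_gt0) _.
  by rewrite leq_mul2l /=; apply: up_log_min => //; apply: ltn_expl.
have g0 : 0 <= g ^+ 2 by rewrite sqr_ge0.
have n0 : 0 <= n%:R :> R by [].
have h1 : 7 * g ^+ 2 * (2 * B) <= n%:R * (2 * n%:R).
  by apply: ler_pM; [lra|lra|lra|rewrite ler_wpM2l].
have h2 : 7 * g ^+ 2 * (2 * B) * 2 ^+ r <= n%:R * (2 * n%:R) * (2 * n%:R).
  by apply: ler_pM => //; apply: mulr_ge0; lra.
apply: le_trans h2 _; rewrite le_eqVlt; apply/orP; left; apply/eqP; ring.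
Qed.

End Budgets.

(** * The failure event and the theorem *)

Local Open Scope complex_scope.

Section CharacteristicFunction.
Variables (R : realType) (d k : nat) (D : probability (d.-tuple R) R).
Variables (w : 'I_k -> R) (mu : 'I_k -> d.-tuple R).

Definition wave (c : bool) (t x : d.-tuple R) : R :=
  if c then cos (inner t x) else sin (inner t x).

Lemma measurable_inner (t : d.-tuple R) : measurable_fun setT (inner t).
Proof.
apply: measurable_sum => i; apply: measurable_funM => //.
exact: measurable_tnth.
Qed.

Lemma measurable_wave c t : measurable_fun setT (wave c t).
Proof.
case: c; rewrite /wave.
  apply: (measurableT_comp (f := cos)); last exact: measurable_inner.
  by apply: continuous_measurable_fun; exact: continuous_cos.
apply: (measurableT_comp (f := sin)); last exact: measurable_inner.
by apply: continuous_measurable_fun; exact: continuous_sin.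
Qed.

Lemma wave_le1 c t x : `|wave c t x| <= 1.
Proof. by case: c; rewrite ler_norml ?cos_geN1 ?cos_le1 ?sin_geN1 ?sin_le1. Qed.

Lemma integrable_wave c t : D.-integrable setT (EFin \o wave c t).
Proof. exact: integrable_bounded (measurable_wave c t) (wave_le1 c t). Qed.

Lemma inner_vadd (t x y : d.-tuple R) : inner t (vadd x y) = inner t x + inner t y.
Proof.
by rewrite /inner -big_split; apply: eq_bigr => i _; rewrite tnth_mktuple mulrDr.
Qed.

(** Translation multiplies a characteristic function by a phase. The addition formulas carry this
    out on the real integrals of cosine and sine. *)
Lemma mix_mean_wave t :
  mix_mean D w mu (wave true t) +i* mix_mean D w mu (wave false t) =
  charfun D t * mix_cf w mu t.
Proof.
have E j : Rintegral D setT (fun x => wave true t (vadd x (mu j))) =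
     complex.Re (charfun D t) * cos (inner t (mu j)) - complex.Im (charfun D t) * sin (inner t (mu j))
  /\ Rintegral D setT (fun x => wave false t (vadd x (mu j))) =
     complex.Re (charfun D t) * sin (inner t (mu j)) + complex.Im (charfun D t) * cos (inner t (mu j)).
  have iZ c (a : R) : D.-integrable setT (EFin \o (fun x => wave c t x * a)).
    apply: (@integrable_bounded _ _ _ _ _ `|a|).
      by apply: measurable_funM => //; exact: measurable_wave.
    by move=> x; rewrite normrM ler_piMl// wave_le1.
  rewrite /charfun /=; split.
    under eq_Rintegral do rewrite /wave inner_vadd cosD.
    rewrite (@RintegralB _ _ _ _ _ (fun x => wave true t x * cos (inner t (mu j)))
       (fun x => wave false t x * sin (inner t (mu j))))//.
    by rewrite !RintegralZr//; exact: integrable_wave.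
  under eq_Rintegral do rewrite /wave inner_vadd sinD addrC.
  rewrite (@RintegralD _ _ _ _ _ (fun x => wave true t x * sin (inner t (mu j)))
       (fun x => wave false t x * cos (inner t (mu j))))//.
  by rewrite !RintegralZr//; exact: integrable_wave.
rewrite /mix_cf mulr_sumr /mix_mean.
have -> : \sum_(j < k) charfun D t * ((w j)%:C * cis (inner t (mu j))) =
  \sum_j ((w j * Rintegral D setT (fun x => wave true t (vadd x (mu j)))) +i*
          (w j * Rintegral D setT (fun x => wave false t (vadd x (mu j))))).
  apply: eq_bigr => j _; have [-> ->] := E j.
  case: (charfun D t) => p q; apply/eqP; rewrite eq_complex /=.
  by apply/andP; split; apply/eqP; ring.
by apply/eqP; rewrite eq_complex !raddf_sum /= !eqxx.
Qed.

(** The exponents are rounded up to naturals because the program evaluates only fixed integer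
    powers; as [d] and [T] are at least 1, this only weakens the bound. *)
Lemma charfun_ge (c0 c1 c2 T : R) (N0 N1 N2 : nat) (t : d.-tuple R) :
  0 < c0 -> (0 < d)%N -> slow_fourier_decay c0 c1 c2 D ->
  c0^-1 <= N0%:R -> c1 <= N1%:R -> c2 <= N2%:R -> 1 <= T -> norm2 t <= T ->
  (N0%:R * (d%:R ^+ N1 * T ^+ N2))^-1 <= cmod (charfun D t).
Proof.
move=> c00 d0 sfd h0 h1 h2 T1 tT.
have d1 : 1 <= d%:R :> R by rewrite ler1n.
apply: (@le_trans _ _ (c0 * d%:R `^ (- c1) * T `^ (- c2))); last first.
  apply: le_trans (sfd T T1) _; apply: ge_inf; last by exists t.
  by exists 0 => _ [s _ <-]; exact: cmod_ge0.
have p (a c : R) N : 1 <= a -> c <= N%:R -> (a ^+ N)^-1 <= a `^ (- c).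
  move=> a1 cN; rewrite -powR_mulrn; last by lra.
  by rewrite -powRN; apply: ler_powR => //; rewrite lerN2.
have a0 (a : R) N : 1 <= a -> 0 <= (a ^+ N)^-1 by move=> a1; rewrite invr_ge0 exprn_ge0//; lra.
have n0 : 0 < N0%:R :> R by apply: lt_le_trans h0; rewrite invr_gt0.
rewrite invfM invfM -mulrA; apply: ler_pM.
- by rewrite invr_ge0 ltW.
- by apply: mulr_ge0; exact: a0.
- by rewrite -[c0]invrK lef_pV2 ?posrE ?invr_gt0.
- by apply: ler_pM; [exact: a0|exact: a0|exact: p|exact: p].
Qed.

Variables (disp : measure_display) (Omega : measurableType disp).
Variables (P : probability Omega R) (n : nat) (X : 'I_n -> {RV P >-> d.-tuple R}).

Lemma sample_atE (x : 'I_n -> d.-tuple R) (l : 'I_n) (j : 'I_d) :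
  sample_at x l j = tnth (x l) j.
Proof.
rewrite /sample_at; have sz : (l < size (enum 'I_n))%N by rewrite size_enum_ord.
by rewrite (nth_map l) ?size_enum_ord// nth_ord_enum -tnth_nth.
Qed.

Lemma noise_of_no_dev (eta0 : R) t omega : charfun D t != 0 ->
  (forall c, ~ dev_event D w mu X (wave c t) eta0 omega) ->
  cmod (ecf (sample_at (fun i => X i omega)) n t / charfun D t - mix_cf w mu t) <=
  2 * eta0 / cmod (charfun D t).
Proof.
move=> phi0 nodev.
have p0 : 0 < cmod (charfun D t).
  rewrite lt_neqAle cmod_ge0 andbT eq_sym; apply: contraNneq phi0 => h.
  by apply/eqP; exact: Normc.eq0_normc.
have -> : ecf (sample_at (fun i => X i omega)) n t / charfun D t - mix_cf w mu t =
   (ecf (sample_at (fun i => X i omega)) n t - charfun D t * mix_cf w mu t) / charfun D t.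
  by rewrite mulrBl [charfun D t * _]mulrC mulfK.
rewrite Normc.normcM Normc.normcV ler_wpM2r ?invr_ge0 ?cmod_ge0//.
rewrite -mix_mean_wave.
have -> : ecf (sample_at (fun i => X i omega)) n t =
   ((\sum_i wave true t (X i omega)) / n%:R) +i* ((\sum_i wave false t (X i omega)) / n%:R).
  rewrite /ecf.
  have -> : \sum_(l < n) cis (\sum_(j < d) tnth t j * sample_at (fun i => X i omega) l j) =
    (\sum_i wave true t (X i omega)) +i* (\sum_i wave false t (X i omega)).
    have -> : \sum_(l < n) cis (\sum_(j < d) tnth t j * sample_at (fun i => X i omega) l j) =
       \sum_(l < n) cis (inner t (X l omega)).
      apply: eq_bigr => l _; congr cis; apply: eq_bigr => j _.
      by rewrite (sample_atE (fun i => X i omega)).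
    by apply/eqP; rewrite eq_complex !raddf_sum /= !eqxx.
  have -> : n%:R^-1 = (n%:R^-1)%:C :> R[i] by rewrite fmorphV rmorph_nat.
  move: (\sum_i _) (\sum_i wave false _ _) => a b.
  by apply/eqP; rewrite eq_complex /=; apply/andP; split; apply/eqP; ring.
apply: le_trans (ler_cmod_ReIm _) _ => /=.
have h c : `|(\sum_i wave c t (X i omega)) / n%:R - mix_mean D w mu (wave c t)| <= eta0.
  by rewrite leNgt; apply/negP; exact: nodev.
by have := h true; have := h false; lra.
Qed.

End CharacteristicFunction.

Local Close Scope complex_scope.

Section Frequencies.
Variables (R : realType) (d m n Q : nat).

(** Index 0 is the scale 0, at which masses are measured; the others are the [n + 1] scales of the
    refinement. *)
Definition scale (a : nat) : R := if a is l.+1 then 2 ^+ l / 2 ^+ n else 0.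

Lemma used_scaleP (s : R) : used_scale n s -> exists a : 'I_n.+2, s = scale a.
Proof.
case=> [->|[l ln ->]]; first by exists ord0.
by exists (@Ordinal n.+2 l.+1 ln).
Qed.

Lemma used_scale_le1 (s : R) : used_scale n s -> `|s| <= 1.
Proof.
case=> [->|[l ln ->]]; first by rewrite normr0.
rewrite ger0_norm; last by rewrite divr_ge0// exprn_ge0.
by rewrite ler_pdivrMr ?exprn_gt0// mul1r ler_weXn2l// ler1n.
Qed.

Lemma freq_ext (u u' : nat -> R) s j0 x :
  (forall y, (y < m * d)%N -> u y = u' y) -> freq d m Q u s j0 x = freq d m Q u' s j0 x.
Proof.
move=> uu; apply: eq_from_tnth => j; rewrite !tnth_mktuple /freq_coord; congr (_ + _).
apply: eq_bigr => i _; rewrite uu//.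
by have := ltn_ord i; have := ltn_ord j; nia.
Qed.

Lemma dirdot_ext (u u' : nat -> R) (x : d.-tuple R) (i : 'I_m) :
  (forall y, (y < m * d)%N -> u y = u' y) -> dirdot u x i = dirdot u' x i.
Proof.
move=> uu; apply: eq_bigr => j _; rewrite uu//.
by have := ltn_ord i; have := ltn_ord j; nia.
Qed.

Lemma norm_freq_le (u : nat -> R) (M s : R) j0 x :
  (0 < d)%N -> (m <= Q)%N -> (0 < Q)%N -> 1 <= M -> `|s| <= 1 ->
  (forall y, (y < m * d)%N -> `|u y| <= 2 * M) ->
  norm2 (freq d m Q u s j0 x) <= 4 * (Q%:R * Q%:R) * (M * d%:R).
Proof.
move=> d0 mQ Q0 M1 s1 uM.
have Q1 : 1 <= Q%:R :> R by rewrite ler1n.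
have mQR : m%:R <= Q%:R :> R by rewrite ler_nat.
have -> : 4 * (Q%:R * Q%:R) * (M * d%:R) = d%:R * (4 * (Q%:R * Q%:R) * M) :> R by ring.
have QQ : 1 <= Q%:R * Q%:R :> R by apply: mulr_ege1.
have QQM : Q%:R * Q%:R * 1 <= Q%:R * Q%:R * M :> R by rewrite ler_wpM2l//; lra.
apply: norm2_le => //; first by rewrite -mulrA; lra.
move=> j; rewrite tnth_mktuple /freq_coord.
have t1 : `|if val j == j0 then s else 0| <= 1 by case: ifP => // _; rewrite normr0.
have t2 : `|\sum_(i < m) (digit Q x i)%:R * u (i * d + j)%N| <= m%:R * (Q%:R * (2 * M)).
  apply: le_trans (ler_norm_sum _ _ _) _.
  rewrite -[X in _ <= X%:R * _]card_ord -sum1_card natr_sum mulr_suml.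
  apply: ler_sum => i _; rewrite mul1r normrM; apply: ler_pM => //.
    by rewrite normr_nat ler_nat ltnW// ltn_pmod.
  by apply: uM; have := ltn_ord i; have := ltn_ord j; nia.
apply: le_trans (ler_normD _ _) _; apply: le_trans (lerD t1 t2) _.
have : m%:R * (Q%:R * (2 * M)) <= Q%:R * (Q%:R * (2 * M)).
  by rewrite ler_wpM2r// mulr_ge0//; lra.
lra.
Qed.

Lemma bit_dir_le (beta : nat -> bool) (M : R) start x : 0 <= M ->
  `|bit_dir n beta M start x| <= 2 * M.
Proof.
move=> M0; rewrite /bit_dir; apply: le_trans (ler_norm_sum _ _ _) _.
have : \sum_(b < n) M / 2 ^+ b <= 2 * M - M / 2 ^+ n * 2.
  elim: n => [|N IH]; first by rewrite big_ord0 expr0; lra.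
  rewrite big_ord_recr /= exprS.
  have -> : M / (2 * 2 ^+ N) * 2 = M / 2 ^+ N by field; rewrite expf_neq0.
  lra.
have : 0 <= M / 2 ^+ n * 2 by rewrite mulr_ge0// divr_ge0// exprn_ge0.
have : \sum_(b < n) `|if beta (start + (x * n + b))%N then 0 else M / 2 ^+ b| <=
   \sum_(b < n) M / 2 ^+ b.
  apply: ler_sum => b _; have h : 0 <= M / 2 ^+ b by rewrite divr_ge0// exprn_ge0.
  by case: ifP => _; rewrite ?normr0// ger0_norm.
lra.
Qed.

End Frequencies.

(** * The failure event and its probability *)

Section GoodEvent.
Variables (R : realType) (d k n N0 N1 N2 ce ct : nat).
Variables (D : probability (d.-tuple R) R) (w : 'I_k -> R) (mu : 'I_k -> d.-tuple R).
Variables (c0 c1 c2 gamma wmin eps delta : R).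
Variables (disp : measure_display) (Omega : measurableType disp).
Variables (P : probability Omega R).
Variables (X : 'I_n -> {RV P >-> d.-tuple R}) (U : nat -> {RV P >-> R}).
Local Notation l := (ell n).
Local Notation r := (loglog n).
Local Notation m := (ndir n).
Local Notation Q := (nbase n).
Local Notation block := (m * d * n)%N.
Local Notation N := (n * block)%N.
Local Notation g := (d%:R + gamma^-1).
Local Notation eta0 := (eta0 ce n l delta).
Local Notation inv_decay M := (inv_decay N0 N1 N2 d Q M).
Local Notation theta M := (theta N0 N1 N2 ce ct d n Q l eps delta M).
Local Notation trial_M := (trial_M delta).
Local Notation rho := (1 / (64 * 2 ^+ r) : R).
Variables (t0 L : nat).

Definition test_freq (b : {ffun 'I_N -> bool}) (tau x a j0 : nat) : d.-tuple R :=
  freq d m Q (bit_dir n (coin_bits b) (trial_M tau) (tau * block)) (scale R n a) j0 x.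

Definition noisy_index : finType :=
  ({ffun 'I_N -> bool} * ('I_n * ('I_n.+2 * ('I_d * 'I_(Q ^ m)))) * bool)%type.

(** Once a coin pattern is fixed, the frequency is deterministic and the deviation bound applies.
    The factor [2 ^ - N] in that bound compensates the sum over all patterns. *)
Definition noisy (z : noisy_index) : set Omega :=
  let: (b, (tau, (a, (j0, x))), c) := z in
  dev_event D w mu X (wave c (test_freq b tau x a j0)) eta0 `&` coin_event U b.

(** Merging counts only if it occurs in all of the [L] useful trials, since one separating trial is
    enough. Noise is excluded in all [n] trials, because any of them may be the one that delivers
    the output. *)
Definition failure : set Omega :=
  some_of (mem (bad_patterns m n L t0 mu trial_M rho)) (fun b => coin_event U b) `|`
  some_of xpredT noisy.

Hypotheses (w_gt0 : forall j, 0 < w j) (sum_w : \sum_(j < k) w j = 1).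
Hypothesis XU : iid_samples_and_coins (mixture D w mu) X U.
Hypotheses (n_gt0 : (0 < n)%N) (d_gt0 : (0 < d)%N) (k_gt0 : (0 < k)%N).
Hypothesis eta0_itv : 0 < eta0 <= 1.

Lemma pr_coin_event (b : {ffun 'I_N -> bool}) :
  measurable (coin_event U b) /\ fine (P (coin_event U b)) = 2 ^- N.
Proof.
have [mb pb] := pr_joint XU b (fun i : 'I_n => @measurableT _ (d.-tuple R)).
have E : [set x | forall i : 'I_n, [set: d.-tuple R] (X i x)] `&` coin_event U b = coin_event U b.
  by apply/seteqP; split=> x // [].
rewrite E in mb pb; split=> //; rewrite pb big1 ?mul1r// => i _.
by rewrite preimage_setT probability_setT.
Qed.

Lemma measurable_noisy z : measurable (noisy z).
Proof.
case: z => [[b [tau [a [j0 x]]]] c] /=; apply: measurableI; last by have [] := pr_coin_event b.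
exact: measurable_dev_event (measurable_wave _ _) _.
Qed.

Lemma measurable_failure : measurable failure.
Proof.
apply: measurableU; apply: measurable_some_of; last exact: measurable_noisy.
by move=> b; have [] := pr_coin_event b.
Qed.

Lemma pr_failure_le :
  (#|bad_patterns m n L t0 mu trial_M rho|%:R / 2 ^+ N <= delta / 2) ->
  (4 * (n * (n.+2 * (d * Q ^ m))))%N%:R * expR (- (n%:R * (eta0 ^+ 2 / 128))) <= delta / 2 ->
  fine (P failure) <= delta.
Proof.
move=> bad_le noise_le.
have mb (b : {ffun 'I_N -> bool}) : measurable (coin_event U b) by have [] := pr_coin_event b.
have h1 : fine (P (some_of (mem (bad_patterns m n L t0 mu trial_M rho))
    (fun b => coin_event U b))) <= delta / 2.
  apply: le_trans (pr_some_of_le P _ mb) _.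
  apply: le_trans bad_le; rewrite (eq_bigr (fun=> 2 ^- N)).
    rewrite sumr_const -[leLHS]mulr_natl le_eqVlt; apply/orP; left; apply/eqP; congr (_%:R / _); exact: eq_card.
  by move=> b _; have [] := pr_coin_event b.
have h2 : fine (P (some_of xpredT noisy)) <= delta / 2.
  apply: le_trans (pr_some_of_le P _ measurable_noisy) _.
  apply: le_trans noise_le; set E := expR _.
  apply: (@le_trans _ _ (\sum_(z : noisy_index) 2 * E * 2 ^- N)).
    apply: ler_sum => -[[b [tau [a [j0 x]]]] c] _ /=.
    apply: pr_dev_le => //; last exact: wave_le1.
      by move=> j; exact: ltW.
    exact: measurable_wave.
  rewrite sumr_const /noisy_index !card_prod card_ffun card_bool !card_ord -[leLHS]mulr_natl.
  rewrite !natrM !natrX; have p2 : 2 ^+ N != 0 :> R by rewrite expf_neq0.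
  rewrite le_eqVlt; apply/orP; left; apply/eqP.
  by move: p2; set p := 2 ^+ N => p2; field.
rewrite -lee_fin fine_prK; last exact: measurable_failure.
apply: le_trans (measureU2 P _ _) _; [exact: measurable_some_of|exact: measurable_some_of measurable_noisy|].
rewrite -[X in (X + _ <= _)%E]fine_prK; last exact: measurable_some_of.
rewrite -[X in (_ + X <= _)%E]fine_prK; last exact: measurable_some_of measurable_noisy.
by rewrite -EFinD lee_fin; lra.
Qed.

End GoodEvent.

(** * Accuracy outside the failure event *)

Section Accuracy.
Variables (R : realType) (d k n N0 N1 N2 ce ct : nat).
Variables (D : probability (d.-tuple R) R) (w : 'I_k -> R) (mu : 'I_k -> d.-tuple R).
Variables (c0 c1 c2 gamma wmin eps delta : R).
Variables (disp : measure_display) (Omega : measurableType disp).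
Variables (P : probability Omega R).
Variables (X : 'I_n -> {RV P >-> d.-tuple R}) (U : nat -> {RV P >-> R}).
Local Notation l := (ell n).
Local Notation r := (loglog n).
Local Notation m := (ndir n).
Local Notation Q := (nbase n).
Local Notation block := (m * d * n)%N.
Local Notation N := (n * block)%N.
Local Notation g := (d%:R + gamma^-1).
Local Notation eta0 := (eta0 ce n l delta).
Local Notation inv_decay M := (inv_decay N0 N1 N2 d Q M).
Local Notation theta M := (theta N0 N1 N2 ce ct d n Q l eps delta M).
Local Notation trial_M := (trial_M delta).
Local Notation rho := (1 / (64 * 2 ^+ r) : R).
Variables (t0 L : nat).
Hypotheses (n_gt0 : (0 < n)%N) (d_gt0 : (0 < d)%N) (k_gt0 : (0 < k)%N) (N0_gt0 : (0 < N0)%N).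
Hypotheses (ceE : ce = (128 * 60)%N) (ctE : ct = 1152%N).
Hypotheses (eps_gt0 : 0 < eps) (eps_lt1 : eps < 1) (delta_gt0 : 0 < delta) (delta_lt1 : delta < 1).
Hypotheses (w_gt0 : forall j, 0 < w j) (sum_w : \sum_(j < k) w j = 1).
Hypothesis wmin_le : forall j, wmin <= w j.
Hypotheses (c0_gt0 : 0 < c0) (sfd : slow_fourier_decay c0 c1 c2 D).
Hypotheses (N0_ge : c0^-1 <= N0%:R) (N1_ge : c1 <= N1%:R) (N2_ge : c2 <= N2%:R).
Hypothesis theta_wmin : forall M : R, 1 <= M -> M <= 7 * g ^+ 2 -> 4 * theta M <= wmin.
Hypothesis tLn : (t0 + L <= n)%N.
Hypothesis M_itv : forall t, (t < L)%N -> d%:R / gamma <= trial_M (t0 + t) <= 7 * g ^+ 2.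
Hypothesis mu_small : forall j (j0 : 'I_d), `|tnth (mu j) j0| <= 2 ^+ n.-1.

Variable omega : Omega.
Local Notation sample := (sample_at (fun i => X i omega)).
Local Notation coin := (fun i => U i omega).
Hypothesis good : ~ failure ce D w mu delta X U t0 L omega.

Definition outcome : {ffun 'I_N -> bool} := [ffun i : 'I_N => U i omega < 1 / 2].

Lemma outcome_event : coin_event U outcome omega.
Proof. by move=> i; rewrite /half /= ffunE. Qed.

Lemma no_dev (tau a j0 x : nat) c : (tau < n)%N -> (a < n.+2)%N -> (j0 < d)%N -> (x < Q ^ m)%N ->
  ~ dev_event D w mu X (wave c (test_freq delta outcome tau x a j0)) eta0 omega.
Proof.
move=> h1 h2 h3 h4 dev; apply: good; right.
exists (outcome, (Ordinal h1, (Ordinal h2, (Ordinal h3, Ordinal h4))), c) => //=.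
by split=> //; exact: outcome_event.
Qed.

Lemma gen_dir_outcome (M : R) tau y : (tau < n)%N -> (y < m * d)%N ->
  gen_dir n coin M (tau * block) y = bit_dir n (coin_bits outcome) M (tau * block) y.
Proof.
move=> tn yd; apply: eq_bigr => b _; rewrite /coin_bits.
have lN : (tau * block + (y * n + b) < N)%N.
  have h1 : (y * n + b < block)%N by have := ltn_ord b; move: (m * d)%N yd => z yd; nia.
  have : (tau * block + block <= N)%N by rewrite -mulSnr leq_mul2r tn orbT.
  by move: h1; move: (y * n + b)%N block => p q; lia.
by rewrite insubT ffunE.
Qed.

Lemma trial_M_ge1 tau : 1 <= trial_M tau.
Proof.
by rewrite /trial_M lerDl divr_ge0//; have := half_le_Lam delta_gt0 delta_lt1; lra.
Qed.

Section Trial.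
Variables (tau : nat) (u : nat -> R).
Hypothesis tau_n : (tau < n)%N.
Hypothesis u_gen : forall y, (y < m * d)%N ->
  u y = gen_dir n coin (trial_M tau) (tau * (m * d * n)) y.
Local Notation M := (trial_M tau).
Local Notation eta := (2 * (eta0 * inv_decay M)).

Lemma u_outcome y : (y < m * d)%N -> u y = bit_dir n (coin_bits outcome) M (tau * block) y.
Proof. by move=> yd; rewrite u_gen// gen_dir_outcome. Qed.

Lemma u_le y : (y < m * d)%N -> `|u y| <= 2 * M.
Proof.
by move=> yd; rewrite u_outcome// bit_dir_le//; have := trial_M_ge1 tau; lra.
Qed.

Lemma noise_le (s : R) (j0 : 'I_d) x : used_scale n s -> (x < Q ^ m)%N ->
  cmod (ecf sample n (freq d m Q u s j0 x) / charfun D (freq d m Q u s j0 x) -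
        mix_cf w mu (freq d m Q u s j0 x)) <= eta.
Proof.
move=> us xQ; have [a sa] := used_scaleP us.
have M1 := trial_M_ge1 tau; have Q0 := nbase_gt0 n.
set t := freq d m Q u s j0 x.
have tE : t = test_freq delta outcome tau x a j0.
  by rewrite /t /test_freq sa; apply: freq_ext => y yd; exact: u_outcome.
have tN : norm2 t <= 4 * (Q%:R * Q%:R) * (M * d%:R).
  apply: norm_freq_le => //; [exact: (ndir_le_nbase n_gt0)|exact: (used_scale_le1 us)|exact: u_le].
have T1 : 1 <= 4 * (Q%:R * Q%:R) * (M * d%:R).
  have Q1 : 1 <= Q%:R :> R by rewrite ler1n.
  apply: mulr_ege1; last by apply: mulr_ege1 => //; rewrite ler1n.
  by apply: mulr_ege1; [lra|exact: mulr_ege1].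
have pge := charfun_ge c0_gt0 d_gt0 sfd N0_ge N1_ge N2_ge T1 tN.
have i1 := inv_decay_ge1 n N1 N2 d_gt0 N0_gt0 M1.
have i0 : 0 < (inv_decay M)^-1 by rewrite invr_gt0; move: i1; rewrite /(inv_decay M); lra.
have p0 : 0 < cmod (charfun D t) by apply: lt_le_trans pge.
have phi0 : charfun D t != 0.
  by apply: contraTneq p0 => ->; rewrite Normc.normc0 ltxx.
have nodev c : ~ dev_event D w mu X (wave c t) eta0 omega by rewrite tE; exact: no_dev.
apply: le_trans (noise_of_no_dev phi0 nodev) _.
rewrite -mulrA ler_wpM2l// ler_wpM2l ?sqrtr_ge0//.
rewrite -[leRHS]invrK lef_pV2 ?posrE//.
Qed.

Variable W : nat -> R.
Hypothesis W_binom : forall a, (a < Q)%N -> W a = 'C(Q.-1, a)%:R / 2 ^+ Q.-1.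

Lemma rho_ge0 : 0 <= rho.
Proof. by rewrite divr_ge0// mulr_ge0// exprn_ge0. Qed.

Lemma rhoE : rho = 1 / (64 * (2 ^ r)%:R). Proof. by rewrite natrX. Qed.

Lemma tail_le : expR (- (Q.-1%:R * rho ^+ 2)) <= n%:R^-1 ^+ 2.
Proof. by rewrite rhoE; exact: tail_nbase. Qed.

(** Valid at every scale, also before [M] reaches [d / gamma]: the picks certify themselves. As
    [k > 0], an accepted candidate exists, and it bounds the threshold as the weight estimate
    requires. *)
Lemma found_accurate (pick : nat -> nat) (out : nat -> R) :
  picks_spec sample (charfun D) k m n Q (2 ^ r) W u (theta M * theta M) (Q ^ m) k pick ->
  outs_spec sample (charfun D) m n Q W u k pick out ->
  accurate eps w mu (fun j => out (j * d.+1)%N)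
    (fun j => [tuple out (j * d.+1 + 1 + i)%N | i < d]).
Proof.
move=> picks outs; have M1 := trial_M_ge1 tau; have Q0 := nbase_gt0 n.
have [e0 thb ep ep1 [th0 eth m1 m2 m3]] :=
  trial_facts N1 N2 d_gt0 N0_gt0 eps_gt0 eps_lt1 delta_gt0 delta_lt1 ceE ctE n_gt0 M1.
have n0 : 0 <= (n%:R^-1 : R) by rewrite invr_ge0.
have M0 : 0 <= M by lra.
have r0 : (0 < 2 ^ r)%N by rewrite expn_gt0.
apply: (accurate_of_picks Q0 n_gt0 d_gt0 W_binom w_gt0 sum_w noise_le e0 n0 rho_ge0 tail_le
  thb ep ep1 th0 u_le M0 r0 rhoE eth picks outs mu_small m1 _ _); first by rewrite rhoE.
apply: m3; have [_ acc _ _] := picks; have [_ acc0] := acc 0%N k_gt0.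
exact: (th_le_accepted Q0 d_gt0 W_binom w_gt0 sum_w noise_le th0 acc0).
Qed.

Lemma all_found cnt (pick : nat -> nat) :
  picks_spec sample (charfun D) k m n Q (2 ^ r) W u (theta M * theta M) (Q ^ m) cnt pick ->
  M <= 7 * g ^+ 2 ->
  (forall j j', j != j' -> exists i : 'I_m, 6 * rho < sdist (dirdot u (mu j) i - dirdot u (mu j') i)) ->
  (k <= cnt)%N.
Proof.
move=> picks M7 gap; have M1 := trial_M_ge1 tau; have Q0 := nbase_gt0 n.
have [e0 thb ep ep1 [th0 eth m1 m2 m3]] :=
  trial_facts N1 N2 d_gt0 N0_gt0 eps_gt0 eps_lt1 delta_gt0 delta_lt1 ceE ctE n_gt0 M1.
have n0 : 0 <= (n%:R^-1 : R) by rewrite invr_ge0.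
have M0 : 0 <= M by lra.
have r0 : (0 < 2 ^ r)%N by rewrite expn_gt0.
apply: (picks_complete Q0 n_gt0 d_gt0 W_binom w_gt0 sum_w noise_le e0 n0 rho_ge0 tail_le
  thb ep ep1 th0 M0 r0 rhoE eth picks gap _ (ndir_nbase n_gt0)).
  rewrite rhoE; have Qr : 0 < Q%:R :> R by rewrite ltr0n.
  have rr : 0 < 64 * (2 ^ r)%:R :> R by rewrite mulr_gt0// ltr0n.
  rewrite ler_pdivlMr// mulrAC ler_pdivrMr// mul1r.
  have := nbase_ge n_gt0; rewrite -(ler_nat R) natrM natrX => h; lra.
move=> j; have := theta_wmin M1 M7; have := wmin_le j; move: eth; lra.
Qed.

End Trial.

(** An execution in which every trial fell short is impossible: the coin pattern is not bad, so one
    of the [L] useful trials merges no pair, and that trial would have found all components. *)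
Lemma accurate_off_failure (W out : nat -> R) :
  (forall a, (a < Q)%N -> W a = 'C(Q.-1, a)%:R / 2 ^+ Q.-1) ->
  result_spec N0 N1 N2 ce ct sample coin (charfun D) k m n Q (2 ^ r) l eps delta W out ->
  accurate eps w mu (fun j => out (j * d.+1)%N)
    (fun j => [tuple out (j * d.+1 + 1 + i)%N | i < d]).
Proof.
move=> W_binom [[tau [u [pick [tn [ug picks] outs]]]]|none].
  exact: (found_accurate tn ug W_binom picks outs).
have nb : outcome \notin bad_patterns m n L t0 mu trial_M rho.
  apply/negP => h; apply: good; left; exists outcome; first exact: h.
  exact: outcome_event.
move: nb; rewrite inE negb_forall => /existsP[t]; rewrite negb_exists => /forallP nm.
have tn : (t0 + t < n)%N by have := ltn_ord t; move: tLn; lia.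
have [cnt [u [pick [ck [ug picks]]]]] := none _ tn.
have /andP[_ M7] := M_itv (ltn_ord t).
suff : (k <= cnt)%N by rewrite leqNgt ck.
apply: (all_found tn ug W_binom picks M7) => j j' jj'.
have [i h] : exists i : 'I_m,
    ~~ (sdist (loc_diff t0 mu trial_M outcome t (j, j') i) <= 6 * rho).
  by apply/existsP; have := nm (j, j'); rewrite /merged jj' andTb negb_forall.
exists i; move: h; rewrite -ltNge /loc_diff /=.
have ue y : (y < m * d)%N -> u y = pattern_dir t0 trial_M outcome t y.
  by move=> yd; rewrite (u_outcome tn ug).
by rewrite !(dirdot_ext _ _ ue).
Qed.

End Accuracy.

(** * What minimal separation and maximal norm imply *)

Section Mixture.
Variables (R : realType) (d k : nat) (w : 'I_k -> R) (mu : 'I_k -> d.-tuple R).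
Variables (gamma B : R).
Hypothesis min_gamma : is_min (separations mu) gamma.
Hypothesis gamma_gt0 : 0 < gamma.
Hypothesis max_B : is_max (range (fun j => norm2 (mu j))) B.

Lemma coord_le_norm2 (x : d.-tuple R) c : `|tnth x c| <= norm2 x.
Proof.
rewrite -sqrtr_sqr /norm2 ler_wsqrtr// /inner (bigD1 c)//= -expr2 lerDl.
by apply: sumr_ge0 => i _; rewrite -expr2 sqr_ge0.
Qed.

Lemma dim_gt0 : (0 < d)%N.
Proof.
have [[j [j' [_ e]]] _] := min_gamma; rewrite lt0n; apply/eqP => d0.
move: gamma_gt0; rewrite e /norm2 /inner; move: (vsub _ _) => x.
rewrite big1 ?sqrtr0 ?ltxx// => i _.
by have := ltn_ord i; rewrite {2}d0.
Qed.

Lemma components_gt0 : (0 < k)%N.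
Proof. by have [[j _] _] := min_gamma; apply: leq_ltn_trans (ltn_ord j). Qed.

Lemma max_coord (x : d.-tuple R) : exists c, norm2 x <= d%:R * `|tnth x c|.
Proof.
pose c0 := Ordinal dim_gt0; exists [arg max_(c > c0) `|tnth x c|]%O.
case: arg_maxP => // c _ cm; apply: norm2_le => // [|i]; first exact: dim_gt0.
exact: cm.
Qed.

Lemma coord_gap (j j' : 'I_k) : j != j' ->
  exists c : 'I_d, gamma / d%:R <= `|tnth (mu j) c - tnth (mu j') c|.
Proof.
move=> jj'; have [c h] := max_coord (vsub (mu j) (mu j')).
exists c; have d0 : 0 < d%:R :> R by rewrite ltr0n dim_gt0.
rewrite ler_pdivrMr// mulrC; move: h; rewrite tnth_mktuple; apply: le_trans.
by have [_] := min_gamma; apply; exists j', j.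
Qed.

Lemma coord_le_B j (c : 'I_d) : `|tnth (mu j) c| <= B.
Proof.
apply: le_trans (coord_le_norm2 _ _) _; have [_] := max_B; apply.
by exists j.
Qed.

(** Two means whose coordinates differ by [gamma / d] cannot both be close to the origin, so
    [B >= gamma / (2 * d)]; and [d / gamma <= g ^ 2]. *)
Lemma B_lower : 1 / (2 * (d%:R + gamma^-1) ^+ 2) <= B.
Proof.
have [[j [j' [jj' e]]] _] := min_gamma.
have [c h] := coord_gap jj'.
have := ler_normB (tnth (mu j') c) (tnth (mu j) c).
have := coord_le_B j c; have := coord_le_B j' c => b1 b2 b3.
have d1 : 1 <= d%:R :> R by rewrite ler1n dim_gt0.
have gi : 0 < gamma^-1 by rewrite invr_gt0.
apply: (@le_trans _ _ (gamma / d%:R / 2)); last by lra.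
have -> : gamma / d%:R / 2 = 1 / (2 * (d%:R * gamma^-1)) by field; rewrite !gt_eqF//; lra.
have p0 : 0 < d%:R * gamma^-1 by rewrite mulr_gt0//; lra.
rewrite !div1r lef_pV2 ?posrE; [|rewrite mulr_gt0// exprn_gt0//; lra|lra].
rewrite ler_wpM2l// expr2; have := ltW gi; nra.
Qed.

End Mixture.

(** [2 ^ (48 * l) + 4 <= 2 ^ (49 * l)], and [2 ^ l <= 2 * n <= n ^ 2] turns this into [n ^ 98]. *)
Lemma time_bound (n e : nat) : (2 <= n)%N -> (0 < e)%N ->
  ((2 ^ (48 * ell n)).+4 ^ e <= (98 * e) * n ^ (98 * e))%N.
Proof.
move=> n2 e0; have n0 : (0 < n)%N by apply: ltnW.
have l0 := ell_gt0 n0.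
have h1 : ((2 ^ (48 * ell n)).+4 <= 2 ^ (49 * ell n))%N.
  have -> : (49 * ell n = 48 * ell n + ell n)%N by lia.
  rewrite expnD; have a4 : (4 <= 2 ^ (48 * ell n))%N.
    by rewrite -[X in (X <= _)%N]/(2 ^ 2)%N leq_exp2l//; lia.
  have a2 : (2 <= 2 ^ ell n)%N by rewrite -[X in (X <= _)%N]/(2 ^ 1)%N leq_exp2l.
  by move: a4 a2; move: (2 ^ (48 * ell n))%N (2 ^ ell n)%N => a b; nia.
have h2 : (2 ^ (49 * ell n) <= n ^ 98)%N.
  rewrite mulnC expnM [X in (_ <= X)%N](_ : _ = (n ^ 2) ^ 49)%N; last by rewrite -expnM.
  rewrite leq_exp2r//; apply: leq_trans (expn_ell_le n0) _.
  by rewrite -mulnn leq_mul2r n2 orbT.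
apply: (@leq_trans ((n ^ 98) ^ e)); first by rewrite leq_exp2r// (leq_trans h1).
by rewrite -expnM leq_pmull// muln_gt0.
Qed.

Theorem theorem3p2 (R : realType) (c1 c2 : R) (hc1 : 0 <= c1) (hc2 : 0 <= c2) :
  exists q : nat, forall c0 : R, 0 < c0 ->
  exists (algorithm : program) (C : R) (p a : nat),
  forall (d k : nat) (D : probability (d.-tuple R) R)
    (w : 'I_k -> R) (mu : 'I_k -> d.-tuple R) (gamma wmin B : R),
    slow_fourier_decay c0 c1 c2 D ->
    (forall j, 0 < w j) -> \sum_(j < k) w j = 1 ->
    is_min (separations mu) gamma -> 0 < gamma ->
    is_min (range w) wmin ->
    is_max (range (fun j => norm2 (mu j))) B ->
  forall (eps delta : R), 0 < eps < 1 -> 0 < delta < 1 ->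
  forall n : nat, soft C p (sample_rate d q gamma wmin B eps delta) <= n%:R ->
  forall (disp : measure_display) (Omega : measurableType disp)
    (P : probability Omega R)
    (X : 'I_n -> {RV P >-> d.-tuple R}) (U : nat -> {RV P >-> R}),
    iid_samples_and_coins (mixture D w mu) X U ->
  exists success : set Omega,
    [/\ measurable success,
        ((1 - delta)%:E <= P success)%E
      & forall omega : Omega, exists (t : nat) (s : state R),
        [/\ exec (sample_at (fun i => X i omega)) (fun l => U l omega)
              (charfun D) algorithm (init_state d k n eps delta) t s,
            (t <= a * n ^ a)%N
          & success omega ->
            accurate eps w mu
              (fun j : 'I_k => out_weight d s j)
              (fun j : 'I_k => out_mean d s j)]].

Proof.
have natge (c : R) : 0 <= c -> exists N : nat, c <= N%:R /\ (0 < N)%N.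
  move=> c_ge0; exists (Num.truncn c).+1; split=> //.
  by have /andP[_ /ltW] := Num.Theory.truncn_itv c_ge0.
have [N1 [N1_ge _]] := natge c1 hc1.
have [N2 [N2_ge _]] := natge c2 hc2.
(* The degree depends only on the roundings of [c1] and [c2]; the hidden constant [c0] enters
   through [N0], in the program and in [C]. *)
exists (exp_g N1 N2 + 4)%N => c0 c0_gt0.
have [|N0 [N0_ge N0_gt0]] := natge c0^-1; first by rewrite invr_ge0 ltW.
have [ce ceE] : exists ce, ce = (128 * 60)%N by exists (128 * 60)%N.
have [ct ctE] : exists ct, ct = 1152%N by exists 1152%N.
have [C1 C1E] : exists C1 : R, C1 = 64 * (ct%:R ^+ 2 * ce%:R * const_K R N0 N2 ^+ 2) by eexists.
have C1_gt0 : 0 < C1.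
  have K_gt0 : 0 < const_K R N0 N2 by apply: lt_le_trans (const_K_ge R N2 N0_gt0).
  rewrite C1E; apply: mulr_gt0 => //; apply: mulr_gt0; last exact: exprn_gt0.
  by apply: mulr_gt0; [apply: exprn_gt0|]; rewrite ltr0n ?ceE ?ctE.
have [C [C_gt0 growth]] := soft_growth (exp_l N2) C1_gt0.
pose e := depth (estimator N0 N1 N2 ce ct).
have e_gt0 : (0 < e)%N := depth_gt0 _.
exists (estimator N0 N1 N2 ce ct), C, (exp_l N2), (98 * e)%N.
move=> d k D w mu gamma wmin B sfd w_gt0 sum_w min_gamma gamma_gt0 min_w max_B.
move=> eps delta /andP[eps_gt0 eps_lt1] /andP[delta_gt0 delta_lt1] n n_ge.
move=> disp Omega P X U XU.
have d_gt0 := dim_gt0 min_gamma gamma_gt0; have k_gt0 := components_gt0 min_gamma.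
have B_ge := B_lower min_gamma gamma_gt0 max_B.
have g_gt0 : 0 < d%:R + gamma^-1 by rewrite addr_gt0 ?invr_gt0// ltr0n.
have B_gt0 : 0 < B.
  by apply: lt_le_trans B_ge; rewrite divr_gt0// mulr_gt0// exprn_gt0.
have [[j0 _ wj0] wmin_lb] := min_w.
have wmin_gt0 : 0 < wmin by rewrite -wj0.
have wmin_le j : wmin <= w j by apply: wmin_lb; exists j.
have k_wmin : k%:R * wmin <= 1.
  rewrite -[leRHS]sum_w -[X in X%:R * _ <= _]card_ord -sum1_card natr_sum mulr_suml.
  by apply: ler_sum => j _; rewrite mul1r.
have Lam_gt0 : 0 < ln (2 / delta) by have := half_le_Lam delta_gt0 delta_lt1; lra.
set F := sample_rate _ _ _ _ _ _ _ in n_ge.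
have F_gt0 : 0 < F.
  by rewrite /F /sample_rate divr_gt0// !mulr_gt0// exprn_gt0.
have n_gt0 : (0 < n)%N.
  rewrite -(ltr_nat R); apply: lt_le_trans n_ge; rewrite /soft.
  apply: mulr_gt0; first exact: mulr_gt0.
  by apply: exprn_gt0; apply: ln_gt0; lra.
have rate := growth F n F_gt0 n_gt0 n_ge.
have [nLam ng n128 dn [kn Bn eta0E eta0_itv th_wmin]] :=
  rate_facts d_gt0 k_gt0 N0_gt0 gamma_gt0 wmin_gt0 k_wmin eps_gt0 eps_lt1 delta_gt0 delta_lt1
    B_ge ceE ctE C1E n_gt0 rate.
have [t0 [L [L_ge tLn M_itv]]] := trial_range d_gt0 delta_gt0 delta_lt1 gamma_gt0 nLam.
have [room rn] := exp_room n_gt0 ng (leq_trans (isT : (16 <= 128)%N) n128) (ltW B_gt0) Bn.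
have szs := sizes_bound n_gt0 d_gt0 k_gt0 dn kn.
have [_ _ _ _ [_ _ QmK _ _]] := szs.
have QK : (nbase n <= (2 ^ (48 * ell n)).+4)%N.
  apply: leq_trans QmK; rewrite -[X in (X <= _)%N]expn1 leq_pexp2l//; exact: nbase_gt0.
have rK : (3 * loglog n + 13 <= (2 ^ (48 * ell n)).+4)%N.
  by apply: leq_trans QK; apply: ltnW; apply: ltn_expl.
have lK : (ell n <= (2 ^ (48 * ell n)).+4)%N.
  apply: leq_trans (_ : 48 * ell n <= _)%N; first by rewrite leq_pmull.
  by do 4!apply: leqW; apply: ltnW; apply: ltn_expl.
exists (~` failure ce D w mu delta X U t0 L).
have mf := measurable_failure ce delta t0 L XU.
split; first exact: measurableC.
  rewrite -fine_prK ?lee_fin ?pr_setC//; last exact: measurableC.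
  rewrite lerD2l lerN2; apply: pr_failure_le => //; last first.
    by apply: (noise_budget n_gt0 d_gt0 k_gt0 dn kn delta_gt0 delta_lt1); rewrite eta0E ceE.
  apply: le_trans (coin_budget n_gt0 d_gt0 k_gt0 dn kn delta_gt0 delta_lt1 L_ge).
  have bad := card_bad_patterns (ndir n) tLn rn d_gt0 gamma_gt0 (coord_le_B max_B)
    (coord_gap min_gamma gamma_gt0).
  have {bad} := bad (trial_M delta) (1 / (64 * 2 ^+ loglog n)) _ _ erefl.
  set bp := bad_patterns _ _ _ _ _ _ _ => bad.
  rewrite ler_pdivrMr ?exprn_gt0// mulrAC ler_pdivlMr ?ltr0n ?expn_gt0//.
  rewrite -natrX -!natrM ler_nat; apply: bad => t tL; have /andP[h1 h2] := M_itv t tL => //.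
  by apply: le_trans room; rewrite ler_wpM2r// mulr_ge0// ltW.
move=> omega.
(* Halting in polynomial time is proved for every [omega]; only the accuracy is conditional on the
   good event, so it sits inside the postcondition. *)
pose post (s : state R) := ~ failure ce D w mu delta X U t0 L omega ->
  accurate eps w mu (fun j : 'I_k => out_weight d s j) (fun j : 'I_k => out_mean d s j).
have [t [s' [ex [tK ps]]]] : wp (sample_at (fun i => X i omega)) (fun i => U i omega)
    (charfun D) (2 ^ (48 * ell n)) (estimator N0 N1 N2 ce ct) post (init_state d k n eps delta).
  apply: (wp_estimator szs n_gt0 lK rK QK) => W s' W_binom res good.
  have mu_small j (i : 'I_d) : `|tnth (mu j) i| <= 2 ^+ n.-1.
    apply: le_trans (coord_le_B max_B j i) (le_trans Bn _).
    by rewrite -natrX ler_nat -[X in (X <= _)%N](prednK n_gt0) ltn_expl.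
  have := accurate_off_failure n_gt0 d_gt0 k_gt0 N0_gt0 ceE ctE eps_gt0 eps_lt1 delta_gt0
    delta_lt1 w_gt0 sum_w wmin_le c0_gt0 sfd N0_ge N1_ge N2_ge th_wmin tLn M_itv mu_small
    good W_binom res.
  set w1 := (fun j : 'I_k => _); set m1 := (fun j : 'I_k => _).
  have -> : w1 = (fun j : 'I_k => out_weight d s' j).
    apply: funext => j; rewrite /w1 ifT// ltn_mul2r /=; exact: ltn_ord.
  have -> // : m1 = (fun j : 'I_k => out_mean d s' j).
  apply: funext => j; apply: eq_from_tnth => i; rewrite !tnth_mktuple ifT//.
  apply: (@leq_trans (j * d.+1 + d.+1)); first by rewrite -addnA ltn_add2l add1n ltnS.
  by rewrite -mulSnr leq_mul2r ltn_ord orbT.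
exists t, s'; split=> //.
apply: leq_trans tK _; apply: time_bound => //; exact: leq_trans n128.
Qed.
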